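(* Let $q^1,\dots,q^m$ be i.i.d. samples from a distribution $\mathbb P$ on $\Delta_n$, let $p^1\in\Delta_n$, and let $\hat p_{\varepsilon'}\in\Delta_n$ be such that $$\frac1m\sum_{k=1}^mW(\hat p_{\varepsilon'},q^k)+\lambda B_d(\hat p_{\varepsilon'},p^1)-\min_{p\in\Delta_n}\left\{\frac1m\sum_{k=1}^mW(p,q^k)+\lambda B_d(p,p^1)\right\}\le\varepsilon'.$$ Let $W(p)=\mathbb{E}_{q\sim\mathbb P}W(p,q)$ and $p^*\in\arg\min_{p\in\Delta_n}W(p)$. To satisfy $W(\hat p_{\varepsilon'})-W(p^* )\le\varepsilon$ with probability at least $1-\beta$, it suffices to take $\lambda=\varepsilon/(2R_d^2)$ and $$m=\widetilde O\left(\frac{\|C\|_\infty^2}{\beta\varepsilon^2}\right),\qquad\varepsilon'=\widetilde O\left(\frac{\varepsilon^3}{\|C\|_\infty^2}\right),$$ where $R_d^2=B_d(p^*,p^1)=O(\log n)$. The total complexity of Mirror Prox computing $\hat p_{\varepsilon'}$ is $$\widetilde O\left(\frac{n^2\sqrt n\,\|C\|_\infty^5}{\varepsilon^5}\right).$$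
   Context: $\Delta_n$ is the probability simplex; $C\in\mathbb{R}^{n\times n}_+$ is a symmetric cost matrix with $\|C\|_\infty$ its largest entry; $W(p,q)=\min\{\langle C,\pi\rangle:\pi\in\mathbb{R}^{n\times n}_+,\pi\mathbf 1=p,\pi^\top\mathbf 1=q\}$. The prox-function is $d(p)=\frac1{2(a-1)}\|p\|_a^2$ with $a=1+\frac1{2\log n}$ and $B_d(p,p^1)=d(p)-d(p^1)-\langle\nabla d(p^1),p-p^1\rangle$; $B_d(\cdot,p^1)$ is $1$-strongly convex and $\widetilde O(1)$-Lipschitz in the $\ell_1$-norm on $\Delta_n$. Standing convention: measures are bounded away from the boundary of $\Delta_n$ (after adding a small noise and normalizing), so that $W(\cdot,q)$ is Lipschitz in the $\ell_1$-norm with constant $O(\|C\|_\infty)$. Mirror Prox is applied to the saddle-point form of the penalized problem $$\min_{p\in\Delta_n,\ x_i\in\Delta_{n^2}}\ \max_{y_i\in[-1,1]^{2n}}\ \frac1m\sum_{i=1}^m\Big\{c^\top x_i+2\|c\|_\infty\big(y_i^\top Ax_i-(p^\top,(q^i)^\top)y_i\big)\Big\}+\lambda B_d(p,p^1),$$ where $c$ is the vectorized $C$, $x_i$ is a vectorized transport plan, and $A\in\{0,1\}^{2n\times n^2}$ maps a vectorized plan $\pi$ to its pair of marginals $(\pi\mathbf 1,\pi^\top\mathbf 1)$. Complexity counts arithmetic operations. $\widetilde O$ hides logarithmic factors; setting a parameter to $\widetilde O(E)$ means with a suitable constant and logarithmic factor. In the complexity bound $\beta$ is treated as a fixed constant.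 *)

(* Defs.v *)
From HB Require Import structures.
From mathcomp Require Import all_boot all_order all_algebra.
From mathcomp Require Import all_classical all_reals all_analysis.

Set Implicit Arguments.
Unset Strict Implicit.
Unset Printing Implicit Defensive.
Import Order.TTheory GRing.Theory Num.Theory.
Import numFieldNormedType.Exports.
Local Open Scope classical_set_scope.
Local Open Scope ring_scope.

Definition is_argmin (R : realType) (T : Type) (S : set T) (f : T -> R) (x : T) :=
  S x /\ forall y, S y -> f x <= f y.

Definition simplex (R : realType) (k : nat) : set 'cV[R]_k :=
  [set p : 'cV[R]_k | (forall i, 0 <= p i 0) /\ \sum_i p i 0 = 1].
Arguments simplex R k : clear implicits.

Definition frobenius (R : realType) (r c : nat) (M N : 'M[R]_(r, c)) : R :=
  \sum_i \sum_j M i j * N i j.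

Definition plans (R : realType) (n : nat) (p q : 'cV[R]_n) : set 'M[R]_n :=
  [set pi : 'M[R]_n | [/\ forall i j, 0 <= pi i j,
                pi *m const_mx 1 = p & pi^T *m const_mx 1 = q]].

(* For p and q in the simplex the infimum is attained. *)
Definition transport (R : realType) (n : nat) (C : 'M[R]_n) (p q : 'cV[R]_n) : R :=
  inf [set frobenius C pi | pi in plans p q].

Definition borel_cV (R : realType) (n : nat) :=
  g_sigma_algebraType (@open 'cV[R]_n).

Definition expected_transport (R : realType) (n : nat) (C : 'M[R]_n)
    (P : probability (borel_cV R n) R) (p : 'cV[R]_n) : R :=
  \int[P]_q transport C p q.

Definition bregman (R : realType) (V : normedModType R) (f : V -> R) (u v : V) : R :=
  f u - f v - 'D_(u - v) f v.

Definition lnorm (R : realType) (n : nat) (a : R) (p : 'cV[R]_n) : R :=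
  (\sum_i `|p i 0| `^ a) `^ a^-1.

Definition prox_exponent (R : realType) (n : nat) : R := 1 + (2 * ln n%:R)^-1.

Definition prox_fun (R : realType) (n : nat) (p : 'cV[R]_n) : R :=
  (2 * (prox_exponent R n - 1))^-1 * lnorm (prox_exponent R n) p ^+ 2.

Definition Bd (R : realType) (n : nat) (p p1 : 'cV[R]_n) : R :=
  bregman (@prox_fun R n) p p1.

Definition penalized (R : realType) (n m : nat) (C : 'M[R]_n)
    (q : 'I_m -> 'cV[R]_n) (lam : R) (p1 p : 'cV[R]_n) : R :=
  m%:R^-1 * (\sum_k transport C p (q k)) + lam * Bd p p1.

(* The infimum is attained: the penalized objective is continuous on the simplex. *)
Definition penalized_gap (R : realType) (n m : nat) (C : 'M[R]_n)
    (q : 'I_m -> 'cV[R]_n) (lam : R) (p1 p : 'cV[R]_n) : R :=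
  penalized C q lam p1 p -
  inf [set penalized C q lam p1 p' | p' in simplex R n].

(* Mutual independence of a finite family: taking some of the B k to be setT
   gives the product rule for every subfamily. *)
Definition iid (R : realType) (d d' : measure_display) (O : measurableType d)
    (T : measurableType d') (Pr : probability O R) (P : probability T R)
    (m : nat) (X : 'I_m -> O -> T) : Prop :=
  [/\ forall k, measurable_fun setT (X k),
      forall k (B : set T), measurable B -> Pr (X k @^-1` B) = P B
    & forall B : 'I_m -> set T, (forall k, measurable (B k)) ->
        Pr (\bigcap_k (X k @^-1` B k)) = (\prod_k Pr (X k @^-1` B k))%E].

(* S need not be measurable; for measurable S this is t <= Pr S. *)
Definition with_probability_at_least (R : realType) (d : measure_display)
    (O : measurableType d) (Pr : probability O R) (t : R) (S : set O) : Prop :=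
  exists2 E, measurable E /\ (t%:E <= Pr E)%E & E `<=` S.

(* column (i, j) has its two ones in rows i and n + j *)
Definition incidence (R : realType) (n : nat) : 'M[R]_(n + n, n * n) :=
  \sum_i \sum_j (delta_mx (lshift n i) (mxvec_index i j) +
                 delta_mx (rshift n j) (mxvec_index i j)).

Definition vectorize (R : realType) (n : nat) (C : 'M[R]_n) : 'cV[R]_(n * n) :=
  (mxvec C)^T.

Lemma incidenceE (R : realType) (n : nat) (pi : 'M[R]_n) :
  incidence R n *m vectorize pi = col_mx (pi *m const_mx 1) (pi^T *m const_mx 1).
Proof.
have deltaE (k : 'I_(n + n)) i j :
    delta_mx k (mxvec_index i j) *m vectorize pi = pi i j *: delta_mx k 0.
  apply/colP => l; rewrite !mxE (bigD1 (mxvec_index i j)) //= big1 => [|s sN].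
    by rewrite !mxE !eqxx !andbT addr0 mxvecE mulrC.
  by rewrite !mxE (negPf sN) andbF mul0r.
apply/colP => k; rewrite /incidence mulmx_suml summxE.
under eq_bigr => i _.
  rewrite mulmx_suml summxE.
  under eq_bigr => j _ do rewrite mulmxDl !deltaE !mxE eqxx !andbT.
  over.
case: (split_ordP k) => l ->; rewrite ?col_mxEu ?col_mxEd !mxE.
  rewrite (bigD1 l) //= [X in _ + X]big1 ?addr0 => [|i iN]; last first.
    rewrite big1 // => j _.
    by rewrite eq_lrshift eq_lshift eq_sym (negPf iN) !mulr0 addr0.
  by apply: eq_bigr => j _; rewrite eq_lrshift eqxx !mxE mulr0 addr0.
apply: eq_bigr => i _; rewrite (bigD1 l) //= big1 ?addr0 => [|j jN].
  by rewrite eq_rlshift eqxx !mxE mulr0 add0r.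
by rewrite eq_rlshift eq_rshift eq_sym (negPf jN) !mulr0 addr0.
Qed.

(* The m plans x_i and the m dual vectors y_i are stored as columns. *)
Record state (R : realType) (n m : nat) := State {
  st_p : 'cV[R]_n;
  st_x : 'M[R]_(n * n, m);
  st_y : 'M[R]_(n + n, m) }.

Definition feasible (R : realType) (n m : nat) : set (state R n m) :=
  [set z : state R n m | [/\ simplex R n (st_p z),
               forall i, simplex R (n * n) (col i (st_x z))
             & forall k i, -1 <= st_y z k i <= 1]].
Arguments feasible R n m : clear implicits.

Definition saddle (R : realType) (n m : nat) (C : 'M[R]_n)
    (q : 'I_m -> 'cV[R]_n) (lam : R) (p1 : 'cV[R]_n)
    (p : 'cV[R]_n) (x : 'M[R]_(n * n, m)) (y : 'M[R]_(n + n, m)) : R :=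
  m%:R^-1 * (\sum_i
    (frobenius (vectorize C) (col i x) +
     2 * `|vectorize C| *
       (frobenius (col i y) (incidence R n *m col i x) -
        frobenius (col_mx p (q i)) (col i y)))) +
  lam * Bd p p1.

Definition grad (R : realType) (r c : nat) (f : 'M[R]_(r, c) -> R)
    (u : 'M[R]_(r, c)) : 'M[R]_(r, c) :=
  \matrix_(i, j) 'D_(delta_mx i j) f u.

(* the monotone operator (grad_p F, grad_x F, - grad_y F) *)
Definition saddle_operator (R : realType) (n m : nat)
    (F : 'cV[R]_n -> 'M[R]_(n * n, m) -> 'M[R]_(n + n, m) -> R)
    (z : state R n m) : state R n m :=
  State (grad (fun p => F p (st_x z) (st_y z)) (st_p z))
        (grad (fun x => F (st_p z) x (st_y z)) (st_x z))
        (- grad (fun y => F (st_p z) (st_x z) y) (st_y z)).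

(* ln 0 = 0, so that 0 ln 0 = 0 *)
Definition entropy (R : realType) (r c : nat) (u : 'M[R]_(r, c)) : R :=
  \sum_i \sum_j u i j * ln (u i j).

Definition half_sqnorm (R : realType) (r c : nat) (u : 'M[R]_(r, c)) : R :=
  2^-1 * frobenius u u.

(* Entropic setup on the simplices, Euclidean setup on the box; the step size
   and the relative weights of the blocks are merged into (sp, sx, sy). *)
Definition prox_divergence (R : realType) (n m : nat) (sp sx sy : R)
    (z z0 : state R n m) : R :=
  sp^-1 * bregman (@entropy R n 1) (st_p z) (st_p z0) +
  sx^-1 * bregman (@entropy R (n * n) m) (st_x z) (st_x z0) +
  sy^-1 * bregman (@half_sqnorm R (n + n) m) (st_y z) (st_y z0).

Definition is_prox (R : realType) (n m : nat) (sp sx sy : R)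
    (z0 g : state R n m) : state R n m -> Prop :=
  is_argmin (feasible R n m) (fun z =>
    frobenius (st_p g) (st_p z) + frobenius (st_x g) (st_x z) +
    frobenius (st_y g) (st_y z) + prox_divergence sp sx sy z z0).

Definition mirror_prox (R : realType) (n m : nat)
    (F : 'cV[R]_n -> 'M[R]_(n * n, m) -> 'M[R]_(n + n, m) -> R)
    (sp sx sy : R) (p1 : 'cV[R]_n) (z w : nat -> state R n m) : Prop :=
  z 0%N = State p1 (const_mx (n * n)%:R^-1) 0 /\
  forall k,
    is_prox sp sx sy (z k) (saddle_operator F (z k)) (w k) /\
    is_prox sp sx sy (z k) (saddle_operator F (w k)) (z k.+1).

Definition mirror_prox_output (R : realType) (n m : nat)
    (w : nat -> state R n m) (N : nat) : 'cV[R]_n :=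
  N%:R^-1 *: \sum_(k < N) st_p (w k).

(* Straight-line programs over real registers: each instruction performs one
   scalar operation and the cost of a program is its number of instructions.
   The only constants are natural numbers, so that a program depends on the
   data of the problem only through its input registers. *)
Inductive unop := Exp | Ln.
Inductive binop := Add | Sub | Mul | Div | Pow | Max | Min.
Inductive instr :=
  | Const (dst k : nat)
  | Un (f : unop) (dst src : nat)
  | Bin (f : binop) (dst src1 src2 : nat).

Definition eval_unop (R : realType) (f : unop) (a : R) : R :=
  match f with Exp => expR a | Ln => ln a end.

Definition eval_binop (R : realType) (f : binop) (a b : R) : R :=
  match f with
  | Add => a + b | Sub => a - b | Mul => a * b | Div => a / b
  | Pow => a `^ b | Max => Num.max a b | Min => Num.min a b
  end.

Definition exec (R : realType) (e : nat -> R) (i : instr) : nat -> R :=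
  match i with
  | Const dst k => [eta e with dst |-> k%:R]
  | Un f dst s => [eta e with dst |-> eval_unop f (e s)]
  | Bin f dst s t => [eta e with dst |-> eval_binop f (e s) (e t)]
  end.

Definition run (R : realType) (prog : seq instr) (e : nat -> R) : nat -> R :=
  foldl (@exec R) e prog.

Definition problem_data (R : realType) (n m : nat) (C : 'M[R]_n)
    (q : 'I_m -> 'cV[R]_n) (lam : R) (p1 : 'cV[R]_n) (sp sx sy : R) : seq R :=
  [:: lam; sp; sx; sy]
  ++ [seq C i j | i <- enum 'I_n, j <- enum 'I_n]
  ++ [seq p1 i 0 | i <- enum 'I_n]
  ++ [seq q k i 0 | k <- enum 'I_m, i <- enum 'I_n].

Definition computes (R : realType) (n : nat) (prog : seq instr) (input : seq R)
    (out : 'cV[R]_n) : Prop :=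
  forall i : 'I_n, run prog (nth 0 input) i = out i 0.

(* Main.v *)
(** Sampling. As B_d is strongly convex in the l1 norm, the penalized empirical
    objective grows quadratically around its minimizer; replacing one sample
    therefore moves an approximate minimizer by O(|C| / (lam m)), the expected
    generalization gap is O(|C|^2 / (lam m)), and Markov's inequality turns it
    into a failure probability. The samples are first rounded to a finite grid
    of the simplex: expectations become finite sums, and the success event
    contains a finite union of measurable cells although [phat] need not be
    measurable.

    Optimization. The operator of the saddle-point problem is Lipschitz relative
    to the weighted sum of the entropic and Euclidean divergences: Pinsker's
    inequality controls the bilinear part, and the gradient of B_d is controlled
    because B_d is smooth relative to the entropy. Mirror Prox thus has duality
    gap O(|C| sqrt(n) log^2 / N), and exact penalization bounds the gap of the
    penalized objective by the duality gap. The proximal steps are softmaxes and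
    clippings, so an iteration costs O(n^2 m) operations. *)

Require Import Defs.
From mathcomp Require Import all_boot all_order all_algebra.
From mathcomp Require Import all_classical all_reals all_analysis.
From mathcomp Require Import measurable_realfun.
From mathcomp Require Import ring lra zify.
Import Order.TTheory GRing.Theory Num.Theory.
Import numFieldNormedType.Exports.

Set Implicit Arguments.
Unset Strict Implicit.
Unset Printing Implicit Defensive.
Local Open Scope classical_set_scope.
Local Open Scope ring_scope.

(** * Power functions and relative entropy *)

(** [phat] is an arbitrary approximate minimizer, so stability is never applied to it: it is proved
    for auxiliary near-minimizers on the rounded samples, and quadratic growth places [phat] within
    about sqrt(eps' / lam) of them. Asking that |C| sqrt(eps' / lam) be of order eps, with lam at
    least of order eps / ln n, dictates eps' of order eps^3 / |C|^2. The complexity is the product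
    of n^2 operations per sample and iteration, |C|^2 / eps^2 samples and |C| sqrt(n) / eps'
    iterations. The gradient of the prox-function involves x_i^(a - 1), whose slope is infinite at
    the boundary, so it is not Lipschitz in any norm. Comparison with the entropy absorbs this at
    the price of a term lam ln n in an inverse step size. As lam = eps / (2 Rd2) has no upper bound
    when p1 is close to pstar, that term is controlled by restricting the competitors to points no
    worse than p1, for which lam KL is O(|C|) up to a logarithm. Infima over plans and over the
    simplex are approached up to a slack, never shown to be attained. *)

Section Scalar.
Context {R : realType}.
Implicit Types (x y s t a b th m M : R).

Lemma MVT_pos (h dh : R -> R) s t : 0 < s -> s <= t ->
  (forall z : R, 0 < z -> is_derive z 1 h (dh z)) ->
  exists2 c, s <= c <= t & h t - h s = dh c * (t - s).
Proof.
move=> s0 st hh.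
have pos z : s <= z -> 0 < z by apply: lt_le_trans.
have [||c] := @MVT_segment R h dh s t st.
- by move=> z /[!in_itv]/= /andP[/ltW/pos /hh].
- by apply: derivable_within_continuous => z /[!in_itv]/= /andP[/pos /hh []].
- by rewrite in_itv/=; exists c.
Qed.

(** A derivative nondecreasing on [m, M] gives convexity there. Applied to the difference of two
    functions, as in most estimates below, this compares their Bregman divergences and plays the
    part of a comparison of second derivatives. *)
Lemma bregman_scalar_ge0 (h dh : R -> R) m M x y : 0 < m ->
  (forall z : R, 0 < z -> is_derive z 1 h (dh z)) ->
  (forall s t, m <= s -> s <= t -> t <= M -> dh s <= dh t) ->
  m <= x <= M -> m <= y <= M -> dh x * (y - x) <= h y - h x.
Proof.
move=> m0 hh mono /andP[mx xM] /andP[my yM].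
have [xy|/ltW yx] := leP x y.
- have [|c /andP[xc cy] ->] := @MVT_pos h dh x y _ xy hh; first exact: lt_le_trans mx.
  by rewrite ler_wpM2r ?subr_ge0// mono// (le_trans cy).
- have [|c /andP[yc cx] e] := @MVT_pos h dh y x _ yx hh; first exact: lt_le_trans my.
  have -> : h y - h x = dh c * (y - x) by rewrite -opprB e; ring.
  by rewrite ler_wnM2r ?subr_le0// mono// (le_trans my).
Qed.

Lemma ln_sub_ge s t : 0 < s -> s <= t -> (t - s) / t <= ln t - ln s.
Proof.
move=> s0 st; have t0 : 0 < t by apply: lt_le_trans st.
have := @le_ln1Dx R (s / t - 1).
have -> : 1 + (s / t - 1) = s / t by ring.
have -> : -1 < s / t - 1 by rewrite -subr_gt0 opprK subrK divr_gt0.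
move=> /(_ isT); rewrite ln_div ?posrE// => h; rewrite mulrBl divff ?gt_eqF//; lra.
Qed.

Lemma ln_sub_le s t : 0 < s -> s <= t -> ln t - ln s <= (t - s) / s.
Proof.
move=> s0 st; have t0 : 0 < t by apply: lt_le_trans st.
have := @le_ln1Dx R (t / s - 1).
have -> : 1 + (t / s - 1) = t / s by ring.
have -> : -1 < t / s - 1 by rewrite -subr_gt0 opprK subrK divr_gt0.
by move=> /(_ isT); rewrite ln_div ?posrE// mulrBl divff ?gt_eqF.
Qed.

Lemma powR_neg_le s t r : r <= 0 -> 0 < s -> s <= t -> t `^ r <= s `^ r.
Proof.
move=> r0 s0 st; have t0 : 0 < t by apply: lt_le_trans st.
rewrite -[r]opprK powRN [leRHS]powRN lef_pV2 ?posrE ?powR_gt0//.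
by rewrite ge0_ler_powR ?nnegrE ?oppr_ge0// ltW.
Qed.

Lemma powR_sub_ge s t th M : 0 <= th <= 1 -> 0 < s -> s <= t -> t <= M ->
  th * M `^ (th - 1) * (t - s) <= t `^ th - s `^ th.
Proof.
move=> /andP[th0 th1] s0 st tM.
have [c /andP[sc ct] ->] :=
  @MVT_pos (@powR R ^~ th) (fun z => th * z `^ (th - 1)) s t s0 st
    (fun z z0 => is_derive1_powR th z0).
rewrite ler_wpM2r ?subr_ge0// ler_wpM2l// powR_neg_le ?subr_le0//.
- exact: lt_le_trans sc.
- exact: le_trans tM.
Qed.

(** With D = th (ln t - ln s) the left side is t^th (1 - exp (- D)), where t^th <= 1 and 1 - exp (-
    D) <= D. In this sense powers are dominated by the logarithm on (0, 1]. *)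
Lemma powR_sub_le_ln s t th : 0 <= th -> 0 < s -> s <= t -> t <= 1 ->
  t `^ th - s `^ th <= th * (ln t - ln s).
Proof.
move=> th0 s0 st t1; have t0 : 0 < t by apply: lt_le_trans st.
rewrite /powR !gt_eqF//.
have -> : th * ln s = th * ln t + - (th * (ln t - ln s)) by ring.
rewrite expRD; set D := th * (_ - _).
have D0 : 0 <= D by apply: mulr_ge0 => //; rewrite subr_ge0 ler_ln ?posrE.
have e1 : expR (th * ln t) <= 1.
  by rewrite -[leRHS]expR0 ler_expR mulr_ge0_le0// ln_le0.
have e0 := expR_ge0 (th * ln t).
have := expR_ge1Dx (- D).
move: (expR (th * ln t)) (expR (- D)) e1 e0 => u v; nra.
Qed.

(** The Bregman divergence of z ln z. The affine term - (u - v) cancels between distributions but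
    makes each coordinate nonnegative on its own, so that sums can be bounded term by term. *)
Definition kl (u v : R) : R := u * ln u - u * ln v - (u - v).

Lemma is_derive_xlnx (z : R) : 0 < z -> is_derive z 1 (fun z => z * ln z) (ln z + 1).
Proof.
move=> z0; have dl := is_derive1_ln z0.
apply: (@is_derive_eq _ _ _ (id * (@ln R))).
by rewrite !scaler1 -[_ *: _]/(z * z^-1) divff ?gt_eqF// addrC.
Qed.

Lemma is_deriveB_fun (f g : R -> R) (z u v : R) :
  is_derive z 1 f u -> is_derive z 1 g v ->
  is_derive z 1 (fun z => f z - g z) (u - v).
Proof. by move=> df dg; have := is_deriveB df dg. Qed.

Lemma is_deriveZ_fun (f : R -> R) (c z u : R) :
  is_derive z 1 f u -> is_derive z 1 (fun z => c * f z) (c * u).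
Proof. by move=> df; have := is_deriveZ c df. Qed.

Lemma is_derive_sqr (c z : R) : is_derive z 1 (fun z => c * z ^+ 2) (2 * c * z).
Proof.
have d : is_derive z 1 (c *: (id ^+ 2 : R -> R)) (2 * c * z).
  by apply: is_derive_eq; rewrite expr1 -[LHS]/(c * ((2 * z) * 1)); ring.
exact: d.
Qed.

(** The second derivative 1 / z of z ln z is at least 1 / max u v between the two points. The scalar
    criterion asks for positive points, so u = 0 is settled by hand. *)
Lemma kl_ge u v : 0 <= u -> 0 < v ->
  (u - v) ^+ 2 / (2 * Num.max u v) <= kl u v.
Proof.
move=> u0 v0; have [->|uN0] := eqVneq u 0.
  rewrite max_r ?ltW// /kl !mul0r sub0r subrr sub0r opprK sqrrN expr2.
  rewrite -mulf_div divff ?gt_eqF//; lra.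
have {uN0}u0 : 0 < u by rewrite lt_neqAle eq_sym uN0.
set M := Num.max u v.
have M0 : 0 < M by rewrite lt_max u0.
pose c := (2 * M)^-1.
have cM : 2 * c = M^-1 by rewrite /c invfM mulrA divff ?mul1r.
have := @bregman_scalar_ge0 (fun z => z * ln z - c * z ^+ 2)
  (fun z => ln z + 1 - 2 * c * z) (Num.min u v) M v u.
have -> : 0 < Num.min u v by rewrite lt_min u0.
rewrite !le_max !ge_min !lexx !orbT /= => H.
have {}H := H isT _ _ isT isT.
rewrite -/c in H *.
suff : (ln v + 1 - 2 * c * v) * (u - v) <=
    u * ln u - c * u ^+ 2 - (v * ln v - c * v ^+ 2).
  by rewrite /kl; move: (ln u) (ln v) => lu lv; rewrite mulrC; nra.
apply: H.
  move=> z z0; have d1 := is_derive_xlnx z0; have d2 := is_derive_sqr c z.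
  exact: (is_deriveB_fun d1 d2).
move=> s t ms st tM.
have s0 : 0 < s by apply: lt_le_trans ms; rewrite lt_min u0.
have t0 : 0 < t by apply: lt_le_trans st.
have := ln_sub_ge s0 st; have : (t - s) / M <= (t - s) / t.
  by rewrite ler_wpM2l ?subr_ge0// lef_pV2.
rewrite cM; lra.
Qed.

Lemma kl_ge0 u v : 0 <= u -> 0 < v -> 0 <= kl u v.
Proof.
move=> u0 v0; apply: le_trans (kl_ge u0 v0).
by rewrite divr_ge0 ?sqr_ge0// mulr_ge0// le_max u0.
Qed.

(** For a <= 2 the second derivative a (a - 1) z^(a - 2) is nonincreasing, hence smallest at M. The
    points x = 0 and y = 0 are out of reach of the scalar criterion and treated apart, with a (a -
    1) / 2 <= a - 1. *)
Lemma powR_bregman_ge a x y M : 1 < a -> a <= 2 -> 0 <= x -> 0 <= y ->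
  x <= M -> y <= M -> 0 < M ->
  a * (a - 1) / 2 * ((y - x) ^+ 2 * M `^ (a - 2)) <=
  y `^ a - x `^ a - a * x `^ (a - 1) * (y - x).
Proof.
move=> a1 a2 x0 y0 xM yM M0.
have sqM z : 0 < z -> z <= M -> z ^+ 2 * M `^ (a - 2) <= z `^ a.
  move=> z0 zM; have -> : z `^ a = z ^+ 2 * z `^ (a - 2).
    rewrite -(powR_mulrn _ (ltW z0)) -powRD ?(gt_eqF z0) ?implybT//.
    by congr (_ `^ _); ring.
  by rewrite ler_wpM2l ?sqr_ge0// powR_neg_le// subr_le0.
have c1 : a * (a - 1) / 2 <= a - 1 by nra.
have c0 : 0 <= a * (a - 1) / 2 by nra.
have [->|xN0] := eqVneq x 0.
  have [->|yN0] := eqVneq y 0.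
    by rewrite !subrr expr0n/= mul0r !mulr0 subr0.
  have {yN0}y0 : 0 < y by rewrite lt_neqAle eq_sym yN0.
  rewrite !powR0 ?gt_eqF ?subr_gt0//; last lra.
  rewrite mulr0 mul0r !subr0.
  have := sqM _ y0 yM; have := powR_ge0 y a; have := powR_ge0 M (a - 2).
  move: (y `^ a) (M `^ _) => u v v0 u0 h.
  have : 0 <= y ^+ 2 * v by rewrite mulr_ge0 ?sqr_ge0.
  nra.
have {xN0}x0 : 0 < x by rewrite lt_neqAle eq_sym xN0.
have [->|yN0] := eqVneq y 0.
  rewrite sub0r sqrrN powR0 ?gt_eqF//; last lra.
  have -> : 0 - x `^ a - a * x `^ (a - 1) * - x = (a - 1) * x `^ a.
    have : x * x `^ (a - 1) = x `^ a by rewrite mulr_powRB1 ?ltW//; lra.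
    by nra.
  have := sqM _ x0 xM; have := powR_ge0 x a; have := powR_ge0 M (a - 2).
  move: (x `^ a) (M `^ _) => u v v0 u0 h.
  have : 0 <= x ^+ 2 * v by rewrite mulr_ge0 ?sqr_ge0.
  nra.
have {yN0}y0 : 0 < y by rewrite lt_neqAle eq_sym yN0.
set c := a * (a - 1) / 2 * M `^ (a - 2).
have := @bregman_scalar_ge0 (fun z => z `^ a - c * z ^+ 2)
  (fun z => a * z `^ (a - 1) - 2 * c * z) (Num.min x y) M x y.
have -> : 0 < Num.min x y by rewrite lt_min x0.
rewrite xM yM !ge_min !lexx !orbT /= => H.
have {}H := H isT _ _ isT isT.
suff : (a * x `^ (a - 1) - 2 * c * x) * (y - x) <=
    y `^ a - c * y ^+ 2 - (x `^ a - c * x ^+ 2).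
  have -> : a * (a - 1) / 2 * ((y - x) ^+ 2 * M `^ (a - 2)) = c * (y - x) ^+ 2.
    by rewrite /c; ring.
  by move: (x `^ (a - 1)) (x `^ a) (y `^ a) => X1 X Y; nra.
apply: H.
  move=> z z0; have d1 := is_derive1_powR a z0; have d2 := is_derive_sqr c z.
  exact: (is_deriveB_fun d1 d2).
move=> s t ms st tM.
have s0 : 0 < s by apply: lt_le_trans ms; rewrite lt_min x0.
have th : 0 <= a - 1 <= 1 by apply/andP; split; lra.
have := powR_sub_ge th s0 st tM.
have -> : a - 1 - 1 = a - 2 by ring.
rewrite /c; move: (M `^ _) (s `^ _) (t `^ _) => A B D h.
have a0 : 0 < a by lra.
have := ler_wpM2l (ltW a0) h; nra.
Qed.

(** On (0, 1] the second derivative a (a - 1) z^(a - 2) is at most a (a - 1) / z, that of a (a - 1)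
    z ln z. *)
Lemma powR_bregman_le a x y : 1 < a -> 0 < x -> 0 < y -> x <= 1 -> y <= 1 ->
  y `^ a - x `^ a - a * x `^ (a - 1) * (y - x) <= a * (a - 1) * kl y x.
Proof.
move=> a1 x0 y0 x1 y1.
set c := a * (a - 1).
have c0 : 0 <= c by rewrite /c; nra.
have := @bregman_scalar_ge0 (fun z => c * (z * ln z) - z `^ a)
  (fun z => c * (ln z + 1) - a * z `^ (a - 1)) (Num.min x y) 1 x y.
have -> : 0 < Num.min x y by rewrite lt_min x0.
rewrite x1 y1 !ge_min !lexx !orbT /= => H.
have {}H := H isT _ _ isT isT.
suff : (c * (ln x + 1) - a * x `^ (a - 1)) * (y - x) <=
    c * (y * ln y) - y `^ a - (c * (x * ln x) - x `^ a).
  rewrite /kl; move: (x `^ (a - 1)) (x `^ a) (y `^ a) (ln x) (ln y) => X1 X Y lx ly.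
  by lra.
apply: H.
  move=> z z0; have d1 := is_derive1_powR a z0; have d2 := is_derive_xlnx z0.
  exact: (is_deriveB_fun (is_deriveZ_fun c d2) d1).
move=> s t ms st t1.
have s0 : 0 < s by apply: lt_le_trans ms; rewrite lt_min x0.
have th : 0 <= a - 1 by lra.
have := powR_sub_le_ln th s0 st t1.
rewrite /c; move: (ln s) (ln t) (s `^ _) (t `^ _) => A B D E h.
have a0 : 0 < a by lra.
have := ler_wpM2l (ltW a0) h; nra.
Qed.

Lemma powR_tangent_le b x y : 1 <= b -> 0 < x -> 0 < y ->
  b * x `^ (b - 1) * (y - x) <= y `^ b - x `^ b.
Proof.
move=> b1 x0 y0.
have := @bregman_scalar_ge0 (fun z => z `^ b)
  (fun z => b * z `^ (b - 1)) (Num.min x y) (Num.max x y) x y.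
rewrite lt_min x0 y0 !ge_min !le_max !lexx !orbT /= => H.
apply: H => // s t ms st tM.
have s0 : 0 < s by apply: lt_le_trans ms; rewrite lt_min x0.
have t0 : 0 <= t by apply: le_trans st; apply: ltW.
by rewrite ler_wpM2l ?(le_trans ler01)// ge0_ler_powR ?nnegrE ?subr_ge0 ?(ltW s0).
Qed.

(** On [m, 1] the second derivative b (b - 1) z^(b - 2) is at most 2 / m, that of z^2 / m. *)
Lemma powR_tangent_ge b x y m : 1 <= b -> b <= 2 -> 0 < m ->
  m <= x <= 1 -> m <= y <= 1 ->
  y `^ b - x `^ b - b * x `^ (b - 1) * (y - x) <= m^-1 * (y - x) ^+ 2.
Proof.
move=> b1 b2 m0 mx my.
have := @bregman_scalar_ge0 (fun z => m^-1 * z ^+ 2 - z `^ b)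
  (fun z => 2 * m^-1 * z - b * z `^ (b - 1)) m 1 x y m0 _ _ mx my => H.
suff : (2 * m^-1 * x - b * x `^ (b - 1)) * (y - x) <=
    m^-1 * y ^+ 2 - y `^ b - (m^-1 * x ^+ 2 - x `^ b).
  move: (x `^ (b - 1)) (x `^ b) (y `^ b) (m^-1) => X1 X Y c.
  by lra.
apply: H.
  move=> z z0; have d1 := is_derive1_powR b z0; have d2 := is_derive_sqr m^-1 z.
  exact: (is_deriveB_fun d2 d1).
move=> s t ms st t1.
have s0 : 0 < s by apply: lt_le_trans ms.
have th : 0 <= b - 1 by lra.
have h1 := powR_sub_le_ln th s0 st t1.
have h2 : (t - s) / s <= (t - s) * m^-1.
  by rewrite ler_wpM2l ?subr_ge0// lef_pV2.
have h3 := ln_sub_le s0 st.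
have h4 : (b - 1) * (ln t - ln s) <= (b - 1) * ((t - s) * m^-1).
  by rewrite ler_wpM2l// (le_trans h3).
have h5 : b * (b - 1) * ((t - s) * m^-1) <= 2 * ((t - s) * m^-1).
  rewrite ler_wpM2r ?mulr_ge0 ?subr_ge0 ?invr_ge0 ?(ltW m0)//.
  have : 0 <= (2 - b) * (b + 1) by rewrite mulr_ge0//; lra.
  by clear; lra.
have b0 : 0 <= b by lra.
have := ler_wpM2l b0 (le_trans h1 h4).
move: (s `^ _) (t `^ _) (m^-1) h5 => D E c; nra.
Qed.

(** If u > v, write u (ln u - ln v) as v (ln u - ln v) + (u - v) (ln u - ln v): the first part is at
    most u - v and is cancelled, the second carries the factor ln dl^-1. Unlike [KL_le_ln], the
    resulting bound vanishes with the distance. *)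
Lemma kl_le u v dl : 0 <= u -> u <= 1 -> 0 < dl -> dl <= v -> dl <= 1 ->
  kl u v <= `|u - v| * (1 + ln dl^-1).
Proof.
move=> u0 u1 d0 dv d1; have v0 : 0 < v by apply: lt_le_trans dv.
have l0 : 0 <= ln dl^-1 by rewrite ln_ge0// invf_ge1.
have [->|uN0] := eqVneq u 0.
  rewrite /kl !mul0r !sub0r oppr0 add0r opprK normrN gtr0_norm//.
  by rewrite ler_peMr ?lerDl// ltW.
have {uN0}u0 : 0 < u by rewrite lt_neqAle eq_sym uN0.
have lv : - ln dl^-1 <= ln v by rewrite lnV ?posrE// opprK ler_ln ?posrE.
have lu : ln u <= 0 by rewrite ln_le0.
rewrite /kl; have [uv|/ltW vu] := leP u v.
  have := ln_sub_ge u0 uv; rewrite ler0_norm ?subr_le0// => h.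
  have : 0 <= (v - u) / v by rewrite divr_ge0 ?subr_ge0 ?(ltW v0).
  move: h lu l0; move: ((v - u) / v) (ln u) (ln v) (ln dl^-1) => A B D E.
  nra.
have := ln_sub_le v0 vu; rewrite ger0_norm ?subr_ge0// => h.
have : v * (ln u - ln v) <= u - v.
  by rewrite -ler_pdivlMl// mulrC.
move: lu lv l0; move: (ln u) (ln v) (ln dl^-1) => B D E; nra.
Qed.

End Scalar.

(** * Relative entropy and the l1 norm of finite families *)

Section Families.
Context {R : realType} {I : finType}.
Implicit Types (u v d e w : I -> R).

Definition l1 u : R := \sum_i `|u i|.

Definition KL u v : R := \sum_i kl (u i) (v i).

Lemma l1_ge0 u : 0 <= l1 u.
Proof. by apply: sumr_ge0. Qed.

(** Sum 2 t |d i| <= e i + t^2 w i over i and take t = l1 d / C, the best choice. No division by w i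
    occurs, so weights may vanish. *)
Lemma cauchy_schwarz d e w (C : R) : (forall i, 0 <= e i) -> (forall i, 0 <= w i) ->
  (forall i, d i ^+ 2 <= e i * w i) -> \sum_i w i <= C -> 0 < C ->
  l1 d ^+ 2 <= (\sum_i e i) * C.
Proof.
move=> e0 w0 dew wC C0; pose t := l1 d / C.
have t0 : 0 <= t by rewrite divr_ge0 ?l1_ge0// ltW.
have tC : t * C = l1 d by rewrite /t divfK ?gt_eqF.
clearbody t; have H i : 2 * t * `|d i| <= e i + t ^+ 2 * w i.
  have q0 : 0 <= e i + t ^+ 2 * w i by apply: addr_ge0 => //; apply: mulr_ge0 => //; exact: sqr_ge0.
  rewrite -(@ler_pXn2r _ 2) ?nnegrE ?mulr_ge0//.
  have : (t * `|d i|) ^+ 2 <= t ^+ 2 * (e i * w i).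
    by rewrite exprMn ler_wpM2l ?sqr_ge0// real_normK ?num_real.
  have : 0 <= (e i - t ^+ 2 * w i) ^+ 2 by rewrite sqr_ge0.
  by rewrite -mulrA; move: (t ^+ 2) (t * `|d i|) => T U h1 h2; lra.
have : \sum_i (2 * t * `|d i|) <= \sum_i (e i + t ^+ 2 * w i).
  by apply: ler_sum => i _; exact: H.
rewrite big_split/= -!mulr_sumr -/(l1 d) => h.
have h2 : t ^+ 2 * \sum_i w i <= t ^+ 2 * C by rewrite ler_wpM2l ?sqr_ge0.
move: (l1 d) (\sum_i e i) (\sum_i w i) tC h h2 => B A W <- h h2.
have : t ^+ 2 * C <= A by lra.
by move/(ler_wpM2r (ltW C0)); lra.
Qed.

Lemma KL_ge0 u v : (forall i, 0 <= u i) -> (forall i, 0 < v i) -> 0 <= KL u v.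
Proof. by move=> u0 v0; apply: sumr_ge0 => i _; exact: kl_ge0. Qed.

(** The weights max (u i) (v i) of [kl_ge] sum to at most 2, which yields the constant 4 where the
    sharp one is 2. *)
Lemma pinsker u v : (forall i, 0 <= u i) -> (forall i, 0 < v i) ->
  \sum_i u i = 1 -> \sum_i v i = 1 ->
  l1 (fun i => u i - v i) ^+ 2 <= 4 * KL u v.
Proof.
move=> u0 v0 su sv.
have := @cauchy_schwarz (fun i => u i - v i) (fun i => 2 * kl (u i) (v i))
  (fun i => Num.max (u i) (v i)) 2.
rewrite -mulr_sumr -/(KL u v) => H; apply: (le_trans (H _ _ _ _ _)) => //.
- by move=> i; rewrite mulr_ge0 ?kl_ge0.
- by move=> i; rewrite le_max u0.
- move=> i; have M0 : 0 < Num.max (u i) (v i) by rewrite lt_max v0 orbT.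
  have := kl_ge (u0 i) (v0 i); rewrite ler_pdivrMr ?mulr_gt0// => h.
  by apply: (le_trans h); rewrite mulrCA mulrA.
- have -> : 2 = \sum_i (u i + v i) by rewrite big_split/= su sv.
  by apply: ler_sum => i _; rewrite ge_max lerDl lerDr u0 ltW ?v0.
- lra.
Qed.

Lemma KL_le u v (dl : R) : (forall i, 0 <= u i <= 1) -> 0 < dl <= 1 ->
  (forall i, dl <= v i) ->
  KL u v <= l1 (fun i => u i - v i) * (1 + ln dl^-1).
Proof.
move=> u01 /andP[d0 d1] dv; rewrite /l1 mulr_suml; apply: ler_sum => i _.
by case/andP: (u01 i) => ? ?; apply: kl_le.
Qed.

Lemma distr_le1 u i : (forall i, 0 <= u i) -> \sum_i u i = 1 -> u i <= 1.
Proof.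
move=> u0 <-; rewrite (bigD1 i)//= lerDl; exact: sumr_ge0.
Qed.

Lemma KL_le_ln u v (dl : R) : (forall i, 0 <= u i) -> \sum_i u i = 1 ->
  \sum_i v i = 1 -> 0 < dl -> (forall i, dl <= v i) -> KL u v <= ln dl^-1.
Proof.
move=> u0 su sv d0 dv; rewrite /KL /kl !sumrB su sv subrr subr0.
rewrite -[leRHS]mul1r -{1}su mulr_suml -sumrB; apply: ler_sum => i _.
rewrite -mulrBr ler_wpM2l// lerBlDr lnV ?posrE//.
have l1 : ln (u i) <= 0 by rewrite ln_le0// distr_le1.
have l2 : ln dl <= ln (v i) by rewrite ler_ln ?posrE// (lt_le_trans d0).
by lra.
Qed.

End Families.

(** All gradients below are computed along lines, where the rules for functions of one real variable
    apply. *)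
Lemma derive_line (R : realType) (V : normedModType R) (f : V -> R) (x v : V) (l : R) :
  is_derive (0 : R) 1 (fun t : R => f (x + t *: v)) l -> 'D_v f x = l.
Proof.
case=> _ <-; rewrite /derive.
rewrite (_ : (fun h : R => h^-1 *: ((f \o shift x) (h *: v) - f x)) =
  fun h : R => h^-1 *: (((fun t : R => f (x + t *: v)) \o shift (0 : R)) (h *: (1 : R))
    - f (x + (0 : R) *: v)))//.
apply/funext => h /=.
by rewrite scale0r !addr0 [_%:A]mulr1 [_ + x]addrC.
Qed.

Section AbsPow.
Context {R : realType}.

Lemma powR_le1 (u c : R) : 0 <= u -> u <= 1 -> 0 <= c -> u `^ c <= 1.
Proof.
move=> u0 u1 c0; rewrite [leRHS](_ : 1 = 1 `^ c); last by rewrite powR1.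
by rewrite ge0_ler_powR ?nnegrE.
Qed.

Lemma powR_bregman_bound_ge0 (a d M : R) : 1 < a ->
  0 <= a * (a - 1) / 2 * (d ^+ 2 * M `^ (a - 2)).
Proof.
move=> a1; apply: mulr_ge0; last by rewrite mulr_ge0 ?sqr_ge0 ?powR_ge0.
by rewrite divr_ge0// mulr_ge0 ?subr_ge0 ?(ltW a1) ?(le_trans ler01 (ltW a1)).
Qed.

Lemma is_derive_affine (x c t : R) : is_derive t 1 (fun t => x + t * c) c.
Proof.
have d : is_derive t 1 (cst x + c *: (id : R -> R)) (0 + c *: 1).
  exact: is_deriveD.
move: d; rewrite add0r -[c *: 1]/(c * 1) mulr1; congr is_derive.
by apply/funext => z /=; rewrite -[_ z]/(x + c * z) mulrC.
Qed.

(** Zero coordinates matter: the argument may lie on the boundary of the simplex while the line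
    leaves it. There a > 1 makes the difference quotient |t c|^a / t tend to 0. *)
Lemma is_derive_abs_powR (a x c : R) : 1 < a -> 0 <= x ->
  is_derive (0 : R) 1 (fun t => `|x + t * c| `^ a) (a * x `^ (a - 1) * c).
Proof.
move=> a1 x0; have a0 : a != 0 by rewrite gt_eqF//; lra.
have [->|xN0] := eqVneq x 0; last first.
  have {xN0}x0 : 0 < x by rewrite lt_neqAle eq_sym xN0.
  apply: (@near_eq_is_derive _ _ _ ((@powR R ^~ a) \o (fun t => x + t * c))).
  - have cont : {for (0:R), continuous (fun t : R => x + t * c)}.
      apply: differentiable_continuous; apply/derivable1_diffP.
      by case: (is_derive_affine x c 0).
    have : \forall t \near (0:R), 0 < x + t * c.
      by apply: (cvgr_gt _ cont); rewrite mul0r addr0.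
    by apply: filterS => t t0 /=; rewrite gtr0_norm.
  - have p : 0 < (fun t => x + t * c) 0 by rewrite mul0r addr0.
    have := @is_derive1_comp R (@powR R ^~ a) (fun t => x + t * c) 0 _ _
      (is_derive1_powR a p) (is_derive_affine x c 0).
    by rewrite /= mul0r addr0.
rewrite powR0 ?subr_eq0 ?gt_eqF// mulr0 mul0r.
apply/is_derive1_caratheodory.
(* Caratheodory's slope function. Its value at t = 0 is 0 because 0^-1 = 0, which is the derivative
   to be found. *)
exists (fun t => `|t * c| `^ a / t); split.
- move=> t; rewrite mul0r addr0 normr0 powR0// !subr0 add0r.
  have [->|t0] := eqVneq t 0; first by rewrite mul0r normr0 powR0// mulr0.
  by rewrite divfK.
- apply/cvgrPdist_le => e e0.
  pose K := `|c| `^ a + 1.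
  have K0 : 0 < K by rewrite ltr_wpDl ?powR_ge0.
  have eK : 0 < e / K by rewrite divr_gt0.
  have d0 : 0 < (e / K) `^ (a - 1)^-1 by rewrite powR_gt0.
  near=> t; rewrite invr0 mulr0 sub0r normrN normrM ger0_norm ?powR_ge0// normrM.
  have [->|t0] := eqVneq t 0; first by rewrite normr0 mul0r powR0// mul0r ltW.
  rewrite powRM// -(@mulr_powRB1 _ `|t| a)//; last lra.
  have -> : `|t| * `|t| `^ (a - 1) * `|c| `^ a * `|t^-1| =
      `|c| `^ a * `|t| `^ (a - 1).
    by rewrite normfV; field; rewrite normr_eq0.
  have tle : `|t| `^ (a - 1) <= e / K.
    have -> : e / K = ((e / K) `^ (a - 1)^-1) `^ (a - 1).
      by rewrite -powRrM mulVf ?powRr1 ?(ltW eK)// subr_eq0 gt_eqF.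
    by rewrite ge0_ler_powR ?nnegrE ?powR_ge0 ?subr_ge0 ?(ltW a1).
  rewrite (le_trans (ler_wpM2l (powR_ge0 _ _) tle))//.
  by rewrite mulrCA ger_pMr// ler_pdivrMr// mul1r lerDl.
- by rewrite invr0 mulr0.
Unshelve. all: by end_near. Qed.

End AbsPow.

(** * The prox-function *)

Section Prox.
Context {R : realType} {n : nat}.
Hypothesis n_gt1 : (1 < n)%N.
Implicit Types (p u v x y : 'cV[R]_n).

Local Notation L := (ln n%:R : R).
Local Notation th := ((2 * L)^-1).
Local Notation a := (prox_exponent R n).
Local Notation b := (2 / a).

Lemma ln_n_ge : 1 / 2 <= L.
Proof.
have n2 : 2 <= n%:R :> R by rewrite ler_nat.
have n0 : 0 < n%:R :> R by lra.
have := @ln_sub_ge R 1 n%:R ltr01; rewrite ln1 subr0 => h.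
apply: le_trans (h _); last lra.
rewrite ler_pdivlMr//; lra.
Qed.

Lemma ln_n_gt0 : 0 < L. Proof. have := ln_n_ge; lra. Qed.

Lemma thL : th * L = 1 / 2.
Proof. by have := ln_n_gt0 => h; field; rewrite gt_eqF. Qed.

Lemma th01 : 0 < th <= 1.
Proof.
have := ln_n_gt0; have := ln_n_ge => h1 h2.
by rewrite invr_gt0 mulr_gt0//= invf_le1 ?mulr_gt0//; lra.
Qed.

Lemma a12 : 1 < a /\ a <= 2.
Proof. by rewrite /prox_exponent; case/andP: th01; split; lra. Qed.

Lemma a1E : a - 1 = th. Proof. rewrite /prox_exponent; ring. Qed.

Lemma abE : a * b = 2.
Proof. by have [h _] := a12; field; rewrite gt_eqF//; lra. Qed.

(** The factor ln n of [prox_fun] is calibrated to the modulus a (a - 1) of z^a: their product with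
    b is 1, so that no ln n survives in the coordinatewise term of [BdE]. *)
Lemma LabE : L * (a * (a - 1) * b) = 1.
Proof. by rewrite mulrAC abE a1E mulrCA [L * _]mulrC thL mul1r divff. Qed.

Lemma b12 : 1 <= b <= 2.
Proof.
have [h1 h2] := a12; have a0 : 0 < a by lra.
rewrite ler_pdivlMr// ler_pdivrMr//; lra.
Qed.

Definition psum (u : 'I_n -> R) : R := \sum_i u i `^ a.

Definition prox_grad x : 'cV[R]_n :=
  \col_i (2 * L * psum (x ^~ 0) `^ (b - 1) * x i 0 `^ th).

Lemma prox_funE : @prox_fun R n = fun p => L * (\sum_i `|p i 0| `^ a) `^ b.
Proof.
apply/funext => p; rewrite /prox_fun a1E; congr (_ * _).
  by rewrite invfM invrK mulrA mulVf ?mul1r.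
rewrite /lnorm -powR_mulrn ?powR_ge0// -powRrM; congr (_ `^ _).
by rewrite mulrC.
Qed.

Lemma is_derive_prox x v : (forall i, 0 <= x i 0) -> 0 < psum (x ^~ 0) ->
  is_derive (0 : R) 1 (fun t : R => prox_fun (x + t *: v))
    (\sum_i prox_grad x i 0 * v i 0).
Proof.
move=> x0 S0; have [a1 _] := a12.
have dS : is_derive (0 : R) 1 (fun t : R => \sum_i `|x i 0 + t * v i 0| `^ a)
    (\sum_i a * x i 0 `^ (a - 1) * v i 0).
  have := @is_derive_sum R R R n
    (fun i t => `|x i 0 + t * v i 0| `^ a) 0 1 _
    (fun i => is_derive_abs_powR (v i 0) a1 (x0 i)).
  by congr is_derive; apply/funext => t; rewrite fct_sumE.
have S0E : \sum_i `|x i 0 + 0 * v i 0| `^ a = psum (x ^~ 0).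
  by apply: eq_bigr => i _; rewrite mul0r addr0 ger0_norm.
have dP : is_derive (\sum_i `|x i 0 + 0 * v i 0| `^ a) 1 (@powR R ^~ b)
    (b * psum (x ^~ 0) `^ (b - 1)).
  by rewrite S0E; exact: is_derive1_powR.
have d := is_deriveZ_fun L (is_derive1_comp dP dS).
have -> : (fun t : R => prox_fun (x + t *: v)) =
    fun t : R => L * (\sum_i `|x i 0 + t * v i 0| `^ a) `^ b.
  apply/funext => t; rewrite prox_funE; congr (_ * _ `^ _).
  by apply: eq_bigr => i _; rewrite !mxE.
have -> : \sum_i prox_grad x i 0 * v i 0 = L * (b * psum (x ^~ 0) `^ (b - 1) *
    (\sum_i a * x i 0 `^ (a - 1) * v i 0)).
  rewrite !mulr_sumr; apply: eq_bigr => i _; rewrite !mxE a1E.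
  transitivity (a * b * L * psum (x ^~ 0) `^ (b - 1) * x i 0 `^ th * v i 0).
    by rewrite abE.
  by move: (b) (psum _ `^ _) (x i 0 `^ th); clear=> *; ring.
exact: d.
Qed.

Lemma derive_prox x v : (forall i, 0 <= x i 0) -> 0 < psum (x ^~ 0) ->
  'D_v (@prox_fun R n) x = \sum_i prox_grad x i 0 * v i 0.
Proof. by move=> x0 S0; exact: (derive_line (is_derive_prox v x0 S0)). Qed.

Local Notation nu := (n%:R `^ th : R).

(** The reason for a - 1 = 1 / (2 ln n): n^(a - 1) is the constant sqrt(e), so passing between the
    l1 norm and the a-norm costs only a constant factor. *)
Lemma nuE : nu = expR (1 / 2).
Proof.
by rewrite /powR gt_eqF ?thL// ltr0n (ltn_trans _ n_gt1).
Qed.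

Lemma nu_gt0 : 0 < nu. Proof. by rewrite nuE expR_gt0. Qed.

Lemma nu_le2 : nu <= 2.
Proof.
rewrite nuE -lef_pV2 ?posrE ?expR_gt0// -expRN.
by apply: le_trans (expR_ge1Dx _); lra.
Qed.

Lemma sum_le1 (u : 'I_n -> R) : (forall i, 0 <= u i) -> \sum_i u i = 1 ->
  psum u <= 1.
Proof.
move=> u0 su; rewrite -su; apply: ler_sum => i _.
have [a1 _] := a12.
have [->|ui] := eqVneq (u i) 0; first by rewrite powR0// gt_eqF//; lra.
by rewrite ge1r_powR ?(ltW a1)// lt_neqAle eq_sym ui u0 distr_le1.
Qed.

Lemma natr_gt0 : 0 < n%:R :> R. Proof. by rewrite ltr0n (ltn_trans _ n_gt1). Qed.

Lemma sum_ninv : \sum_(i < n) n%:R^-1 = 1 :> R.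
Proof.
by rewrite sumr_const card_ord -[LHS]mulr_natl divff// gt_eqF// natr_gt0.
Qed.

(** Jensen's inequality: the tangent of z^a at the uniform value 1 / n lies below z^a, and its
    linear part sums to zero. *)
Lemma sum_ge_nu (u : 'I_n -> R) : (forall i, 0 <= u i) -> \sum_i u i = 1 ->
  nu^-1 <= psum u.
Proof.
move=> u0 su; have [a1 a2] := a12; have nn := natr_gt0.
pose x := n%:R^-1 : R.
have x0 : 0 < x by rewrite invr_gt0.
have H i : x `^ a + a * x `^ (a - 1) * (u i - x) <= u i `^ a.
  have := @powR_bregman_ge R a x (u i) (x + u i) a1 a2 (ltW x0) (u0 i).
  rewrite lerDl lerDr (ltW x0) u0 ltr_wpDr// => /(_ isT isT isT).
  have := powR_bregman_bound_ge0 (u i - x) (x + u i) a1.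
  lra.
have : \sum_i (x `^ a + a * x `^ (a - 1) * (u i - x)) <= psum u.
  by apply: ler_sum => i _; exact: H.
suff -> : \sum_i (x `^ a + a * x `^ (a - 1) * (u i - x)) = nu^-1 by [].
transitivity (n%:R * x `^ a).
  rewrite big_split/= -mulr_sumr sumrB su (_ : \sum_(i < n) x = 1) ?sum_ninv//.
  by rewrite subrr mulr0 addr0 sumr_const card_ord mulr_natl.
rewrite -(@mulr_powRB1 _ x a) ?(ltW x0)//; last lra.
rewrite mulrA /x divff ?gt_eqF// mul1r a1E -powR_inv1 ?(ltW nn)// -powRrM.
by rewrite mulN1r powRN.
Qed.

Lemma psum_gt0 (u : 'I_n -> R) : (forall i, 0 <= u i) -> \sum_i u i = 1 ->
  0 < psum u.
Proof. by move=> u0 /(sum_ge_nu u0); apply: lt_le_trans; rewrite invr_gt0 nu_gt0. Qed.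

Lemma psum_ge_half (u : 'I_n -> R) : (forall i, 0 <= u i) -> \sum_i u i = 1 ->
  2^-1 <= psum u.
Proof.
move=> u0 /(sum_ge_nu u0); apply: le_trans.
by rewrite lef_pV2 ?posrE ?nu_gt0// nu_le2.
Qed.

Lemma derive_prox_simplex x v : simplex R n x ->
  'D_v (@prox_fun R n) x = \sum_i prox_grad x i 0 * v i 0.
Proof. by case=> x0 sx; rewrite derive_prox// psum_gt0. Qed.

Lemma prox_fun_simplex x : (forall i, 0 <= x i 0) ->
  prox_fun x = L * psum (x ^~ 0) `^ b.
Proof.
move=> x0; rewrite prox_funE; congr (_ * _ `^ _); apply: eq_bigr => i _.
by rewrite ger0_norm.
Qed.

(* Splitting along s |-> s ^ b and the coordinatewise power reduces estimates
   of Bd to scalar Bregman divergences. *)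
Lemma BdE y x : simplex R n y -> simplex R n x ->
  Bd y x =
    L * (psum (y ^~ 0) `^ b - psum (x ^~ 0) `^ b
         - b * psum (x ^~ 0) `^ (b - 1) * (psum (y ^~ 0) - psum (x ^~ 0)))
    + L * b * psum (x ^~ 0) `^ (b - 1) *
      \sum_i (y i 0 `^ a - x i 0 `^ a - a * x i 0 `^ (a - 1) * (y i 0 - x i 0)).
Proof.
move=> [y0 sy] [x0 sx]; rewrite /Bd /bregman derive_prox ?psum_gt0//.
rewrite !prox_fun_simplex// !sumrB.
have -> : \sum_i prox_grad x i 0 * (y - x) i 0 =
    L * b * psum (x ^~ 0) `^ (b - 1) *
    \sum_i a * x i 0 `^ (a - 1) * (y i 0 - x i 0).
  rewrite mulr_sumr; apply: eq_bigr => i _; rewrite !mxE a1E.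
  transitivity (a * b * L * psum (x ^~ 0) `^ (b - 1) * x i 0 `^ th * (y i 0 - x i 0)).
    by rewrite abE.
  by move: (b) (psum _ `^ _) (x i 0 `^ th); clear=> *; ring.
rewrite -/(psum (x ^~ 0)) -/(psum (y ^~ 0)).
set A := \sum_i a * _ * _; move: (psum (x ^~ 0)) (psum (y ^~ 0)) A => Sx Sy A.
by move: (Sx `^ (b - 1)) (Sx `^ b) (Sy `^ b); move: (b); clear=> *; ring.
Qed.

(** [prox_fun] is homogeneous of degree 2, so its gradient at x paired with x is twice its value;
    paired with y it is nonnegative. Hence Bd y x is at most the sum of the values at y and x, each
    at most ln n. *)
Lemma Bd_le y x : simplex R n y -> simplex R n x -> Bd y x <= 2 * L.
Proof.
move=> [y0 sy] [x0 sx]; rewrite /Bd /bregman derive_prox ?psum_gt0//.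
rewrite !prox_fun_simplex//; have L0 := ln_n_gt0.
have gx : \sum_i prox_grad x i 0 * x i 0 = 2 * L * psum (x ^~ 0) `^ b.
  transitivity (\sum_i 2 * L * psum (x ^~ 0) `^ (b - 1) * x i 0 `^ a).
    apply: eq_bigr => i _; rewrite !mxE -mulrA [_ `^ th * _]mulrC -a1E.
    by rewrite mulr_powRB1//; case: a12; lra.
  rewrite -mulr_sumr -/(psum (x ^~ 0)) -mulrA; congr (_ * _).
  rewrite mulrC mulr_powRB1//; first by rewrite ltW// psum_gt0.
  by case/andP: b12; lra.
have gy : 0 <= \sum_i prox_grad x i 0 * y i 0.
  apply: sumr_ge0 => i _; rewrite !mxE !mulr_ge0 ?powR_ge0//; lra.
have -> : \sum_i prox_grad x i 0 * (y - x) i 0 =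
    \sum_i prox_grad x i 0 * y i 0 - \sum_i prox_grad x i 0 * x i 0.
  by rewrite -sumrB; apply: eq_bigr => i _; rewrite !mxE; ring.
rewrite gx.
have powle (u : 'I_n -> R) : (forall i, 0 <= u i) -> \sum_i u i = 1 ->
    psum u `^ b <= 1.
  move=> u0 su; apply: powR_le1; rewrite ?sum_le1 ?(ltW (psum_gt0 _ _))//.
  by case/andP: b12; lra.
move: gy (powle _ y0 sy) (powle _ x0 sx).
move: (\sum_i _) (_ `^ b) (_ `^ b) L0 => g A B; clear; nra.
Qed.

Lemma psum_pow_ge (u : 'I_n -> R) : (forall i, 0 <= u i) -> \sum_i u i = 1 ->
  2^-1 <= psum u `^ (b - 1) <= 1.
Proof.
move=> u0 su; case/andP: b12 => b1 b2.
have S0 := psum_gt0 u0 su; have S1 := sum_le1 u0 su; have S2 := psum_ge_half u0 su.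
apply/andP; split.
  apply: le_trans S2 _; rewrite ger1_powR ?S0//; lra.
apply: powR_le1; rewrite ?(ltW S0)//; lra.
Qed.

Lemma powR_bregman_ge0 (s t : R) : 0 <= s -> 0 <= t ->
  0 <= t `^ a - s `^ a - a * s `^ (a - 1) * (t - s).
Proof.
have [a1 a2] := a12; move=> s0 t0.
apply: le_trans (@powR_bregman_ge R a s t (s + t + 1) a1 a2 s0 t0 _ _ _).
- exact: powR_bregman_bound_ge0.
- by rewrite -addrA lerDl addr_ge0.
- by rewrite addrAC lerDr addr_ge0.
- by rewrite ltr_wpDl// addr_ge0.
Qed.

(** With M = s + t + 1/n one has M^(2 - a) = M M^(1 - a) <= M n^(a - 1). The summand 1/n is what
    bounds the negative power, and for two distributions the weights M still total only 3. *)
Lemma powR_bregman_weighted (s t : R) : 0 <= s -> 0 <= t ->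
  a * (a - 1) / 2 * (t - s) ^+ 2 <=
  (t `^ a - s `^ a - a * s `^ (a - 1) * (t - s)) * ((s + t + n%:R^-1) * nu).
Proof.
have [a1 a2] := a12; have nn := natr_gt0; move=> s0 t0.
have ni : 0 < n%:R^-1 :> R by rewrite invr_gt0.
set M := s + t + n%:R^-1.
have M0 : 0 < M by rewrite ltr_wpDl// addr_ge0.
have sM : s <= M by rewrite /M -addrA lerDl addr_ge0// ltW.
have tM : t <= M by rewrite /M addrAC lerDr addr_ge0// ltW.
have nM : n%:R^-1 <= M by rewrite lerDr addr_ge0.
have := powR_bregman_ge a1 a2 s0 t0 sM tM M0.
move/(ler_wpM2r (powR_ge0 M (2 - a))); set D := t `^ a - _ - _.
have D0 : 0 <= D by exact: powR_bregman_ge0.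
rewrite [leLHS](_ : _ = a * (a - 1) / 2 * (t - s) ^+ 2); last first.
  transitivity (a * (a - 1) / 2 * (t - s) ^+ 2 * (M `^ (a - 2) * M `^ (2 - a))).
    by rewrite !mulrA.
  rewrite -powRD ?(gt_eqF M0) ?implybT// addrA subrK subrr.
  by rewrite powRr0 mulr1.
move/le_trans; apply; rewrite ler_wpM2l//.
have -> : 2 - a = 1 - th by rewrite -a1E; ring.
rewrite powRD ?(gt_eqF M0) ?implybT// powRr1 ?(ltW M0)//.
rewrite ler_wpM2l ?(ltW M0)//.
apply: le_trans (@powR_neg_le R n%:R^-1 M (- th) _ ni nM) _.
  by case/andP: th01 => h _; rewrite oppr_le0 ltW.
by rewrite -powR_inv1 ?(ltW nn)// -powRrM mulrNN mul1r.
Qed.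

(** The weights (x i + y i + 1/n) nu sum to at most 3 * 2 = 6, so the squared l1 distance is at most
    12 / (a (a - 1)) times the coordinatewise sum of [BdE]; the factor psum^(b - 1) >= 1/2 turns 12
    into 24. The other term of [BdE] is nonnegative because s^b is convex. *)
Lemma Bd_strongly_convex y x : simplex R n y -> simplex R n x ->
  24^-1 * l1 (fun i => y i 0 - x i 0) ^+ 2 <= Bd y x.
Proof.
move=> dy dx; have [y0 sy] := dy; have [x0 sx] := dx.
rewrite (BdE dy dx); have [a1 a2] := a12; have /andP[b1 b2] := b12.
have L0 := ln_n_gt0; have nn := natr_gt0.
set D := \sum_i _; set Sx := psum (x ^~ 0); set Sy := psum (y ^~ 0).
have Sx0 : 0 < Sx by apply: psum_gt0.
have Sy0 : 0 < Sy by apply: psum_gt0.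
have h1 := powR_tangent_le b1 Sx0 Sy0.
pose w i := (x i 0 + y i 0 + n%:R^-1) * nu.
have ni : 0 < n%:R^-1 :> R by rewrite invr_gt0.
have CS := @cauchy_schwarz R 'I_n (fun i => y i 0 - x i 0)
  (fun i => 2 / (a * (a - 1)) * (y i 0 `^ a - x i 0 `^ a - a * x i 0 `^ (a - 1) * (y i 0 - x i 0)))
  w 6.
have key i := powR_bregman_weighted (x0 i) (y0 i).
have D0 i := powR_bregman_ge0 (x0 i) (y0 i).
have aa : 0 < a * (a - 1) by rewrite mulr_gt0 ?subr_gt0// (lt_trans ltr01).
have w0 i : 0 <= w i.
  by rewrite /w mulr_ge0 ?(ltW nu_gt0)// !addr_ge0 ?(ltW ni).
have sw : \sum_i w i <= 6.
  rewrite -mulr_suml !big_split/= sx sy sum_ninv.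
  by rewrite (_ : 6 = (1 + 1 + 1) * 2) ?ler_wpM2l ?nu_le2//; ring.
have {CS} : l1 (fun i => y i 0 - x i 0) ^+ 2 <= 2 / (a * (a - 1)) * D * 6.
  rewrite /D mulr_sumr; apply: CS => // [i|i].
    by apply: mulr_ge0; [rewrite divr_ge0// ltW|exact: D0].
  have := key i; rewrite -ler_pdivlMl ?divr_gt0// invf_div => h.
  by rewrite -[leRHS]mulrA; exact: h.
have := LabE.
have : 0 <= D by apply: sumr_ge0.
have /andP[h2 _] := psum_pow_ge x0 sx.
rewrite -/Sx in h2; move: h1 h2.
move: D (Sx `^ (b - 1)) (Sx `^ b) (Sy `^ b) (l1 _ ^+ 2) => D s1 s2 s3 l h1 h2 d0 e.
have -> : 2 / (a * (a - 1)) * D * 6 = 12 / (a * (a - 1)) * D by ring.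
rewrite mulrAC ler_pdivlMr// => h3.
have h4 : 0 <= L * (s3 - s2 - b * s1 * (Sy - Sx)).
  by apply: mulr_ge0; [exact: ltW|lra].
have b0 : 0 <= b by lra.
have h5 : L * b * (2^-1 * D) <= L * b * (s1 * D).
  by apply: ler_wpM2l; [rewrite mulr_ge0// ltW|exact: ler_wpM2r].
have h6 : L * b * (l * (a * (a - 1))) <= L * b * (12 * D).
  by apply: ler_wpM2l => //; rewrite mulr_ge0// ltW.
have h7 : L * b * (l * (a * (a - 1))) = l.
  transitivity (l * (L * (a * (a - 1) * b))); last by rewrite e mulr1.
  by rewrite !mulrA; ring.
rewrite h7 in h6.
have -> : L * b * s1 * D = L * b * (s1 * D) by ring.
move: h4 h5 h6; move: (L * b) (L * (_ - _)) => B A h4 h5 h6.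
by clear -h4 h5 h6; lra.
Qed.

Lemma Bd_ge0 y x : simplex R n y -> simplex R n x -> 0 <= Bd y x.
Proof.
move=> dy dx; apply: le_trans (Bd_strongly_convex dy dx).
by rewrite mulr_ge0 ?sqr_ge0// invr_ge0.
Qed.

Lemma powR_lipschitz (s t : R) : 0 < s -> 0 < t -> s <= 1 -> t <= 1 ->
  `|s `^ a - t `^ a| <= 2 * `|s - t|.
Proof.
have [a1 a2] := a12.
have aux (u v : R) : 0 < u -> 0 < v -> u <= 1 -> v <= u ->
    `|u `^ a - v `^ a| <= 2 * `|u - v|.
  move=> u0 v0 u1 vu; have a0 : 0 <= a by apply: le_trans (ltW a1).
  rewrite !ger0_norm ?subr_ge0// ?ge0_ler_powR ?nnegrE ?(ltW u0) ?(ltW v0)//.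
  have := powR_tangent_le (ltW a1) u0 v0.
  have : u `^ (a - 1) <= 1.
    by apply: powR_le1; rewrite ?(ltW u0)// subr_ge0 ltW.
  have := powR_ge0 u (a - 1); have : 0 <= u - v by rewrite subr_ge0.
  move: (u `^ (a - 1)) (u `^ a) (v `^ a) a1 a2 => p q r; move: (a) => c.
  clear=> c1 c2 uv p0 p1.
  have : c * p <= 2 by nra.
  nra.
move=> s0 t0 s1 t1; have [ts|/ltW st] := leP t s; first exact: aux.
by rewrite distrC [`|s - t|]distrC; exact: aux.
Qed.

(* s |-> s ^ a is dominated by the entropy on (0,1], because a <= 2: Bd is
   smooth relative to KL although it is not smooth in the l1 norm. *)
Lemma Bd_relatively_smooth y x : simplex R n y -> simplex R n x ->
  (forall i, 0 < y i 0) -> (forall i, 0 < x i 0) ->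
  Bd y x <= (32 * L + 1) * KL (y ^~ 0) (x ^~ 0).
Proof.
move=> dy dx yp xp; have [y0 sy] := dy; have [x0 sx] := dx.
rewrite (BdE dy dx); have [a1 a2] := a12; have /andP[b1 b2] := b12.
have L0 := ln_n_gt0.
set D := \sum_i _; set Sx := psum (x ^~ 0); set Sy := psum (y ^~ 0).
set K := KL _ _; set l := l1 (fun i => y i 0 - x i 0).
have x1 i : x i 0 <= 1 by exact: (@distr_le1 R _ (x ^~ 0) i x0 sx).
have y1 i : y i 0 <= 1 by exact: (@distr_le1 R _ (y ^~ 0) i y0 sy).
have lK : l ^+ 2 <= 4 * K by apply: pinsker.
have DK : D <= a * (a - 1) * K.
  rewrite /D /K /KL mulr_sumr; apply: ler_sum => i _.
  exact: powR_bregman_le.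
have SK : (Sy - Sx) ^+ 2 <= 16 * K.
  have h : `|Sy - Sx| <= 2 * l.
    rewrite /Sy /Sx /psum -sumrB /l /l1 mulr_sumr.
    apply: le_trans (ler_norm_sum _ _ _) _; apply: ler_sum => i _.
    exact: powR_lipschitz.
  rewrite -real_normK ?num_real//.
  have h2 : `|Sy - Sx| ^+ 2 <= (2 * l) ^+ 2.
    by rewrite ler_pXn2r ?nnegrE ?mulr_ge0 ?l1_ge0.
  apply: le_trans h2 _; rewrite exprMn; lra.
have [Sx1 Sx2] := (psum_ge_half x0 sx, sum_le1 x0 sx).
have [Sy1 Sy2] := (psum_ge_half y0 sy, sum_le1 y0 sy).
(* Both sums are at least 1/2, so [powR_tangent_ge] with m = 1/2 gives 2 (Sy - Sx)^2, and 2 * 16 =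
   32. *)
have h1 : Sy `^ b - Sx `^ b - b * Sx `^ (b - 1) * (Sy - Sx) <= 32 * K.
  apply: le_trans (@powR_tangent_ge R b Sx Sy 2^-1 b1 b2 _ _ _) _.
  - by rewrite invr_gt0.
  - by apply/andP.
  - by apply/andP.
  - by rewrite invrK; lra.
have K0 : 0 <= K by apply: KL_ge0.
have /andP[h2 h3] := psum_pow_ge x0 sx.
have -> : (32 * L + 1) * K = L * (32 * K) + K by ring.
apply: lerD; first by rewrite ler_wpM2l ?(ltW L0).
have e := LabE.
rewrite -/Sx in h2 h3.
have s0 : 0 <= L * b * Sx `^ (b - 1).
  rewrite mulr_ge0 ?powR_ge0// mulr_ge0 ?(ltW L0)//.
  by apply: le_trans b1; exact: ler01.
apply: le_trans (ler_wpM2l s0 DK) _.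
have -> : L * b * Sx `^ (b - 1) * (a * (a - 1) * K) =
   L * (a * (a - 1) * b) * K * Sx `^ (b - 1) by ring.
by rewrite e mul1r ler_piMr.
Qed.

Lemma Bd_gt0 y x : simplex R n y -> simplex R n x -> y != x -> 0 < Bd y x.
Proof.
move=> dy dx yx; apply: lt_le_trans (Bd_strongly_convex dy dx).
rewrite mulr_gt0 ?invr_gt0// exprn_gt0// lt_neqAle l1_ge0 andbT eq_sym.
apply: contraNN yx => /eqP/psumr_eq0P h; apply/eqP/colP => i.
by apply/eqP; rewrite -subr_eq0 -normr_eq0 h.
Qed.

End Prox.

(** * The transport cost *)

Section Transport.
Context {R : realType} {n : nat}.
Implicit Types (p q u : 'cV[R]_n) (C pi : 'M[R]_n).

Lemma entry_le_norm r c (C : 'M[R]_(r, c)) i j : `|C i j| <= `|C|.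
Proof.
rewrite -[`|C|]/(mx_norm C) mx_normrE.
exact: (le_bigmax_cond _ (fun k : 'I_r * 'I_c => `|C k.1 k.2|) (j := (i, j))).

Qed.

Lemma mulmx_const1 (r c : nat) (pi : 'M[R]_(r, c)) i :
  (pi *m const_mx 1 : 'cV_r) i 0 = \sum_j pi i j.
Proof. by rewrite !mxE; apply: eq_bigr => j _; rewrite !mxE mulr1. Qed.

Lemma plansP p q pi :
  plans p q pi <-> [/\ forall i j, 0 <= pi i j,
    forall i, \sum_j pi i j = p i 0 & forall j, \sum_i pi i j = q j 0].
Proof.
split=> -[pi0 hp hq]; split => //.
- by move=> i; rewrite -hp mulmx_const1.
- by move=> j; rewrite -hq mulmx_const1; apply: eq_bigr => i _; rewrite mxE.
- by apply/colP => i; rewrite mulmx_const1.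
- by apply/colP => j; rewrite mulmx_const1 -hq; apply: eq_bigr => i _; rewrite mxE.
Qed.

Lemma plans_prod p q : simplex R n p -> simplex R n q ->
  plans p q (\matrix_(i, j) (p i 0 * q j 0)).
Proof.
move=> [p0 sp] [q0 sq]; apply/plansP; split.
- by move=> i j; rewrite mxE mulr_ge0.
- by move=> i; under eq_bigr do rewrite mxE; rewrite -mulr_sumr sq mulr1.
- by move=> j; under eq_bigr do rewrite mxE; rewrite -mulr_suml sp mul1r.
Qed.

Lemma plans_simplexr p q pi : simplex R n p -> plans p q pi -> simplex R n q.
Proof.
move=> [p0 sp] /plansP[pi0 hp hq]; split; first by move=> j; rewrite -hq sumr_ge0.
under eq_bigr do rewrite -hq.
by rewrite exchange_big/= -sp; apply: eq_bigr => i _; rewrite hp.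
Qed.

Variable C : 'M[R]_n.
Hypothesis C_ge0 : forall i j, 0 <= C i j.

Lemma frobenius_ge0 pi : (forall i j, 0 <= pi i j) -> 0 <= frobenius C pi.
Proof. by move=> pi0; do 2 apply: sumr_ge0 => ? _; rewrite mulr_ge0. Qed.

Lemma frobenius_le pi : (forall i j, 0 <= pi i j) ->
  frobenius C pi <= `|C| * \sum_i \sum_j pi i j.
Proof.
move=> pi0; rewrite mulr_sumr; apply: ler_sum => i _.
rewrite mulr_sumr; apply: ler_sum => j _; rewrite ler_wpM2r//.
by apply: le_trans (entry_le_norm _ i j); exact: ler_norm.
Qed.

Let cost_lbound p q : has_lbound [set frobenius C pi | pi in plans p q].
Proof. by exists 0 => _ [pi /plansP[pi0 _ _] <-]; exact: frobenius_ge0. Qed.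

Lemma transport_ge0 p q : 0 <= transport C p q.
Proof.
rewrite /transport.
have [->|/set0P ne] := eqVneq [set frobenius C pi | pi in plans p q] set0.
  by rewrite inf0.
by apply: lb_le_inf => // _ [pi /plansP[pi0 _ _] <-]; exact: frobenius_ge0.
Qed.

Lemma transport_le_cost p q pi : plans p q pi -> transport C p q <= frobenius C pi.
Proof. by move=> h; apply: ge_inf; [exact: cost_lbound|exists pi]. Qed.

(** Near-optimal plans stand in for optimal ones: the slack [tau] is removed at the end of each
    estimate, which avoids a compactness argument on the set of plans. *)
Lemma transport_near p q tau : simplex R n p -> simplex R n q -> 0 < tau ->
  exists2 pi, plans p q pi & frobenius C pi < transport C p q + tau.
Proof.
move=> dp dq t0.
have [|_ [pi h <-] lt] := @inf_adherent R [set frobenius C pi | pi in plans p q] _ t0.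
  split; last exact: cost_lbound.
  eexists; exists (\matrix_(i, j) (p i 0 * q j 0)) => //.
  exact: plans_prod.
by exists pi.
Qed.

(** A vector off the simplex is the second marginal of no plan starting at p, and the infimum of the
    empty set is 0. The integral over all column vectors therefore sees only the simplex. *)
Lemma transport_outside p q : simplex R n p -> ~ simplex R n q ->
  transport C p q = 0.
Proof.
move=> dp dq; rewrite /transport (_ : [set frobenius C pi | pi in plans p q] = set0) ?inf0//.
by apply/seteqP; split=> // x [pi h _]; case: dq; exact: plans_simplexr h.
Qed.

(* Scale down the rows of pi, then its columns, until no marginal exceeds its
   target, and spread the missing mass as a product measure. *)
Lemma transport_le_relaxed p q pi : simplex R n p -> simplex R n q ->
  (forall i j, 0 <= pi i j) -> \sum_i \sum_j pi i j = 1 ->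
  transport C p q <= frobenius C pi +
    `|C| * (l1 (fun i => \sum_j pi i j - p i 0) + l1 (fun j => \sum_i pi i j - q j 0)).
Proof.
move=> [p0 sp] [q0 sq] pi0 spi.
(* The factor, at most 1, that brings a mass s down to t. For s = 0 the quotient t / s is 0, which
   is harmless since it multiplies 0. *)
pose shrink (s t : R) := Num.min 1 (t / s).
have shrinkP s t : 0 <= s -> 0 <= t ->
    [/\ 0 <= shrink s t, shrink s t <= 1, shrink s t * s <= t &
        s - shrink s t * s <= Num.max 0 (s - t)].
  move=> s0 t0; rewrite /shrink ge_min lexx le_min ler01 divr_ge0//=.
  have [->|sN0] := eqVneq s 0; first by rewrite !mulr0 subrr le_max lexx.
  have {sN0}s0 : 0 < s by rewrite lt_neqAle eq_sym sN0.
  split=> //; first by rewrite -ler_pdivlMr// ge_min lexx orbT.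
  have [h|h] := leP 1 (t / s); first by rewrite mul1r subrr le_max lexx.
  by rewrite divfK ?gt_eqF// le_max lexx orbT.
pose r i := \sum_j pi i j.
have r0 i : 0 <= r i by apply: sumr_ge0.
pose pi1 i j := shrink (r i) (p i 0) * pi i j.
have pi10 i j : 0 <= pi1 i j.
  by rewrite mulr_ge0//; case: (shrinkP _ _ (r0 i) (p0 i)).
have pi1le i j : pi1 i j <= pi i j.
  by rewrite ler_piMl//; case: (shrinkP _ _ (r0 i) (p0 i)).
pose c1 j := \sum_i pi1 i j.
have c10 j : 0 <= c1 j by apply: sumr_ge0.
pose pi2 i j := shrink (c1 j) (q j 0) * pi1 i j.
have pi20 i j : 0 <= pi2 i j.
  by rewrite mulr_ge0//; case: (shrinkP _ _ (c10 j) (q0 j)).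
have pi2le i j : pi2 i j <= pi1 i j.
  by rewrite ler_piMl//; case: (shrinkP _ _ (c10 j) (q0 j)).
have row1 i : \sum_j pi1 i j = shrink (r i) (p i 0) * r i by rewrite -mulr_sumr.
have col2 j : \sum_i pi2 i j = shrink (c1 j) (q j 0) * c1 j by rewrite -mulr_sumr.
pose e i := p i 0 - \sum_j pi2 i j.
pose f j := q j 0 - \sum_i pi2 i j.
have e0 i : 0 <= e i.
  rewrite subr_ge0; apply: (@le_trans _ _ (\sum_j pi1 i j)); first exact: ler_sum.
  by rewrite row1; case: (shrinkP _ _ (r0 i) (p0 i)).
have f0 j : 0 <= f j.
  by rewrite subr_ge0 col2; case: (shrinkP _ _ (c10 j) (q0 j)).
pose t := \sum_i e i.
have tE : t = 1 - \sum_i \sum_j pi2 i j by rewrite /t sumrB sp.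
have tf : \sum_j f j = t by rewrite tE sumrB sq exchange_big.
have t0 : 0 <= t by apply: sumr_ge0.
(* If no mass is missing, t = 0 and division by t returns 0; as e and f vanish as well, the formula
   for the added product measure remains correct. *)
have mul_div (x : R) : (t = 0 -> x = 0) -> x * t / t = x.
  have [t00 H|tN0 _] := eqVneq t 0; first by rewrite H// !mul0r.
  by rewrite mulfK.
pose pi3 := \matrix_(i, j) (pi2 i j + e i * f j / t).
have pl : plans p q pi3.
  apply/plansP; split.
  - by move=> i j; rewrite mxE addr_ge0// divr_ge0// mulr_ge0.
  - move=> i; under eq_bigr do rewrite mxE.
    rewrite big_split/= -mulr_suml -mulr_sumr tf mul_div => [|t00].
      by rewrite /e addrC subrK.
    by apply: (psumr_eq0P (P := xpredT) (F := e)) => //; rewrite -t00.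
  - move=> j; under eq_bigr do rewrite mxE.
    rewrite big_split/= -mulr_suml -mulr_suml -/t [t * _]mulrC mul_div => [|t00].
      by rewrite /f addrC subrK.
    by apply: (psumr_eq0P (P := xpredT) (F := f)) => //; rewrite tf.
apply: le_trans (transport_le_cost pl) _.
have -> : frobenius C pi3 = (\sum_i \sum_j C i j * pi2 i j) +
    frobenius C (\matrix_(i, j) (e i * f j / t)).
  rewrite /frobenius -big_split; apply: eq_bigr => i _.
  by rewrite -big_split; apply: eq_bigr => j _; rewrite !mxE mulrDr.
apply: lerD.
  do 2 apply: ler_sum => ? _; rewrite ler_wpM2l//.
  exact: le_trans (pi2le _ _) (pi1le _ _).
apply: le_trans (frobenius_le _) _.
  by move=> i j; rewrite mxE divr_ge0// mulr_ge0.
rewrite ler_wpM2l ?normr_ge0//.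
have -> : \sum_i \sum_j (\matrix_(i, j) (e i * f j / t)) i j = t.
  under eq_bigr => i _.
    under eq_bigr do rewrite mxE.
    rewrite -mulr_suml -mulr_sumr tf; over.
  by rewrite -!mulr_suml -/t mul_div.
(* The missing mass is what the two scalings removed: the excess of the rows, plus that of the
   columns after the rows were scaled. *)
have -> : t = (\sum_i (r i - shrink (r i) (p i 0) * r i)) +
    \sum_j (c1 j - shrink (c1 j) (q j 0) * c1 j).
  rewrite !sumrB -/(\sum_i r i) tE -spi.
  have -> : \sum_i shrink (r i) (p i 0) * r i = \sum_j c1 j.
    by under eq_bigr do rewrite -row1; rewrite exchange_big.
  under [X in _ + (_ - X)]eq_bigr do rewrite -col2.
  by rewrite addrA subrK; congr (_ - _); rewrite exchange_big.
have max_norm (x : R) : Num.max 0 x <= `|x| by rewrite ge_max normr_ge0 ler_norm.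
apply: lerD; apply: ler_sum => k _.
  case: (shrinkP _ _ (r0 k) (p0 k)) => _ _ _ /le_trans; apply; exact: max_norm.
case: (shrinkP _ _ (c10 k) (q0 k)) => _ _ _ /le_trans; apply.
(* Scaling the rows only shrinks the columns, so their excess over q is at most that of the columns
   of pi. *)
apply: le_trans (max_norm _); rewrite ge_max !le_max lexx/=; apply/orP; right.
by rewrite lerD2r; apply: ler_sum.
Qed.

(** A near-optimal plan for (p', q') is an approximate plan for (p, q) whose marginal errors are the
    two l1 distances; [transport_le_relaxed] repairs it. *)
Lemma transport_lipschitz p q p' q' : simplex R n p -> simplex R n q ->
  simplex R n p' -> simplex R n q' ->
  transport C p q <= transport C p' q' +
    `|C| * (l1 (fun i => p' i 0 - p i 0) + l1 (fun i => q' i 0 - q i 0)).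
Proof.
move=> dp dq dp' dq'; apply/ler_addgt0Pl => tau t0.
have [pi /plansP[pi0 h1 h2] lt] := transport_near dp' dq' t0.
have spi : \sum_i \sum_j pi i j = 1.
  by under eq_bigr do rewrite h1; case: dp'.
apply: le_trans (transport_le_relaxed dp dq pi0 spi) _.
rewrite addrA [tau + _]addrC lerD ?(ltW lt)// ler_wpM2l ?normr_ge0//.
by rewrite lerD//; apply: ler_sum => i _; rewrite ?h1 ?h2.
Qed.

Lemma simplex_midpoint p p' : simplex R n p -> simplex R n p' ->
  simplex R n (2^-1 *: (p + p')).
Proof.
move=> [p0 sp] [p0' sp']; split.
  by move=> i; rewrite !mxE mulr_ge0 ?invr_ge0 ?addr_ge0.
under eq_bigr do rewrite !mxE.
by rewrite -mulr_sumr big_split/= sp sp' mulVf.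
Qed.

(** Averaging two plans averages both their marginals and their costs. Convexity at midpoints is all
    that the growth argument uses. *)
Lemma transport_midpoint p p' q : simplex R n p -> simplex R n p' ->
  simplex R n q ->
  transport C (2^-1 *: (p + p')) q <= 2^-1 * (transport C p q + transport C p' q).
Proof.
move=> dp dp' dq; apply/ler_addgt0Pl => tau t0.
have [pi /plansP[pi0 h1 h2] lt] := transport_near dp dq t0.
have [pi' /plansP[pi0' h1' h2'] lt'] := transport_near dp' dq t0.
have pl : plans (2^-1 *: (p + p')) q (2^-1 *: (pi + pi')).
  apply/plansP; split.
  - by move=> i j; rewrite !mxE mulr_ge0 ?invr_ge0 ?addr_ge0.
  - move=> i; under eq_bigr do rewrite !mxE.
    by rewrite -mulr_sumr big_split/= h1 h1' !mxE.
  - move=> j; under eq_bigr do rewrite !mxE.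
    by rewrite -mulr_sumr big_split/= h2 h2'; lra.
apply: le_trans (transport_le_cost pl) _.
have -> : frobenius C (2^-1 *: (pi + pi')) =
    2^-1 * (frobenius C pi + frobenius C pi').
  rewrite /frobenius -big_split mulr_sumr; apply: eq_bigr => i _.
  rewrite -big_split mulr_sumr; apply: eq_bigr => j _; rewrite !mxE.
  by rewrite mulrCA mulrDr.
lra.
Qed.

End Transport.

(** * Stability of approximate minimizers *)

Section Stability.
Context {R : realType} {T : finType} {m : nat} {X : Type}.
Variable mu : T -> R.
Hypothesis mu_ge0 : forall t, 0 <= mu t.
Hypothesis mu_sum : \sum_t mu t = 1.
Local Notation sample := {ffun 'I_m -> T}.

Definition pmu (s : sample) : R := \prod_k mu (s k).

Lemma pmu_ge0 s : 0 <= pmu s. Proof. exact: prodr_ge0. Qed.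

Lemma pmu_sum : \sum_s pmu s = 1.
Proof.
rewrite -(bigA_distr_bigA (fun (_ : 'I_m) t => mu t)) big1// => k _.
Qed.

(** Exchanges the k-th sample with an independent fresh draw. As an involution preserving the weight
    [pmu s * mu t], it turns the ghost-sample argument into a reindexing of finite sums. *)
Definition resample (k : 'I_m) (st : sample * T) : sample * T :=
  ([ffun j => if j == k then st.2 else st.1 j], st.1 k).

Lemma resampleK k : involutive (resample k).
Proof.
move=> [s t]; rewrite /resample /= ffunE eqxx; congr pair.
by apply/ffunP => j; rewrite !ffunE /=; case: eqP => [->|].
Qed.

Lemma expect_resample k (phi : sample -> T -> R) :
  \sum_s \sum_t pmu s * mu t * phi s t =
  \sum_s \sum_t pmu s * mu t * phi (resample k (s, t)).1 (s k).
Proof.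
rewrite pair_big [RHS]pair_big /=.
rewrite (reindex_inj (inv_inj (resampleK k))) /=.
apply: eq_bigr => -[s t] _ /=; congr (_ * _).
rewrite /pmu (bigD1 k)//= [in RHS](bigD1 k)//= ffunE eqxx.
rewrite (eq_bigr (fun j => mu (s j))) => [|j /negbTE jk]; last by rewrite ffunE jk.
ring.
Qed.

Lemma expect_cst (s : sample) (x : R) : \sum_t pmu s * mu t * x = pmu s * x.
Proof. by rewrite -mulr_suml -mulr_sumr mu_sum mulr1. Qed.

Lemma expect_coord k (phi : T -> R) :
  \sum_s pmu s * phi (s k) = \sum_t mu t * phi t.
Proof.
transitivity (\sum_s \sum_t pmu s * mu t * phi (s k)).
  by apply: eq_bigr => s _; rewrite expect_cst.
rewrite -(expect_resample k (fun _ t => phi t)) -[RHS]mul1r -pmu_sum mulr_suml.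
by apply: eq_bigr => s _; rewrite mulr_sumr; apply: eq_bigr => t _; rewrite mulrA.
Qed.

Variables (S : set X) (ell : T -> X -> R) (h : X -> R).
Variables (dist : X -> X -> R) (mid : X -> X -> X) (c L tau : R).
Hypothesis m_gt0 : (0 < m)%N.
Hypothesis c_gt0 : 0 < c.
Hypothesis L_gt0 : 0 < L.
Hypothesis dist_ge0 : forall x y, 0 <= dist x y.
Hypothesis distC : forall x y, dist x y = dist y x.
Hypothesis midS : forall x y, S x -> S y -> S (mid x y).
Hypothesis ell_ge0 : forall t x, S x -> 0 <= ell t x.
Hypothesis h_ge0 : forall x, S x -> 0 <= h x.
Hypothesis ell_mid : forall t x y, S x -> S y ->
  ell t (mid x y) <= 2^-1 * (ell t x + ell t y).
Hypothesis h_mid : forall x y, S x -> S y ->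
  h (mid x y) <= 2^-1 * (h x + h y) - c * dist x y ^+ 2.
Hypothesis ell_lip : forall t x y, S x -> S y -> ell t x <= ell t y + L * dist x y.

Definition emp_obj (s : sample) x := m%:R^-1 * (\sum_k ell (s k) x) + h x.

Definition pop_obj x := \sum_t mu t * ell t x + h x.

Variable xh : sample -> X.
Hypothesis xhS : forall s, S (xh s).
Hypothesis xh_min : forall s y, S y -> emp_obj s (xh s) <= emp_obj s y + tau.

(** Near-minimality of [xh s] is tested at its midpoint with y, where strong convexity gains c
    dist^2; doubling gives 2 c dist^2 and the slack 2 tau. *)
Lemma emp_obj_growth s y : S y ->
  emp_obj s (xh s) + 2 * c * dist (xh s) y ^+ 2 <= emp_obj s y + 2 * tau.
Proof.
move=> Sy; have := xh_min s (midS (xhS s) Sy).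
have := h_mid (xhS s) Sy; move: (xhS s); move: (xh s) => x Sx hm.
rewrite /emp_obj.
have : m%:R^-1 * (\sum_k ell (s k) (mid x y)) <=
    2^-1 * (m%:R^-1 * (\sum_k ell (s k) x) + m%:R^-1 * (\sum_k ell (s k) y)).
  rewrite -mulrDr mulrCA ler_wpM2l ?invr_ge0// -big_split mulr_sumr.
  by apply: ler_sum => k _; exact: ell_mid.
move: (m%:R^-1 * _) (m%:R^-1 * _) (m%:R^-1 * _) hm => A B D.
move: (h _) (h _) (h _) => F G H; lra.
Qed.

(** With D = L / (c m) this reads tau <= c D^2 / 2: the tolerance stays below the scale of the
    stability bound. *)
Hypothesis tau_le : tau <= L ^+ 2 / (2 * c * m%:R ^+ 2).

Let mR : 0 < m%:R :> R. Proof. by rewrite ltr0n. Qed.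

Let avgc (z : R) : m%:R^-1 * (\sum_(k < m) z) = z.
Proof. by rewrite sumr_const card_ord -[z *+ m]mulr_natl mulKf// gt_eqF. Qed.

(** The two empirical objectives differ in one term only, so adding their growth inequalities gives
    4 c d^2 <= 2 L d / m + 4 tau <= 2 c (d D + D^2), which is impossible for d > D. *)
Lemma stability k s t :
  dist (xh s) (xh (resample k (s, t)).1) <= L / (c * m%:R).
Proof.
set s' := (resample k (s, t)).1; set x := xh s; set y := xh s'.
set d := dist x y; set D := L / (c * m%:R).
have h1 := emp_obj_growth s (xhS s').
have h2 := emp_obj_growth s' (xhS s).
rewrite -/x -/y -/d [dist y x]distC -/d in h1 h2.
have e z : emp_obj s z - emp_obj s' z = m%:R^-1 * (ell (s k) z - ell t z).
  rewrite /emp_obj opprD addrACA subrr addr0 -mulrBr; congr (_ * _).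
  rewrite (bigD1 k)//= [X in _ - X](bigD1 k)//= ffunE eqxx opprD addrACA.
  rewrite -[RHS]addr0; congr (_ + _); apply/eqP; rewrite subr_eq0; apply/eqP.
  by apply: eq_bigr => j /negbTE jk; rewrite ffunE jk.
have l1 := ell_lip (s k) (xhS s') (xhS s); have l2 := ell_lip t (xhS s) (xhS s').
rewrite -/x -/y [dist y x]distC -/d in l1 l2.
have h3 : m%:R^-1 * (ell (s k) y - ell t y) - m%:R^-1 * (ell (s k) x - ell t x)
    <= m%:R^-1 * (2 * (L * d)).
  by rewrite -mulrBr ler_wpM2l ?invr_ge0//; lra.
have h4 : 4 * c * d ^+ 2 <= m%:R^-1 * (2 * (L * d)) + 4 * tau.
  have := e x; have := e y.
  move: h1 h2 h3; move: (m%:R^-1 * _) (m%:R^-1 * _) (m%:R^-1 * _).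
  move: (emp_obj _ _) (emp_obj _ _) (emp_obj _ _) (emp_obj _ _).
  move=> a1 a2 a3 a4 a5 a6 a7; rewrite -!mulrA; move: (c * _) => a8; lra.
have D0 : 0 < D by rewrite divr_gt0// mulr_gt0.
have e1 : m%:R^-1 * (2 * (L * d)) = 2 * c * (d * D).
  by rewrite /D; field; rewrite !gt_eqF.
have e2 : 4 * tau <= 2 * c * (D * D).
  apply: le_trans (ler_wpM2l _ tau_le) _; first lra.
  by rewrite le_eqVlt; apply/orP; left; apply/eqP; rewrite /D; field; rewrite !gt_eqF.
have d0 : 0 <= d by exact: dist_ge0.
rewrite leNgt; apply/negP => Dd.
have h5 : 4 * c * d ^+ 2 <= 2 * c * (d * D + D * D).
  by rewrite mulrDr -e1; lra.
have : d * D + D * D < 2 * d ^+ 2 by nra.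
rewrite -(ltr_pM2l (_ : 0 < 2 * c)) ?mulr_gt0//.
move: h5; rewrite [2 * c * (2 * _)](_ : _ = 4 * c * d ^+ 2); last by ring.
by move=> h5 h6; have := le_lt_trans h5 h6; rewrite ltxx.
Qed.

(** Resampling turns the expected loss on a sample used for [xh] into the expected loss on a fresh
    draw, evaluated at a near-minimizer that stability keeps within D. The population value thus
    exceeds the empirical one by at most L D, and at the fixed y the empirical objective is
    unbiased. *)
Lemma expected_gap y : S y ->
  \sum_s pmu s * pop_obj (xh s) <= pop_obj y + (L ^+ 2 / (c * m%:R) + tau).
Proof.
move=> Sy; set D := L / (c * m%:R).
have LD : L ^+ 2 / (c * m%:R) = L * D by rewrite /D mulrA expr2.
have swap k : \sum_s pmu s * (\sum_t mu t * ell t (xh s)) <=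
    \sum_s pmu s * ell (s k) (xh s) + L * D.
  have -> : \sum_s pmu s * ell (s k) (xh s) =
      \sum_s \sum_t pmu s * mu t * ell t (xh (resample k (s, t)).1).
    transitivity (\sum_s \sum_t pmu s * mu t * ell (s k) (xh s)).
      by apply: eq_bigr => s _; rewrite expect_cst.
    rewrite (expect_resample k (fun s t => ell (s k) (xh s))).
    by apply: eq_bigr => s _; apply: eq_bigr => t _; rewrite /= ffunE eqxx.
  have -> : L * D = \sum_s \sum_t pmu s * mu t * (L * D).
    under eq_bigr do rewrite expect_cst.
    by rewrite -mulr_suml pmu_sum mul1r.
  rewrite -big_split; apply: ler_sum => s _ /=.
  rewrite mulr_sumr -big_split; apply: ler_sum => t _ /=.
  rewrite mulrA -mulrDr ler_wpM2l ?mulr_ge0 ?pmu_ge0//.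
  apply: le_trans (ell_lip t (xhS s) (xhS (resample k (s, t)).1)) _.
  by rewrite lerD2l ler_wpM2l ?(ltW L_gt0)//; exact: stability.
have avg : \sum_s pmu s * (\sum_t mu t * ell t (xh s)) <=
    \sum_s pmu s * (m%:R^-1 * \sum_k ell (s k) (xh s)) + L * D.
  set A := \sum_s pmu s * _.
  rewrite -(avgc A) -(avgc (L * D)).
  have -> : \sum_s pmu s * (m%:R^-1 * \sum_k ell (s k) (xh s)) =
      m%:R^-1 * \sum_(k < m) \sum_s pmu s * ell (s k) (xh s).
    rewrite exchange_big mulr_sumr; apply: eq_bigr => s _ /=.
    by rewrite mulrCA mulr_sumr.
  rewrite -mulrDr ler_wpM2l ?invr_ge0// -big_split; apply: ler_sum => k _.
  exact: swap.
have emp : \sum_s pmu s * emp_obj s (xh s) <= pop_obj y + tau.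
  apply: (@le_trans _ _ (\sum_s pmu s * (emp_obj s y + tau))).
    by apply: ler_sum => s _; rewrite ler_wpM2l ?pmu_ge0// xh_min.
  under eq_bigr do rewrite mulrDr.
  rewrite big_split/= -mulr_suml pmu_sum mul1r lerD2r.
  rewrite /emp_obj; under eq_bigr do rewrite mulrDr.
  rewrite big_split/= -mulr_suml pmu_sum mul1r lerD2r.
  have -> : \sum_s pmu s * (m%:R^-1 * \sum_k ell (s k) y) =
      m%:R^-1 * \sum_(k < m) \sum_s pmu s * ell (s k) y.
    rewrite exchange_big mulr_sumr; apply: eq_bigr => s _ /=.
    by rewrite mulrCA mulr_sumr.
  under eq_bigr do rewrite (expect_coord _ (fun t => ell t y)).
  by rewrite avgc.
rewrite LD /pop_obj; under eq_bigr do rewrite mulrDr.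
rewrite big_split/=; move: emp avg; rewrite /emp_obj /pop_obj.
rewrite (eq_bigr (fun s => pmu s * (m%:R^-1 * \sum_k ell (s k) (xh s)) +
  pmu s * h (xh s))) => [|s _]; last by rewrite mulrDr.
rewrite big_split/=; move: (\sum_s pmu s * h _) => H; lra.
Qed.

(** Markov's inequality for the excess over the infimum g, which is nonnegative by construction; one
    good event then serves every y. *)
Lemma high_probability_gap beta : 0 < beta ->
  exists2 good : pred sample, 1 - beta <= \sum_(s | good s) pmu s &
    forall s y, good s -> S y ->
      pop_obj (xh s) <= pop_obj y + (L ^+ 2 / (c * m%:R) + tau) / beta.
Proof.
move=> b0; set B := _ + tau.
pose g := inf [set pop_obj y | y in S].
have lb : has_lbound [set pop_obj y | y in S].
  exists 0 => _ [y Sy <-]; rewrite addr_ge0 ?h_ge0// sumr_ge0// => t _.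
  by rewrite mulr_ge0// ell_ge0.
have gle y : S y -> g <= pop_obj y by move=> Sy; apply: ge_inf => //; exists y.
have [s0] : exists s0 : sample, True.
  have := pmu_sum; case: (pickP (fun _ : sample => true)) => [s0 _|none]; first by exists s0.
  rewrite big_pred0// => /eqP; rewrite eq_sym oner_eq0//.
move=> _.
have Eg : \sum_s pmu s * pop_obj (xh s) <= g + B.
  rewrite -lerBlDr; apply: lb_le_inf; first by exists (pop_obj (xh s0)), (xh s0).
  by move=> _ [y Sy <-]; rewrite lerBlDr expected_gap.
exists (fun s => pop_obj (xh s) <= g + B / beta); last first.
  by move=> s y h1 Sy; apply: (le_trans h1); rewrite lerD2r gle.
have H : \sum_(s | ~~ (pop_obj (xh s) <= g + B / beta)) pmu s * (B / beta) <=
    \sum_s pmu s * (pop_obj (xh s) - g).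
  rewrite [leRHS](bigID (fun s => ~~ (pop_obj (xh s) <= g + B / beta)))/=.
  rewrite ler_wpDr//.
    by apply: sumr_ge0 => s _; rewrite mulr_ge0 ?pmu_ge0// subr_ge0 gle.
  apply: ler_sum => s; rewrite -ltNge => /ltW; rewrite -lerBrDl => ?.
  by rewrite ler_wpM2l ?pmu_ge0.
have E2 : \sum_s pmu s * (pop_obj (xh s) - g) <= B.
  under eq_bigr do rewrite mulrBr.
  by rewrite sumrB -mulr_suml pmu_sum mul1r lerBlDl.
have {H E2} : (\sum_(s | ~~ (pop_obj (xh s) <= g + B / beta)) pmu s) * B <= beta * B.
  rewrite -ler_pdivrMl// mulrCA -mulr_suml in H *.
  by rewrite [beta^-1 * B]mulrC; exact: le_trans H E2.
have B0 : 0 < B.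
  apply: ltr_pwDl; first by rewrite divr_gt0 ?exprn_gt0// mulr_gt0.
  (* Comparing [xh s0] with itself shows tau >= 0. *)
  by have := xh_min s0 (xhS s0); rewrite lerDl.
rewrite ler_pM2r// => bad; have := pmu_sum.
rewrite (bigID (fun s => pop_obj (xh s) <= g + B / beta))/=.
move: bad; lra.
Qed.

End Stability.

(** * Discretization of the samples *)

Section BorelSimplex.
Context {R : realType} {n : nat}.
Local Notation BV := (borel_cV R n).

Lemma borel_open (A : set 'cV[R]_n) : open A -> measurable (A : set BV).
Proof. by move=> oA; apply: sub_sigma_algebra. Qed.

Lemma borel_ge (f : 'cV[R]_n -> R) (c : R) : continuous f ->
  measurable ([set q | c <= f q] : set BV).
Proof.
move=> cf; rewrite [X in measurable X](_ : _ = ~` (f @^-1` [set x | x < c])).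
  apply: measurableC; apply: borel_open; apply: open_comp; last exact: open_lt.
  by move=> x _; exact: cf.
by apply/seteqP; split => q /=; rewrite leNgt => /negP.
Qed.

Lemma coord_sum_continuous (s : seq 'I_n) :
  continuous (fun q : 'cV[R]_n => \sum_(i <- s) q i 0 : R).
Proof.
elim: s => [|i s IH].
  rewrite [X in continuous X](_ : _ = cst 0); last by apply/funext => q; rewrite big_nil.
  exact: cst_continuous.
rewrite [X in continuous X](_ : _ = (fun q : 'cV[R]_n => q i 0 : R) +
  (fun q : 'cV[R]_n => \sum_(i <- s) q i 0)); last first.
  by apply/funext => q; rewrite big_cons.
by move=> q; apply: continuousD; [exact: coord_continuous|exact: IH].
Qed.

Lemma borel_simplex : measurable (simplex R n : set BV).
Proof.
rewrite [X in measurable X](_ : _ =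
  (\bigcap_(i in [set: 'I_n]) [set q : 'cV[R]_n | 0 <= q i 0]) `&`
  ([set q : 'cV[R]_n | 1 <= \sum_i q i 0] `&`
   [set q : 'cV[R]_n | -1 <= - \sum_i q i 0])); last first.
  apply/seteqP; split => q /=.
    by move=> [q0 sq]; split; [move=> i _; exact: q0|rewrite /= sq].
  move=> [q0 [h1 h2]]; split; first by move=> i; exact: q0.
  by apply/eqP; rewrite eq_le h1 -lerN2 h2.
have cs := @coord_sum_continuous (index_enum 'I_n).
apply: measurableI; last apply: measurableI.
- apply: fin_bigcap_measurable; first exact: finite_finset.
  by move=> i _; apply: borel_ge; exact: coord_continuous.
- exact: borel_ge.
- by apply: borel_ge => q; apply: continuousN; exact: cs.
Qed.

(** Half-open cubes of side 1 / M. A coordinate equal to 1 has index M, hence ['I_M.+1]. *)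
Definition grid_cell (M : nat) (t : {ffun 'I_n -> 'I_M.+1}) : set 'cV[R]_n :=
  simplex R n `&` [set q | forall i, (t i)%:R <= M%:R * q i 0 < (t i)%:R + 1].

Lemma borel_grid_cell M t : measurable (@grid_cell M t : set BV).
Proof.
apply: measurableI; first exact: borel_simplex.
rewrite [X in measurable X](_ : _ = \bigcap_(i in [set: 'I_n])
  ([set q : 'cV[R]_n | (t i)%:R <= M%:R * q i 0] `&`
   ~` [set q : 'cV[R]_n | (t i)%:R + 1 <= M%:R * q i 0])); last first.
  apply/seteqP; split => q /= h i.
    by move=> _; case/andP: (h i) => h1 h2; split=> //; apply/negP; rewrite -ltNge.
  by have [h1 /negP] := h i Logic.I; rewrite -ltNge => ->; rewrite h1.
apply: fin_bigcap_measurable; first exact: finite_finset.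
have cM i : continuous (fun q : 'cV[R]_n => M%:R * q i 0 : R).
  move=> q; apply: (@continuousM _ _ (cst M%:R) (fun q : 'cV[R]_n => q i 0)).
    exact: cst_continuous.
  exact: coord_continuous.
move=> i _; apply: measurableI; last apply: measurableC; exact: borel_ge.
Qed.

Lemma grid_cell_disjoint M t t' q : grid_cell t q -> @grid_cell M t' q -> t = t'.
Proof.
move=> [_ h] [_ h']; apply/ffunP => i; apply/val_inj => /=.
have /andP[a1 a2] := h i; have /andP[b1 b2] := h' i.
have := le_lt_trans a1 b2; have := le_lt_trans b1 a2.
by rewrite !natr1 !ltr_nat !ltnS => h1 h2; apply/eqP; rewrite eqn_leq h1 h2.
Qed.

Lemma grid_cell_cover M q : simplex R n q -> exists t, @grid_cell M t q.
Proof.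
move=> dq; have [q0 sq] := dq.
have q1 i : q i 0 <= 1 by exact: (@distr_le1 R _ (q ^~ 0) i q0 sq).
have x0 i : 0 <= M%:R * q i 0 by rewrite mulr_ge0.
have lt i : (Num.truncn (M%:R * q i 0)%R < M.+1)%N.
  rewrite ltnS -(ler_nat R); apply: le_trans (_ : M%:R * q i 0 <= _).
    by case/andP: (truncn_itv (x0 i)).
  by rewrite ler_piMr.
exists [ffun i => Ordinal (lt i)]; split=> // i; rewrite ffunE /= natr1.
exact: truncn_itv.
Qed.

Lemma grid_cell_diam M t q q' : (0 < M)%N -> grid_cell t q -> @grid_cell M t q' ->
  l1 (fun i => q i 0 - q' i 0) <= n%:R / M%:R.
Proof.
move=> M0 [_ h] [_ h']; have MR : 0 < M%:R :> R by rewrite ltr0n.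
apply: (@le_trans _ _ (\sum_(i < n) M%:R^-1)); last first.
  by rewrite sumr_const card_ord mulr_natl.
apply: ler_sum => i _.
have /andP[a1 a2] := h i; have /andP[b1 b2] := h' i.
rewrite -[leRHS]mulr1 ler_pdivlMl// -[X in X * _]gtr0_norm// -normrM mulrBr.
rewrite ler_norml; lra.
Qed.

End BorelSimplex.

(** The integral of a nonnegative function is a supremum over the simple functions below it, hence
    monotone for arbitrary functions. The map q -> transport C p q can thus be integrated without a
    proof that it is measurable. *)
Lemma ge0_le_integral_setT (d : measure_display) (T : measurableType d) (R : realType)
    (mu : {measure set T -> \bar R}) (f g : T -> \bar R) :
  (forall x, 0 <= f x)%E -> (forall x, f x <= g x)%E ->
  (\int[mu]_x f x <= \int[mu]_x g x)%E.
Proof.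
move=> f0 fg; have g0 x : (0 <= g x)%E by apply: le_trans (f0 x) (fg x).
rewrite !ge0_integralTE//; apply: le_ereal_sup => _ [h hf <-]; exists h => // x.
exact: le_trans (hf x) (fg x).
Qed.

(** * Integration and sampling over a finite partition *)

Section FinitePartition.
Context {R : realType} {d : measure_display} {T : measurableType d}.
Variables (P : probability T R) (I : finType) (A : I -> set T).
Hypothesis mA : forall t, measurable (A t).
Hypothesis dA : forall t t' x, A t x -> A t' x -> t = t'.

Definition cell_mass (t : I) : R := fine (P (A t)).

Lemma cell_massE t : P (A t) = (cell_mass t)%:E.
Proof. by rewrite fineK// fin_num_measure. Qed.

Lemma cell_mass_ge0 t : 0 <= cell_mass t.
Proof. by rewrite fine_ge0. Qed.

Lemma trivIset_cells D : trivIset D A.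
Proof. by move=> t t' _ _ [x [h h']]; exact: dA h h'. Qed.

Lemma measure_fin_cells (D : pred I) :
  P (\bigcup_(t in [set` D]) A t) = (\sum_(t | D t) cell_mass t)%:E.
Proof.
rewrite measure_fin_bigcup; [|exact: finite_finset|exact: trivIset_cells|by move=> *].
rewrite -(bigfs _ (index_enum_uniq I)) => [|t _]; last by rewrite mem_index_enum.
by rewrite -sumEFin; apply: eq_bigr => t _; exact: cell_massE.
Qed.

Lemma integral_fin_cells (c : I -> R) : (forall t, 0 <= c t) ->
  (\int[P]_x (\sum_t c t * \1_(A t) x)%:E = (\sum_t cell_mass t * c t)%:E)%E.
Proof.
move=> c0; under eq_integral do rewrite -sumEFin.
rewrite ge0_integral_sum//; last 2 first.
- move=> t; apply/measurable_EFinP; exact: measurable_funM.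
- by move=> t x _; rewrite lee_fin mulr_ge0.
rewrite -sumEFin; apply: eq_bigr => t _.
under eq_integral do rewrite EFinM.
rewrite ge0_integralZl_EFin//; last first.
  by apply/measurable_EFinP; exact: measurable_indic.
by rewrite integral_indic// setIT EFinM muleC; congr (_ * _)%E; exact: cell_massE.
Qed.

Lemma sum_cells_at (c : I -> R) t x : A t x -> \sum_s c s * \1_(A s) x = c t.
Proof.
move=> h; rewrite (bigD1 t)//= indicE mem_set// mulr1 big1 ?addr0// => s st.
rewrite indicE memNset ?mulr0// => h'; case/eqP: st; exact: dA h' h.
Qed.

Lemma sum_cells_out (c : I -> R) x : (forall t, ~ A t x) ->
  \sum_s c s * \1_(A s) x = 0.
Proof. by move=> h; rewrite big1// => s _; rewrite indicE memNset ?mulr0. Qed.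

(** The function is sandwiched between step functions with values v t - e and v t + e on the cells.
    The lower one is truncated at 0, since monotonicity is used for nonnegative functions only. *)
Lemma Rintegral_cells (f : T -> R) (v : I -> R) (e : R) : 0 <= e ->
  (forall x, 0 <= f x) -> (forall x, (forall t, ~ A t x) -> f x = 0) ->
  (forall t, 0 <= v t) ->
  (forall t x, A t x -> `|f x - v t| <= e) -> \sum_t cell_mass t = 1 ->
  `|\int[P]_x f x - \sum_t cell_mass t * v t| <= e.
Proof.
move=> e0 f0 fout v0 fv sm.
have up : (\int[P]_x (f x)%:E <= (\sum_t cell_mass t * (v t + e))%:E)%E.
  rewrite -integral_fin_cells; last by move=> t; rewrite addr_ge0.
  apply: ge0_le_integral_setT => x; rewrite lee_fin//.
  have [[t h]|/forallNP h] := pselect (exists t, A t x).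
    rewrite (sum_cells_at (fun t => v t + e) h).
    by have := fv _ _ h; rewrite ler_distl => /andP[].
  by rewrite fout// sumr_ge0// => t _; rewrite mulr_ge0// addr_ge0.
have lo : ((\sum_t cell_mass t * Num.max (v t - e) 0)%:E <= \int[P]_x (f x)%:E)%E.
  rewrite -integral_fin_cells; last by move=> t; rewrite le_max lexx orbT.
  have mx t : 0 <= Num.max (v t - e) 0 by rewrite le_max lexx orbT.
  apply: ge0_le_integral_setT => x; rewrite lee_fin.
    by rewrite sumr_ge0// => t _; rewrite mulr_ge0.
  have [[t h]|/forallNP h] := pselect (exists t, A t x).
    rewrite (sum_cells_at (fun t => Num.max (v t - e) 0) h) ge_max f0 andbT.
    by have := fv _ _ h; rewrite ler_distl => /andP[].
  by rewrite sum_cells_out.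
have fin : (\int[P]_x (f x)%:E)%E \is a fin_num.
  rewrite fin_numE; apply/andP; split; apply/eqP => h; move: up lo; rewrite h//.
rewrite /Rintegral; move: up lo; rewrite -(fineK fin) !lee_fin => up lo.
have h1 : \sum_t cell_mass t * (v t + e) = \sum_t cell_mass t * v t + e.
  under eq_bigr do rewrite mulrDr.
  by rewrite big_split/= -mulr_suml sm mul1r.
have h2 : \sum_t cell_mass t * v t - e <= \sum_t cell_mass t * Num.max (v t - e) 0.
  rewrite -[X in _ - X]mul1r -sm mulr_suml -sumrB; apply: ler_sum => t _.
  by rewrite -mulrBr ler_wpM2l ?cell_mass_ge0// le_max lexx.
by rewrite ler_norml; move: up lo h1 h2; lra.
Qed.

Variables (d' : measure_display) (O : measurableType d') (Pr : probability O R).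
Variables (m : nat) (X : 'I_m -> O -> T).
Hypothesis iidX : iid Pr P X.

Lemma iid_cells (good : pred {ffun 'I_m -> I}) :
  exists E : set O, [/\ measurable E,
    Pr E = (\sum_(s | good s) pmu cell_mass s)%:E &
    forall o, E o -> exists2 s, good s & forall k, A (s k) (X k o)].
Proof.
have [mX dX indX] := iidX.
pose B (s : {ffun 'I_m -> I}) : set O := \bigcap_k (X k @^-1` A (s k)).
have mB s : measurable (B s).
  apply: fin_bigcap_measurable; first exact: finite_finset.
  by move=> k _; rewrite -[X in measurable X]setTI; exact: mX.
have tB : trivIset [set` good] B.
  move=> s s' _ _ [w [h h']]; apply/ffunP => k.
  by apply: (dA (h k Logic.I)); exact: (h' k Logic.I).
pose E := \bigcup_(s in [set` good]) B s.
exists E; split.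
- by apply: fin_bigcup_measurable => //; exact: finite_finset.
- rewrite measure_fin_bigcup; [|exact: finite_finset|exact: tB|by move=> *].
  rewrite -(bigfs _ (index_enum_uniq _)) => [|s _]; last by rewrite mem_index_enum.
  rewrite -sumEFin; apply: eq_bigr => s _.
  transitivity (\prod_k Pr (X k @^-1` A (s k)))%E; first exact: indX.
  rewrite /pmu -prodEFin; apply: eq_bigr => k _.
  transitivity (P (A (s k))); first exact: dX.
  exact: cell_massE.
- by move=> o [s gs h]; exists s => // k; exact: (h k Logic.I).
Qed.

End FinitePartition.

(** * From stability to the statistical guarantee *)

Section Generalization.
Context {R : realType} {n : nat}.
Hypothesis n_gt1 : (1 < n)%N.
Implicit Types (p q x y : 'cV[R]_n).
Local Notation L := (ln n%:R : R).

(** With z the midpoint, the pairings of the gradient at p with x - p and y - p sum to twice that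
    with z - p, while x - z and y - z are opposite. *)
Lemma Bd_parallelogram x y p : simplex R n x -> simplex R n y -> simplex R n p ->
  Bd x p + Bd y p = 2 * Bd (2^-1 *: (x + y)) p
    + Bd x (2^-1 *: (x + y)) + Bd y (2^-1 *: (x + y)).
Proof.
move=> dx dy dp; have dm := simplex_midpoint dx dy.
set z := 2^-1 *: (x + y) in dm *.
rewrite /Bd /bregman !(derive_prox_simplex n_gt1)//.
have subE (u v : 'cV[R]_n) i : (u - v) i 0 = u i 0 - v i 0 by rewrite !mxE.
have zE i : z i 0 = 2^-1 * (x i 0 + y i 0) by rewrite !mxE.
have e1 : \sum_i prox_grad p i 0 * (x - p) i 0 + \sum_i prox_grad p i 0 * (y - p) i 0
    = 2 * \sum_i prox_grad p i 0 * (z - p) i 0.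
  rewrite -big_split mulr_sumr; apply: eq_bigr => i _ /=.
  by rewrite !subE zE; field.
have e2 : \sum_i prox_grad z i 0 * (x - z) i 0 + \sum_i prox_grad z i 0 * (y - z) i 0
    = 0.
  rewrite -big_split big1// => i _ /=.
  by rewrite !subE zE; field.
move: e1 e2; move: (\sum_i _) (\sum_i _) (\sum_i _) (\sum_i _) (\sum_i _) => A B D E F.
by move: (prox_fun _) (prox_fun _) (prox_fun _) (prox_fun _); clear=> *; lra.
Qed.

(** The gain is half the sum of the two divergences to the midpoint, each at least 1/24 (l / 2)^2 =
    l^2 / 96. *)
Lemma Bd_midpoint x y p : simplex R n x -> simplex R n y -> simplex R n p ->
  Bd (2^-1 *: (x + y)) p <=
    2^-1 * (Bd x p + Bd y p) - 96^-1 * l1 (fun i => x i 0 - y i 0) ^+ 2.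
Proof.
move=> dx dy dp; have dm := simplex_midpoint dx dy.
have := Bd_parallelogram dx dy dp.
have := Bd_strongly_convex n_gt1 dx dm; have := Bd_strongly_convex n_gt1 dy dm.
have halfE (u v : 'cV[R]_n) : l1 (fun i => u i 0 - (2^-1 *: (u + v)) i 0) =
    2^-1 * l1 (fun i => u i 0 - v i 0).
  rewrite /l1 mulr_sumr; apply: eq_bigr => i _.
  rewrite -[X in X * _]ger0_norm ?invr_ge0// -normrM !mxE.
  by congr `|_|; field.
rewrite halfE addrC halfE /l1.
under [X in 24^-1 * (2^-1 * X) ^+ 2 <= _ -> _]eq_bigr do rewrite distrC.
move: (\sum_i _) => l; rewrite exprMn.
move: (Bd _ _) (Bd _ _) (Bd _ _) (Bd _ _) (Bd _ _) => A B D E F.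
by clear; move: (l ^+ 2) => l2; lra.
Qed.

Lemma penalized_gap_le m (C : 'M[R]_n) (q : 'I_m -> 'cV[R]_n) (lam e : R) p1 p p' :
  (forall i j, 0 <= C i j) -> 0 <= lam -> simplex R n p1 -> simplex R n p' ->
  penalized_gap C q lam p1 p <= e ->
  penalized C q lam p1 p <= penalized C q lam p1 p' + e.
Proof.
move=> C0 lam0 dp1 dp'; rewrite /penalized_gap lerBlDl addrC => h.
apply: (le_trans h); rewrite addrC lerD2r; apply: ge_inf; last by exists p'.
exists 0 => _ [x dx <-]; rewrite addr_ge0 ?mulr_ge0 ?invr_ge0 ?Bd_ge0//.
by apply: sumr_ge0 => k _; exact: transport_ge0.
Qed.

(** The budget for eps: 1/2 for the bias lam Bd pstar p1, 3/16 for Markov's inequality, 1/8 for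
    moving from the near-minimizer to [phat], and 2/32 for rounding in the two expectations. *)
Lemma statistical_bound (C : 'M[R]_n) (P : probability (borel_cV R n) R)
    (p1 pstar : 'cV[R]_n) (eps beta lam eps' : R) (m : nat) :
  (forall i j, 0 <= C i j) -> P (simplex R n) = 1%E -> simplex R n p1 ->
  simplex R n pstar -> 0 < `|C| -> 0 < beta -> 0 < eps -> 0 < eps' -> 0 < lam ->
  (0 < m)%N -> lam * Bd pstar p1 <= eps / 2 ->
  `|C| ^+ 2 / (lam / 96 * m%:R) <= beta * eps / 8 ->
  `|C| ^+ 2 * eps' <= lam / 96 * (eps / 8) ^+ 2 ->
  forall (d : measure_display) (O : measurableType d) (Pr : probability O R)
    (q : 'I_m -> O -> borel_cV R n) (phat : O -> 'cV[R]_n),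
  iid Pr P q -> (forall o, simplex R n (phat o)) ->
  (forall o, penalized_gap C (fun k => q k o) lam p1 (phat o) <= eps') ->
  with_probability_at_least Pr (1 - beta)
    [set o | expected_transport C P (phat o) - expected_transport C P pstar <= eps].
Proof.
move=> C0 P1 dp1 dps; set K := `|C|; move=> K0 b0 e0 e0' l0 m0 hbias hm hopt.
move=> d O Pr q phat iidq dphat gphat.
have mR : 0 < m%:R :> R by rewrite ltr0n.
pose c := lam / 96.
have c0 : 0 < c by rewrite divr_gt0.
(* In order: the tolerances allowed by stability, by the growth inequality and by Markov's
   inequality. *)
pose tau := Num.min (K ^+ 2 / (2 * c * m%:R ^+ 2)) (Num.min (eps' / 4) (beta * eps / 16)).
have tau0 : 0 < tau.
  by rewrite !lt_min !divr_gt0 ?exprn_gt0 ?mulr_gt0// exprn_gt0.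
have [tau1 [tau2 tau3]] : tau <= K ^+ 2 / (2 * c * m%:R ^+ 2) /\
    (tau <= eps' / 4 /\ tau <= beta * eps / 16).
  by rewrite /tau !ge_min !lexx !orbT.
(* The mesh of the grid: rounding changes a transport cost by at most K eta, which must be small
   against both eps' and eps. *)
pose eta := Num.min (eps' / 4) (eps / 32) / K.
have eta0 : 0 < eta by rewrite divr_gt0// lt_min !divr_gt0.
have [eta1 eta2] : K * eta <= eps' / 4 /\ K * eta <= eps / 32.
  by rewrite /eta mulrC divfK ?gt_eqF// !ge_min !lexx !orbT.
have n0 : (0 < n)%N by exact: ltn_trans n_gt1.
pose M := (Num.truncn (n%:R / eta)).+1.
have M0 : (0 < M)%N by [].
have diam : n%:R / M%:R <= eta.
  rewrite ler_pdivrMr ?ltr0n// mulrC -ler_pdivrMr//; apply: ltW.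
  have x0 : 0 <= n%:R / eta by rewrite divr_ge0// ltW.
  by have /andP[] := truncn_itv x0.
pose T := {ffun 'I_n -> 'I_M.+1}.
pose A : T -> set (borel_cV R n) := @grid_cell R n M.
have mA t : measurable (A t) by exact: borel_grid_cell.
have dA t t' x : A t x -> A t' x -> t = t' by exact: grid_cell_disjoint.
pose mu := cell_mass P A.
have mu0 t : 0 <= mu t by exact: cell_mass_ge0.
have mu1 : \sum_t mu t = 1.
  apply: EFin_inj; rewrite -P1 -(@measure_fin_cells _ _ _ P _ A mA dA xpredT).
  congr (P _); apply/seteqP; split => x /=; first by case=> t _ [].
  by move=> /(grid_cell_cover M)[t ht]; exists t.
(* A representative of each cell; for an empty cell p1 serves, so that every representative lies in
   the simplex. *)
have [v vA] : {v : T -> 'cV[R]_n & forall t, simplex R n (v t) /\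
    forall x, A t x -> A t (v t)}.
  apply: (@boolp.choice _ _ (fun t w => simplex R n w /\ forall x, A t x -> A t w)) => t.
  have [[x hx]|/forallNP h] := pselect (exists x, A t x).
    by exists x; split=> //; case: hx.
  by exists p1; split=> // x /h.
have vS t : simplex R n (v t) by case: (vA t).
have vclose t x : A t x -> l1 (fun i => x i 0 - v t i 0) <= eta.
  move=> h; case: (vA t) => _ /(_ x h) hv.
  exact: le_trans (grid_cell_diam M0 h hv) diam.
have tclose p t x : simplex R n p -> A t x ->
    `|transport C p x - transport C p (v t)| <= K * eta.
  move=> dp h; have dx : simplex R n x by case: h.
  have l10 : l1 (fun i => p i 0 - p i 0) = 0 :> R.
    by rewrite /l1 big1// => i _; rewrite subrr normr0.
  have h1 := transport_lipschitz C0 dp dx dp (vS t).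
  have h2 := transport_lipschitz C0 dp (vS t) dp dx.
  rewrite l10 add0r in h1 h2.
  have e : l1 (fun i => v t i 0 - x i 0) = l1 (fun i => x i 0 - v t i 0).
    by apply: eq_bigr => i _; rewrite distrC.
  rewrite e in h1; have h3 := ler_wpM2l (ltW K0) (vclose t x h).
  by rewrite ler_norml -/K in h1 h2 *; lra.
pose ell t p := transport C p (v t).
pose h p := lam * Bd p p1.
pose pop p := \sum_t mu t * ell t p.
have popclose p : simplex R n p -> `|expected_transport C P p - pop p| <= K * eta.
  move=> dp; apply: Rintegral_cells => //.
  - by rewrite mulr_ge0// ltW.
  - by move=> x; exact: transport_ge0.
  - move=> x hx; apply: transport_outside => // dx.
    by have [t ht] := grid_cell_cover M dx; exact: hx ht.
  - by move=> t; exact: transport_ge0.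
  - by move=> t x hx; exact: tclose.
have [xh xhP] : {xh : {ffun 'I_m -> T} -> 'cV[R]_n & forall s,
    simplex R n (xh s) /\ forall y, simplex R n y ->
      emp_obj ell h s (xh s) <= emp_obj ell h s y + tau}.
  apply: (@boolp.choice _ _ (fun s x => simplex R n x /\ forall y, simplex R n y ->
      emp_obj ell h s x <= emp_obj ell h s y + tau)) => s.
  have lb : has_lbound [set emp_obj ell h s y | y in simplex R n].
    exists 0 => _ [y dy <-]; apply: addr_ge0; last first.
      by rewrite mulr_ge0 ?(ltW l0)// Bd_ge0.
    rewrite mulr_ge0 ?invr_ge0//.
    by apply: sumr_ge0 => k _; exact: transport_ge0.
  have [|_ [x dx <-] hx] := @inf_adherent R [set emp_obj ell h s y | y in simplex R n] _ tau0.
    by split=> //; exists (emp_obj ell h s p1), p1.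
  exists x; split=> // y dy; apply: (le_trans (ltW hx)); rewrite lerD2r.
  by apply: ge_inf => //; exists y.
have xhS s : simplex R n (xh s) by case: (xhP s).
have xhm s y : simplex R n y -> emp_obj ell h s (xh s) <= emp_obj ell h s y + tau.
  by case: (xhP s) => _; apply.
pose dist p p' := l1 (fun i => p i 0 - p' i 0).
have dist0 p p' : 0 <= dist p p' by exact: l1_ge0.
have distC p p' : dist p p' = dist p' p.
  by apply: eq_bigr => i _; rewrite distrC.
pose mid p p' := 2^-1 *: (p + p') : 'cV[R]_n.
have ell_lip t p p' : simplex R n p -> simplex R n p' ->
    ell t p <= ell t p' + K * dist p p'.
  move=> dp dp'; have := transport_lipschitz C0 dp (vS t) dp' (vS t).
  have -> : l1 (fun i => v t i 0 - v t i 0) = 0 :> R.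
    by rewrite /l1 big1// => i _; rewrite subrr normr0.
  by rewrite addr0 distC.
have h_mid x y : simplex R n x -> simplex R n y ->
    h (mid x y) <= 2^-1 * (h x + h y) - c * dist x y ^+ 2.
  move=> dx dy; have := ler_wpM2l (ltW l0) (Bd_midpoint dx dy dp1).
  rewrite /h /c /dist; move: (l1 _ ^+ 2) => l2.
  by move: (Bd _ _) (Bd _ _) (Bd _ _) => a1 a2 a3; clear; lra.
have midS x y : simplex R n x -> simplex R n y -> simplex R n (mid x y).
  by exact: simplex_midpoint.
have ell0 t x : simplex R n x -> 0 <= ell t x by move=> _; exact: transport_ge0.
have h0 x : simplex R n x -> 0 <= h x.
  by move=> dx; rewrite mulr_ge0 ?(ltW l0)// Bd_ge0.
have ell_mid t x y : simplex R n x -> simplex R n y ->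
    ell t (mid x y) <= 2^-1 * (ell t x + ell t y).
  by move=> dx dy; exact: transport_midpoint.
have [good good1 good2] := high_probability_gap mu0 mu1 m0 c0 K0 dist0 distC midS
  ell0 h0 ell_mid h_mid ell_lip xhS xhm tau1 b0.
have growth := emp_obj_growth midS ell_mid h_mid xhS xhm.
have [E [mE PE EP]] := iid_cells mA dA iidq good.
exists E; first by split=> //; rewrite PE lee_fin.
move=> w Ew /=; have [s gs hs] := EP w Ew.
have pen p : simplex R n p ->
    `|penalized C (fun k => q k w) lam p1 p - emp_obj ell h s p| <= K * eta.
  move=> dp; rewrite /penalized /emp_obj -/(h p) opprD addrACA subrr addr0.
  rewrite -mulrBr -sumrB normrM ger0_norm ?invr_ge0// ler_pdivrMl//.
  apply: le_trans (ler_norm_sum _ _ _) _.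
  rewrite mulr_natl -[X in _ *+ X]card_ord -sumr_const; apply: ler_sum => k _.
  exact: tclose.
have g1 := penalized_gap_le C0 (ltW l0) dp1 (xhS s) (gphat w).
have p2 := pen _ (dphat w); have p3 := pen _ (xhS s).
have g2 := growth s _ (dphat w).
(* Passing between true and rounded samples costs eps' / 4 at each of two points, so [phat w]
   minimizes the rounded objective up to 3/2 eps'; growth adds 2 tau <= eps' / 2. *)
have dsq : 2 * c * dist (xh s) (phat w) ^+ 2 <= 2 * eps'.
  move: tau2 eta1 g1 p2 p3 g2.
  move: (2 * c * _) (emp_obj ell h s (xh s)) (emp_obj ell h s (phat w))
    (penalized _ _ _ _ (phat w)) (penalized _ _ _ _ (xh s)) (K * eta) (tau).
  clear=> x1 x2 x3 x4 x5 x6 x7 a1 a2 a3.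
  by rewrite !ler_norml => /andP[a4 a5] /andP[a6 a7] a8; lra.
have dle : K * dist (xh s) (phat w) <= eps / 8.
  rewrite -(@ler_pXn2r _ 2) ?nnegrE ?mulr_ge0 ?(ltW K0) ?divr_ge0 ?(ltW e0)//.
  rewrite exprMn -(ler_pM2l c0) mulrCA; apply: le_trans hopt.
  rewrite ler_wpM2l ?sqr_ge0//; move: dsq; move: (dist _ _ ^+ 2) (c).
  by clear=> x1 x2; lra.
have g3 := good2 s _ gs dps.
have pc1 := popclose _ (dphat w); have pc2 := popclose _ dps.
have h4 : pop (phat w) <= pop (xh s) + K * dist (xh s) (phat w).
  rewrite -[X in _ + X]mul1r -mu1 mulr_suml -big_split; apply: ler_sum => t _ /=.
  by rewrite -mulrDr ler_wpM2l// distC ell_lip.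
have h5 : (K ^+ 2 / (c * m%:R) + tau) / beta <= eps * (3 / 16).
  rewrite ler_pdivrMr//; move: hm tau3; rewrite -/c.
  by move: (K ^+ 2 / _) (tau); clear=> x1 x2; lra.
have h6 := h0 _ (xhS s).
move: g3; rewrite /pop_obj -/(pop (xh s)) -/(pop pstar) => g3.
move: hbias; rewrite -/(h pstar) => hbias.
move: g3 pc1 pc2 h4 h5 h6 dle eta2 hbias e0.
move: (_ / beta) (K * dist _ _) (K * eta) (h _) (h _) (pop _) (pop _) (pop _)
  (expected_transport _ _ _) (expected_transport _ _ _).
clear=> x1 x2 x3 x4 x5 x6 x7 x8 x9 x10 a1.
by rewrite !ler_norml => /andP[_ a2] /andP[a3 _] *; lra.
Qed.

End Generalization.

(** * Closed-form proximal steps *)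

Section Frobenius.
Context {R : realType}.

Lemma frobeniusE r c (M N : 'M[R]_(r, c)) : frobenius M N = \tr (M^T *m N).
Proof.
rewrite /mxtrace /frobenius exchange_big; apply: eq_bigr => j _ /=.
by rewrite !mxE; apply: eq_bigr => i _; rewrite mxE.
Qed.

Lemma frobenius_col r c (M N : 'M[R]_(r, c)) :
  frobenius M N = \sum_j \sum_i M i j * N i j.
Proof. by rewrite /frobenius exchange_big. Qed.

Lemma frobenius_cV r (u v : 'cV[R]_r) : frobenius u v = \sum_i u i 0 * v i 0.
Proof. by apply: eq_bigr => i _; rewrite big_ord1. Qed.

Lemma frobeniusC r c (M N : 'M[R]_(r, c)) : frobenius M N = frobenius N M.
Proof. by do 2 apply: eq_bigr => ? _; rewrite mulrC. Qed.

Lemma frobeniusDr r c (M N P : 'M[R]_(r, c)) :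
  frobenius M (N + P) = frobenius M N + frobenius M P.
Proof. by rewrite !frobeniusE mulmxDr mxtraceD. Qed.

Lemma frobeniusZr r c (a : R) (M N : 'M[R]_(r, c)) :
  frobenius M (a *: N) = a * frobenius M N.
Proof. by rewrite !frobeniusE -scalemxAr mxtraceZ. Qed.

Lemma frobeniusNr r c (M N : 'M[R]_(r, c)) : frobenius M (- N) = - frobenius M N.
Proof. by rewrite -scaleN1r frobeniusZr mulN1r. Qed.

Lemma frobeniusBr r c (M N P : 'M[R]_(r, c)) :
  frobenius M (N - P) = frobenius M N - frobenius M P.
Proof. by rewrite frobeniusDr frobeniusNr. Qed.

Lemma frobeniusDl r c (M N P : 'M[R]_(r, c)) :
  frobenius (N + P) M = frobenius N M + frobenius P M.
Proof. by rewrite ![frobenius _ M]frobeniusC frobeniusDr. Qed.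

Lemma frobeniusZl r c (a : R) (M N : 'M[R]_(r, c)) :
  frobenius (a *: N) M = a * frobenius N M.
Proof. by rewrite ![frobenius _ M]frobeniusC frobeniusZr. Qed.

Lemma frobeniusNl r c (M N : 'M[R]_(r, c)) : frobenius (- N) M = - frobenius N M.
Proof. by rewrite ![frobenius _ M]frobeniusC frobeniusNr. Qed.

Lemma frobeniusBl r c (M N P : 'M[R]_(r, c)) :
  frobenius (N - P) M = frobenius N M - frobenius P M.
Proof. by rewrite frobeniusDl frobeniusNl. Qed.

Lemma frobenius_sumr r c N (M : 'M[R]_(r, c)) (F : 'I_N -> 'M[R]_(r, c)) :
  frobenius M (\sum_k F k) = \sum_k frobenius M (F k).
Proof.
elim/big_ind2 : _ => //; last by move=> A a B b <- <-; rewrite frobeniusDr.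
by rewrite frobeniusE mulmx0 mxtrace0.
Qed.

Lemma frobenius_adjoint r s c (A : 'M[R]_(r, s)) (Y : 'M[R]_(r, c)) (X : 'M[R]_(s, c)) :
  frobenius (A^T *m Y) X = frobenius Y (A *m X).
Proof. by rewrite !frobeniusE trmx_mul trmxK mulmxA. Qed.

Lemma frobenius_delta r c (G : 'M[R]_(r, c)) i j : frobenius G (delta_mx i j) = G i j.
Proof.
rewrite /frobenius (bigD1 i)//= (bigD1 j)//= !mxE !eqxx mulr1 !big1 ?addr0//.
  by move=> k /negbTE kj; rewrite big1// => l _; rewrite mxE kj mulr0.
by move=> k /negbTE kj; rewrite mxE eqxx kj mulr0.
Qed.

Definition sqnorm r c (M : 'M[R]_(r, c)) : R := frobenius M M.

Lemma sqnorm_ge0 r c (M : 'M[R]_(r, c)) : 0 <= sqnorm M.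
Proof. by do 2 apply: sumr_ge0 => ? _; rewrite -expr2 sqr_ge0. Qed.

Lemma frobenius_young r c (M N : 'M[R]_(r, c)) (rho : R) : 0 < rho ->
  frobenius M N <= rho / 2 * sqnorm M + (2 * rho)^-1 * sqnorm N.
Proof.
move=> r0; rewrite /sqnorm /frobenius !mulr_sumr -big_split; apply: ler_sum => i _ /=.
rewrite !mulr_sumr -big_split; apply: ler_sum => j _ /=.
rewrite -subr_ge0.
have -> : rho / 2 * (M i j * M i j) + (2 * rho)^-1 * (N i j * N i j) - M i j * N i j
  = (2 * rho)^-1 * (rho * M i j - N i j) ^+ 2 by field; rewrite gt_eqF.
by rewrite mulr_ge0 ?sqr_ge0// invr_ge0 mulr_ge0// ltW.
Qed.

Lemma sqnormB r c (M N : 'M[R]_(r, c)) :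
  sqnorm (M - N) = sqnorm M - 2 * frobenius M N + sqnorm N.
Proof.
rewrite /sqnorm !frobeniusBr !frobeniusBl [frobenius N M]frobeniusC; ring.
Qed.

End Frobenius.

(** * Gradients and Bregman divergences of the two proximal setups *)

Section Gradients.
Context {R : realType}.

Lemma grad_eq r c (f : 'M[R]_(r, c) -> R) u (G : 'M[R]_(r, c)) :
  (forall v : 'M[R]_(r, c), 'D_v f u = frobenius G v) -> grad f u = G.
Proof. by move=> h; apply/matrixP => i j; rewrite mxE h frobenius_delta. Qed.

Lemma derive_affine_line (V : normedModType R) (f : V -> R) x v l :
  (forall t, f (x + t *: v) = f x + t * l) -> 'D_v f x = l.
Proof.
move=> h; apply: derive_line.
rewrite (_ : (fun t : R => f (x + t *: v)) = fun t => f x + t * l).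
  exact: is_derive_affine.
by apply/funext => t; exact: h.
Qed.

Lemma is_deriveD_fun (f g : R -> R) (z u v : R) :
  is_derive z 1 f u -> is_derive z 1 g v ->
  is_derive z 1 (fun z => f z + g z) (u + v).
Proof. by move=> df dg; have := is_deriveD df dg. Qed.

Lemma is_derive_sum_fun k (f : 'I_k -> R -> R) (z : R) (u : 'I_k -> R) :
  (forall i, is_derive z 1 (f i) (u i)) ->
  is_derive z 1 (fun z => \sum_i f i z) (\sum_i u i).
Proof.
move=> h; have d := @is_derive_sum R R R k f z 1 u h.
rewrite (_ : (fun z => \sum_i f i z) = \sum_i f i)//.
by apply/funext => t; rewrite fct_sumE.
Qed.

Lemma derive_entropy r c (V W : 'M[R]_(r, c)) : (forall i j, 0 < V i j) ->
  'D_W (@entropy R r c) V = \sum_i \sum_j (ln (V i j) + 1) * W i j.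
Proof.
move=> V0; apply: derive_line.
rewrite (_ : (fun t : R => entropy (V + t *: W)) = fun t => \sum_i \sum_j
    (V i j + t * W i j) * ln (V i j + t * W i j)).
  apply: is_derive_sum_fun => i; apply: is_derive_sum_fun => j.
  have p : 0 < (fun t => V i j + t * W i j) 0 by rewrite mul0r addr0.
  have := @is_derive1_comp R (fun z => z * ln z) (fun t => V i j + t * W i j) 0 _ _
      (is_derive_xlnx p) (is_derive_affine (V i j) (W i j) 0).
  by rewrite /= mul0r addr0.
by apply/funext => t; do 2 apply: eq_bigr => ? _; rewrite !mxE.
Qed.

Definition KLm r c (U V : 'M[R]_(r, c)) : R := \sum_j KL (U ^~ j) (V ^~ j).

Lemma bregman_entropyE r c (U V : 'M[R]_(r, c)) : (forall i j, 0 < V i j) ->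
  bregman (@entropy R r c) U V = KLm U V.
Proof.
move=> V0; rewrite /bregman derive_entropy// /entropy /KLm /KL exchange_big /=.
rewrite [X in _ - X - _]exchange_big /= [X in _ - _ - X]exchange_big /= -!sumrB.
apply: eq_bigr => j _; rewrite -!sumrB; apply: eq_bigr => i _.
by rewrite !mxE /kl; ring.
Qed.

Lemma bregman_half_sqnormE r c (Y Z : 'M[R]_(r, c)) :
  bregman (@half_sqnorm R r c) Y Z = 2^-1 * sqnorm (Y - Z).
Proof.
rewrite /bregman (_ : 'D_(Y - Z) _ Z = frobenius Z (Y - Z)).
  rewrite /half_sqnorm -/(sqnorm Y) -/(sqnorm Z) sqnormB frobeniusBr -/(sqnorm Z).
  by rewrite [frobenius Z Y]frobeniusC; field.
apply: derive_line; set W := Y - Z.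
have d := is_deriveD_fun (is_derive_affine (half_sqnorm Z) (frobenius Z W) 0)
  (is_derive_sqr (half_sqnorm W) 0).
rewrite mulr0 addr0 in d; clearbody W.
rewrite (_ : (fun t : R => half_sqnorm (Z + t *: W)) = fun t =>
  half_sqnorm Z + t * frobenius Z W + half_sqnorm W * t ^+ 2)//.
apply/funext => t; rewrite /half_sqnorm !frobeniusDr !frobeniusDl !frobeniusZr.
by rewrite !frobeniusZl [frobenius W Z]frobeniusC; field.
Qed.

End Gradients.

(** * Softmax and clipping as proximal maps *)

Section ProxSteps.
Context {R : realType}.

Definition softmax (I : finType) (s : R) (z g : I -> R) (i : I) : R :=
  z i * expR (- (s * g i)) / \sum_k z k * expR (- (s * g k)).

Section Family.
Context {I : finType}.
Variables (s : R) (z g : I -> R) (i0 : I).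
Hypothesis s_gt0 : 0 < s.
Hypothesis z_gt0 : forall i, 0 < z i.
Let W := softmax s z g.

Let D_gt0 : 0 < \sum_k z k * expR (- (s * g k)).
Proof.
rewrite (bigD1 i0)//= ltr_wpDr ?mulr_gt0 ?expR_gt0//.
by apply: sumr_ge0 => k _; rewrite mulr_ge0 ?expR_ge0// ltW.
Qed.

Lemma softmax_gt0 i : 0 < W i.
Proof. by rewrite divr_gt0// mulr_gt0 ?expR_gt0. Qed.

Lemma softmax_sum : \sum_i W i = 1.
Proof. by rewrite -mulr_suml divff// gt_eqF. Qed.

Lemma ln_softmax i : ln (W i) = ln (z i) - s * g i - ln (\sum_k z k * expR (- (s * g k))).
Proof. by rewrite /W /softmax ln_div ?posrE ?mulr_gt0 ?expR_gt0// lnM ?posrE ?expR_gt0// expRK. Qed.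

(** ln W differs from ln z - s g by a constant, which drops out because u and W have the same mass.
    The three-point relation is therefore an equality. *)
Lemma softmax_three_point (u : I -> R) : \sum_i u i = 1 ->
  \sum_i g i * u i + s^-1 * KL u z =
  \sum_i g i * W i + s^-1 * KL W z + s^-1 * KL u W.
Proof.
move=> su; have sW := softmax_sum; set D := ln (\sum_k z k * expR (- (s * g k))).
have e1 : KL u W = KL u z + s * (\sum_i g i * u i) + D * (\sum_i u i)
    - \sum_i z i + \sum_i W i.
  rewrite /KL !mulr_sumr -!big_split -sumrB -big_split; apply: eq_bigr => i _ /=.
  by rewrite /kl ln_softmax -/D; ring.
have e2 : KL W z = - (s * \sum_i g i * W i) - D * (\sum_i W i) - \sum_i W i + \sum_i z i.
  rewrite /KL !mulr_sumr -sumrN -!sumrB -big_split; apply: eq_bigr => i _ /=.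
  by rewrite /kl ln_softmax -/D; ring.
rewrite e1 e2 su sW; field; rewrite gt_eqF//.
Qed.

End Family.

Definition clip (x : R) : R := Num.max (-1) (Num.min 1 x).

Lemma clip_bounds x : -1 <= clip x <= 1.
Proof. rewrite /clip le_max lexx /= ge_max ge_min lexx /= andbT; lra. Qed.

Lemma clip_variational (x u : R) : -1 <= u <= 1 -> 0 <= (u - clip x) * (clip x - x).
Proof.
move=> /andP[u1 u2]; rewrite /clip.
have [x1|x1] := leP 1 x.
  rewrite max_r; last lra.
  by rewrite mulr_le0 ?subr_le0.
have [x2|x2] := leP (-1) x; first by rewrite subrr mulr0.
by rewrite mulr_ge0 ?subr_ge0// ltW.
Qed.

Definition softmax_mx r c (s : R) (Z G : 'M[R]_(r, c)) : 'M[R]_(r, c) :=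
  \matrix_(i, j) softmax s (Z ^~ j) (G ^~ j) i.

Definition clip_mx r c (s : R) (Z G : 'M[R]_(r, c)) : 'M[R]_(r, c) :=
  \matrix_(i, j) clip (Z i j - s * G i j).

(** Entrywise the two sides differ by s^-1 (u - w) (w - (z - s g)), whose sign is the optimality
    condition of the projection on [-1, 1]. *)
Lemma clip_three_point r c (s : R) (Z G U : 'M[R]_(r, c)) (W := clip_mx s Z G) : 0 < s ->
  (forall i j, -1 <= U i j <= 1) ->
  frobenius G W + s^-1 * (2^-1 * sqnorm (W - Z)) + s^-1 * (2^-1 * sqnorm (U - W)) <=
  frobenius G U + s^-1 * (2^-1 * sqnorm (U - Z)).
Proof.
move=> s0 hU; rewrite /sqnorm /frobenius !mulr_sumr -!big_split; apply: ler_sum => i _ /=.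
rewrite !mulr_sumr -!big_split; apply: ler_sum => j _ /=.
rewrite !mxE; have := clip_variational (Z i j - s * G i j) (hU i j).
move: (U i j) (Z i j) (G i j) (clip _) => u z g w h.
have si : 0 < s^-1 by rewrite invr_gt0.
have e : g = s^-1 * (s * g) by rewrite mulKf ?gt_eqF.
rewrite -subr_ge0.
rewrite (_ : _ - _ = s^-1 * ((u - w) * (w - (z - s * g)))); last by field; rewrite gt_eqF.
by rewrite mulr_ge0// ltW.
Qed.

Lemma softmax_mx_three_point r c (s : R) (Z G U : 'M[R]_(r, c)) (i0 : 'I_r)
    (W := softmax_mx s Z G) : 0 < s ->
  (forall i j, 0 < Z i j) -> (forall j, \sum_i U i j = 1) ->
  frobenius G U + s^-1 * KLm U Z =
  frobenius G W + s^-1 * KLm W Z + s^-1 * KLm U W.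
Proof.
move=> s0 Z0 sU; rewrite !frobenius_col /KLm !mulr_sumr -!big_split.
apply: eq_bigr => j _ /=.
have -> : W ^~ j = softmax s (Z ^~ j) (G ^~ j) by apply/funext => i; rewrite mxE.
rewrite (@softmax_three_point _ s (Z ^~ j) (G ^~ j) i0 s0 (fun i => Z0 i j) (U ^~ j) (sU j)).
by congr (_ + _ + _); apply: eq_bigr => i _; rewrite mxE.
Qed.

End ProxSteps.

(** Hides pairings and divergences behind variables, so that [ring] and [lra] treat them as
    atoms. *)
Ltac generalize_pairings := repeat match goal with
  | |- context [@frobenius ?R ?r ?c ?a ?b] => move: (@frobenius R r c a b)
  | |- context [@prox_fun ?R ?n ?a] => move: (@prox_fun R n a)
  | |- context [@Bd ?R ?n ?a ?b] => move: (@Bd R n a b)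
  | |- context [@sqnorm ?R ?r ?c ?a] => move: (@sqnorm R r c a)
  | |- context [@KLm ?R ?r ?c ?a ?b] => move: (@KLm R r c a b)
  | |- context [@KL ?R ?I ?a ?b] => move: (@KL R I a b)
  end.

(** * Mirror Prox on the saddle-point problem *)

Section Incidence.
Context {R : realType} {n m : nat}.
Local Notation A := (incidence R n).

Lemma col_mulmx r c (B : 'M[R]_(r, c)) (X : 'M[R]_(c, m)) k :
  col k (B *m X) = B *m col k X.
Proof. by rewrite !colE mulmxA. Qed.

Lemma sum_mxvec_index (f : 'I_(n * n) -> R) :
  \sum_s f s = \sum_i \sum_j f (mxvec_index i j).
Proof.
rewrite pair_big /= (reindex _ (curry_mxvec_bij n n)) /=.
by apply: eq_bigr => -[i j].
Qed.

Lemma incidence_entries (X : 'M[R]_(n * n, m)) k :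
  (forall i, (A *m X) (lshift n i) k = \sum_j X (mxvec_index i j) k) /\
  (forall j, (A *m X) (rshift n j) k = \sum_i X (mxvec_index i j) k).
Proof.
pose pi := vec_mx (col k X)^T.
have e : col k (A *m X) = col_mx (pi *m const_mx 1) (pi^T *m const_mx 1).
  rewrite -incidenceE col_mulmx; congr (_ *m _).
  by rewrite /vectorize /pi vec_mxK trmxK.
split=> i.
  have := congr1 (fun M : 'cV_(n + n) => M (lshift n i) 0) e.
  rewrite /= mxE => ->; rewrite col_mxEu mulmx_const1.
  by apply: eq_bigr => j _; rewrite /pi mxE !mxE.
have := congr1 (fun M : 'cV_(n + n) => M (rshift n i) 0) e.
rewrite /= mxE => ->; rewrite col_mxEd mulmx_const1.
by apply: eq_bigr => j _; rewrite /pi !mxE.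
Qed.

Lemma sum_sqr_le (I : finType) (f : I -> R) : \sum_i f i ^+ 2 <= l1 f ^+ 2.
Proof.
rewrite /l1 expr2 mulr_suml; apply: ler_sum => i _.
rewrite -real_normK ?num_real// expr2 ler_wpM2l//.
by rewrite (bigD1 i)//= lerDl sumr_ge0.
Qed.

(** The l2 norm is below the l1 norm, and each of the two marginal maps contracts the l1 norm. *)
Lemma sqnorm_incidence (X : 'M[R]_(n * n, m)) :
  sqnorm (A *m X) <= 2 * \sum_k l1 (X ^~ k) ^+ 2.
Proof.
rewrite /sqnorm frobenius_col mulr_sumr; apply: ler_sum => k _.
have [hu hd] := incidence_entries X k.
rewrite big_split_ord /= mulr2n mulrDl mul1r.
have ll : l1 (X ^~ k) = \sum_i \sum_j `|X (mxvec_index i j) k|.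
  by rewrite /l1 sum_mxvec_index.
apply: lerD.
  apply: le_trans (_ : l1 (fun i => \sum_j X (mxvec_index i j) k) ^+ 2 <= _).
    apply: le_trans (sum_sqr_le _); apply: ler_sum => i _.
    by rewrite hu expr2.
  rewrite ler_pXn2r ?nnegrE ?l1_ge0// ll; apply: ler_sum => i _.
  exact: ler_norm_sum.
apply: le_trans (_ : l1 (fun j => \sum_i X (mxvec_index i j) k) ^+ 2 <= _).
  apply: le_trans (sum_sqr_le _); apply: ler_sum => i _.
  by rewrite hd expr2.
rewrite ler_pXn2r ?nnegrE ?l1_ge0// ll exchange_big; apply: ler_sum => i _.
exact: ler_norm_sum.
Qed.

Definition marginals_mx (p : 'cV[R]_n) (q : 'I_m -> 'cV[R]_n) : 'M[R]_(n + n, m) :=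
  \matrix_(l, k) col_mx p (q k) l 0.

(** The linear part of p -> marginals_mx p q. Its adjoint, found in [frobenius_spread], gives the
    bilinear part of [op_p]. *)
Definition spread (v : 'cV[R]_n) : 'M[R]_(n + n, m) := marginals_mx v (fun=> 0).

Lemma marginals_mxB p p' q : marginals_mx p q - marginals_mx p' q = spread (p - p').
Proof.
apply/matrixP => l k; rewrite !mxE.
by case: (fintype.split l) => i; rewrite !mxE ?subrr.
Qed.

Lemma frobenius_spread v (Y : 'M[R]_(n + n, m)) :
  frobenius (spread v) Y = frobenius (usubmx Y *m const_mx 1) v.
Proof.
rewrite [RHS]frobenius_cV /frobenius big_split_ord /= [X in _ + X]big1 ?addr0.
  apply: eq_bigr => i _; rewrite mulmx_const1 mulr_suml; apply: eq_bigr => k _.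
  by rewrite [usubmx _ _ _]mxE [spread _ _ _]mxE col_mxEu mulrC.
by move=> i _; rewrite big1// => k _; rewrite mxE col_mxEd mxE mul0r.
Qed.

Lemma sqnorm_spread v : sqnorm (spread v) <= m%:R * l1 (v ^~ 0) ^+ 2.
Proof.
rewrite /sqnorm frobenius_col.
apply: le_trans (_ : \sum_(k < m) l1 (v ^~ 0) ^+ 2 <= _); last first.
  by rewrite sumr_const card_ord mulr_natl.
apply: ler_sum => k _; rewrite big_split_ord /= [X in _ + X]big1 ?addr0.
  apply: le_trans (sum_sqr_le _); apply: ler_sum => i _.
  by rewrite mxE col_mxEu expr2.
by move=> i _; rewrite mxE col_mxEd mxE mul0r.
Qed.

End Incidence.

(** * The iterates of Mirror Prox and their regret *)

Section Saddle.
Context {R : realType} {n m : nat}.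
Hypothesis n_gt1 : (1 < n)%N.
Hypothesis m_gt0 : (0 < m)%N.
Variables (C : 'M[R]_n) (q : 'I_m -> 'cV[R]_n) (lam : R) (p1 : 'cV[R]_n).
Hypothesis dp1 : simplex R n p1.
Hypothesis C_ge0 : forall i j, 0 <= C i j.
Hypothesis lam_ge0 : 0 <= lam.
Hypothesis dq : forall k, simplex R n (q k).
Local Notation A := (incidence R n).
Local Notation L := (ln n%:R : R).
Local Notation st := (state R n m).
Local Notation K := (`|C| : R).
Let kap := 2 * K / m%:R.
Let Cm : 'M[R]_(n * n, m) := \matrix_(s, k) vectorize C s 0.

Lemma norm_vectorize : `|vectorize C| = `|C|.
Proof.
rewrite -[LHS]/(mx_norm (vectorize C)) -[RHS]/(mx_norm C) !mx_normrE.
apply/le_anti/andP; split; apply: bigmax_le => //.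
- rewrite -mx_normrE -[leRHS]/`|C|; exact: normr_ge0.
- move=> [s j] _; rewrite -mx_normrE -[leRHS]/`|C| !mxE /=.
  case/mxvec_indexP: s => a b; rewrite (ord1 j) mxvecE; exact: entry_le_norm.
- rewrite -mx_normrE -[leRHS]/`|vectorize C|; exact: normr_ge0.
- move=> [a b] _; rewrite -mx_normrE -[leRHS]/`|vectorize C| /=.
  rewrite -(mxvecE C) -[mxvec C]trmxK [X in `|X|]mxE; exact: entry_le_norm.
Qed.

Lemma saddleE p X Y : saddle C q lam p1 p X Y =
  m%:R^-1 * frobenius Cm X +
  kap * (frobenius Y (A *m X) - frobenius (marginals_mx p q) Y) + lam * Bd p p1.
Proof.
rewrite /saddle norm_vectorize; congr (_ + _).
rewrite /kap -[2 * K / _]mulrA [K / _]mulrC mulrCA -mulrA -mulrDr; congr (_ * _).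
rewrite [frobenius Cm X]frobenius_col [frobenius Y _]frobenius_col
  [frobenius (marginals_mx _ _) _]frobenius_col -sumrB mulr_sumr -big_split /=.
apply: eq_bigr => k _; rewrite !frobenius_cV; congr (_ + _ * (_ - _)).
- by apply: eq_bigr => s _; rewrite !mxE.
- by apply: eq_bigr => l _; rewrite -col_mulmx !mxE.
- by apply: eq_bigr => l _; rewrite !mxE.
Qed.

Definition op_p (z : st) : 'cV[R]_n :=
  lam *: (prox_grad (st_p z) - prox_grad p1) - kap *: (usubmx (st_y z) *m const_mx 1).
Definition op_x (z : st) : 'M[R]_(n * n, m) :=
  m%:R^-1 *: Cm + kap *: (A^T *m st_y z).
Definition op_y (z : st) : 'M[R]_(n + n, m) :=
  kap *: (A *m st_x z - marginals_mx (st_p z) q).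

(** Along a line the saddle function is affine in x and in y; in p it is affine up to lam
    [prox_fun], differentiated by [is_derive_prox]. *)
Lemma saddle_operatorE z : simplex R n (st_p z) ->
  saddle_operator (saddle C q lam p1) z = State (op_p z) (op_x z) (- op_y z).
Proof.
move=> dp; rewrite /saddle_operator; congr (State _ _ (- _)); apply: grad_eq => v.
- apply: derive_line.
  pose a := m%:R^-1 * frobenius Cm (st_x z) +
    kap * (frobenius (st_y z) (A *m st_x z) - frobenius (marginals_mx (st_p z) q) (st_y z))
    - lam * prox_fun p1 - lam * frobenius (prox_grad p1) (st_p z - p1).
  pose b := - (kap * frobenius (usubmx (st_y z) *m const_mx 1) v)
    - lam * frobenius (prox_grad p1) v.
  have [p0 sp] := dp.
  have d := is_deriveD_fun (is_derive_affine a b 0)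
    (is_deriveZ_fun lam (is_derive_prox n_gt1 v p0 (psum_gt0 n_gt1 p0 sp))).
  rewrite (_ : (fun t : R => saddle C q lam p1 (st_p z + t *: v) (st_x z) (st_y z)) =
     fun t => a + t * b + lam * prox_fun (st_p z + t *: v)); last first.
    apply/funext => t; rewrite saddleE /Bd /bregman (derive_prox_simplex n_gt1)//.
    rewrite -frobenius_cV (_ : st_p z + t *: v - p1 = (st_p z - p1) + t *: v); last first.
      by rewrite addrAC.
    rewrite frobeniusDr frobeniusZr.
    have -> : marginals_mx (st_p z + t *: v) q =
        marginals_mx (st_p z) q + t *: spread v.
      apply/matrixP => l k; rewrite !mxE.
      by case: (fintype.split l) => i; rewrite !mxE; ring.
    rewrite frobeniusDl frobeniusZl frobenius_spread /a /b.
    by move: (kap) (m%:R^-1); generalize_pairings; clear=> *; ring.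
  move: d; rewrite -frobenius_cV (_ : b + _ = frobenius (op_p z) v)//.
  rewrite /op_p frobeniusBl !frobeniusZl frobeniusBl /b.
  by move: (kap); generalize_pairings; clear=> *; ring.
- apply: derive_affine_line => t; rewrite !saddleE mulmxDr -scalemxAr.
  rewrite !frobeniusDr !frobeniusZr /op_x frobeniusDl !frobeniusZl frobenius_adjoint.
  move: (kap) (m%:R^-1) (frobenius (st_y z) (A *m v)).
  by generalize_pairings; clear=> *; ring.
- apply: derive_affine_line => t; rewrite !saddleE.
  rewrite frobeniusDl frobeniusZl frobeniusDr frobeniusZr /op_y frobeniusZl frobeniusBl.
  rewrite [frobenius v _]frobeniusC.
  move: (kap) (m%:R^-1) (frobenius (A *m st_x z) v) (frobenius (marginals_mx (st_p z) q) v).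
  by generalize_pairings; clear=> *; ring.
Qed.

Lemma Bd_three_point x y : simplex R n x -> simplex R n y ->
  Bd x p1 = Bd y p1 + Bd x y + frobenius (prox_grad y - prox_grad p1) (x - y).
Proof.
move=> dx dy; rewrite /Bd /bregman !(derive_prox_simplex n_gt1)//.
rewrite -!frobenius_cV !frobeniusBl !frobeniusBr.
by generalize_pairings; clear=> *; ring.
Qed.

Definition pairing (g z : st) : R := frobenius (st_p g) (st_p z) +
  frobenius (st_x g) (st_x z) + frobenius (st_y g) (st_y z).

Definition op (z : st) : st := State (op_p z) (op_x z) (- op_y z).

Variables (sp sx sy : R).
Hypothesis sp_gt0 : 0 < sp.
Hypothesis sx_gt0 : 0 < sx.
Hypothesis sy_gt0 : 0 < sy.

Definition divergence (z z0 : st) : R := sp^-1 * KLm (st_p z) (st_p z0) +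
  sx^-1 * KLm (st_x z) (st_x z0) + sy^-1 * (2^-1 * sqnorm (st_y z - st_y z0)).

(** The entropy is differentiated at positive vectors only. A proximal step from such a point
    returns to such a point, so every iterate is [interior]. *)
Definition interior (z : st) := [/\ feasible R n m z,
  forall i j, 0 < st_p z i j & forall i j, 0 < st_x z i j].

Lemma KLm_ge0 r c (U V : 'M[R]_(r, c)) : (forall i j, 0 <= U i j) ->
  (forall i j, 0 < V i j) -> 0 <= KLm U V.
Proof. by move=> U0 V0; apply: sumr_ge0 => j _; exact: KL_ge0. Qed.

Lemma KLm_cV r (u v : 'cV[R]_r) : KLm u v = KL (u ^~ 0) (v ^~ 0).
Proof. by rewrite /KLm big_ord1. Qed.

Lemma feasibleP z : feasible R n m z <->
  [/\ forall i j, 0 <= st_p z i j, \sum_i st_p z i 0 = 1, forall i j, 0 <= st_x z i j,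
      forall j, \sum_i st_x z i j = 1 & forall i j, -1 <= st_y z i j <= 1].
Proof.
split=> [[[p0 sp1] hx hy]|[p0 sp1 x0 sx1 hy]]; split=> //.
- by move=> i j; rewrite (ord1 j).
- by move=> i j; have [x0 _] := hx j; have := x0 i; rewrite mxE.
- by move=> j; have [_ <-] := hx j; apply: eq_bigr => i _; rewrite mxE.
- by move=> j; split=> [i|]; [rewrite mxE|rewrite -(sx1 j); apply: eq_bigr => i _; rewrite mxE].
Qed.

Lemma divergence_ge0 u z : feasible R n m u -> interior z -> 0 <= divergence u z.
Proof.
move=> /feasibleP[p0 _ x0 _ _] [_ zp zx].
apply: addr_ge0; first apply: addr_ge0.
- by apply: mulr_ge0; [rewrite invr_ge0 ltW|exact: KLm_ge0].
- by apply: mulr_ge0; [rewrite invr_ge0 ltW|exact: KLm_ge0].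
- apply: mulr_ge0; first by rewrite invr_ge0 ltW.
  by apply: mulr_ge0; [rewrite invr_ge0|exact: sqnorm_ge0].
Qed.

Lemma prox_divergenceE z z0 : interior z0 ->
  prox_divergence sp sx sy z z0 = divergence z z0.
Proof.
move=> [_ zp zx]; rewrite /prox_divergence !bregman_entropyE// bregman_half_sqnormE.
by [].
Qed.

Definition prox_step (z g : st) : st := State (softmax_mx sp (st_p z) (st_p g))
  (softmax_mx sx (st_x z) (st_x g)) (clip_mx sy (st_y z) (st_y g)).

Let n_gt0 : (0 < n)%N. Proof. exact: ltn_trans n_gt1. Qed.
Let i0 : 'I_n := Ordinal n_gt0.
Let s0 : 'I_(n * n) := mxvec_index i0 i0.

Lemma prox_step_interior z g : interior z -> interior (prox_step z g).
Proof.
move=> [_ zp zx].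
have wp i j : 0 < softmax_mx sp (st_p z) (st_p g) i j.
  by rewrite mxE; apply: (softmax_gt0 _ _ i0) => k; exact: zp.
have wx i j : 0 < softmax_mx sx (st_x z) (st_x g) i j.
  by rewrite mxE; apply: (softmax_gt0 _ _ s0) => k; exact: zx.
split=> //; apply/feasibleP; split => /=.
- by move=> i j; exact: ltW.
- under eq_bigr do rewrite mxE.
  by apply: (softmax_sum _ _ i0) => k; exact: zp.
- by move=> i j; exact: ltW.
- move=> j; under eq_bigr do rewrite mxE.
  by apply: (softmax_sum _ _ s0) => k; exact: zx.
- by move=> i j; rewrite mxE clip_bounds.
Qed.

Lemma prox_step_three_point z g u : interior z -> feasible R n m u ->
  pairing g (prox_step z g) + divergence (prox_step z g) z
    + divergence u (prox_step z g) <= pairing g u + divergence u z.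
Proof.
move=> [_ zp zx] /feasibleP[p0 sp1 x0 sx1 hy].
have sp1' j : \sum_i st_p u i j = 1 by rewrite (ord1 j).
have hp := softmax_mx_three_point (st_p g) i0 sp_gt0 zp sp1'.
have hx := softmax_mx_three_point (st_x g) s0 sx_gt0 zx sx1.
have hY := clip_three_point (st_y z) (st_y g) sy_gt0 hy.
rewrite /pairing /divergence /=; move: hp hx hY => /=.
set wp := softmax_mx sp _ _; set wx := softmax_mx sx _ _; set wy := clip_mx _ _ _.
move: (sp^-1 * _) (sp^-1 * _) (sp^-1 * _) (sx^-1 * _) (sx^-1 * _) (sx^-1 * _).
move: (sy^-1 * _) (sy^-1 * _) (sy^-1 * _).
by generalize_pairings=> *; lra.
Qed.

Lemma is_prox_step z g : interior z -> is_prox sp sx sy z g (prox_step z g).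
Proof.
move=> iz; have iw := prox_step_interior g iz.
split; first by case: iw.
move=> u fu /=; rewrite !prox_divergenceE// -/(pairing g u).
rewrite -/(pairing g (prox_step z g)).
apply: le_trans (prox_step_three_point g iz fu).
by rewrite lerDl divergence_ge0.
Qed.

Lemma saddle_operator_op z : interior z ->
  saddle_operator (saddle C q lam p1) z = op z.
Proof. by case=> -[dp _ _] _ _; rewrite saddle_operatorE. Qed.

Lemma l1_spread_le (u v : 'cV[R]_n) : simplex R n u -> simplex R n v ->
  (forall i, 0 < v i 0) ->
  sqnorm (spread (u - v) : 'M[R]_(n + n, m)) <= 4 * m%:R * KLm u v.
Proof.
move=> [u0 su] [v0 sv] vp; apply: le_trans (sqnorm_spread _) _.
rewrite KLm_cV [4 * _]mulrC -mulrA ler_wpM2l//.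
have -> : l1 ((u - v) ^~ 0) = l1 (fun i => u i 0 - v i 0).
  by apply: eq_bigr => i _; rewrite !mxE.
exact: pinsker.
Qed.

Lemma sqnorm_incidence_le (U V : 'M[R]_(n * n, m)) :
  (forall i j, 0 <= U i j) -> (forall i j, 0 < V i j) ->
  (forall j, \sum_i U i j = 1) -> (forall j, \sum_i V i j = 1) ->
  sqnorm (A *m (U - V)) <= 8 * KLm U V.
Proof.
move=> U0 V0 sU sV; apply: le_trans (sqnorm_incidence _) _.
rewrite (_ : 8 = 2 * 4); last by ring.
rewrite -mulrA ler_wpM2l// mulr_sumr; apply: ler_sum => j _.
have -> : l1 ((U - V) ^~ j) = l1 (fun i => U i j - V i j).
  by apply: eq_bigr => i _; rewrite !mxE.
by apply: pinsker.
Qed.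

(** [rho] balances dual against primal distances in Young's inequality. The three bounds on the
    inverse steps are what it then requires, the extra lam (32 L + 1) coming from the relative
    smoothness of lam Bd. It is set to 1 / sqrt(n) in [mirror_prox_rate]. *)
Variable rho : R.
Hypothesis rho_gt0 : 0 < rho.
Hypothesis sy_small : 2 * kap * rho <= sy^-1.
Hypothesis sx_small : 4 * kap / rho <= sx^-1.
Hypothesis sp_small : 2 * kap * m%:R / rho + lam * (32 * L + 1) <= sp^-1.

Let kap_ge0 : 0 <= kap.
Proof. by rewrite /kap !mulr_ge0 ?invr_ge0. Qed.

Lemma spreadB (u v : 'cV[R]_n) :
  spread (u - v) = spread u - spread v :> 'M[R]_(n + n, m).
Proof.
apply/matrixP => l k; rewrite !mxE.
by case: (fintype.split l) => i; rewrite !mxE ?subrr.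
Qed.

Lemma frobenius_marginals p Y : frobenius (marginals_mx p q) Y =
  frobenius Y (spread p) + frobenius Y (marginals_mx 0 q).
Proof.
rewrite -[marginals_mx p q](subrK (marginals_mx 0 q)) marginals_mxB subr0.
by rewrite frobeniusC frobeniusDr.
Qed.

Lemma pairing_opE z u : pairing (op z) u =
  lam * (frobenius (prox_grad (st_p z)) (st_p u) - frobenius (prox_grad p1) (st_p u))
  - kap * frobenius (st_y z) (spread (st_p u)) + m%:R^-1 * frobenius Cm (st_x u)
  + kap * frobenius (st_y z) (A *m st_x u)
  - kap * (frobenius (st_y u) (A *m st_x z) - frobenius (st_y u) (spread (st_p z))
           - frobenius (st_y u) (marginals_mx 0 q)).
Proof.
rewrite /pairing /op /= /op_p /op_x /op_y frobeniusNl !frobeniusZl.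
rewrite [frobenius (_ - _) (st_p u)]frobeniusBl [frobenius (_ + _) (st_x u)]frobeniusDl.
rewrite !frobeniusZl frobeniusBl frobenius_adjoint.
rewrite [frobenius (_ - _) (st_y u)]frobeniusBl frobenius_marginals.
rewrite -frobenius_spread [frobenius (spread _) _]frobeniusC.
rewrite [frobenius (A *m st_x z) _]frobeniusC.
by move: (kap) (m%:R^-1); generalize_pairings=> *; ring.
Qed.

(** For the Bd part, the pairing of the gradient difference with w - v equals Bd v w + Bd w z - Bd v
    z, and relative smoothness bounds the first two terms by KL. For the bilinear part, the
    inequalities of Young and Pinsker leave squared dual distances and KL terms, which the inverse
    step sizes dominate. *)
Lemma op_relatively_lipschitz z w v : interior z -> interior w -> interior v ->
  pairing (op w) w - pairing (op w) v - (pairing (op z) w - pairing (op z) v) <=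
  divergence v w + divergence w z.
Proof.
move=> [fz zp zx] [fw wp wx] [fv vp vx].
have [dpz _ _] := fz; have [dpw _ _] := fw; have [dpv _ _] := fv.
have /feasibleP[pz0 spz xz0 sxz yz] := fz; have /feasibleP[pw0 spw xw0 sxw yw] := fw.
have /feasibleP[pv0 spv xv0 sxv yv] := fv.
have Bdp : lam * frobenius (prox_grad (st_p w) - prox_grad (st_p z)) (st_p w - st_p v)
    <= lam * (32 * L + 1) * (KLm (st_p v) (st_p w) + KLm (st_p w) (st_p z)).
  rewrite -[leRHS]mulrA ler_wpM2l//.
  have e1 := Bd_three_point dpv dpw; have e2 := Bd_three_point dpv dpz.
  have e3 := Bd_three_point dpw dpz; have b0 := Bd_ge0 n_gt1 dpv dpz.
  have b1 := Bd_relatively_smooth n_gt1 dpv dpw (fun i => vp i 0) (fun i => wp i 0).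
  have b2 := Bd_relatively_smooth n_gt1 dpw dpz (fun i => wp i 0) (fun i => zp i 0).
  rewrite -!KLm_cV in b1 b2; rewrite mulrDr.
  move: e1 e2 e3 b0 b1 b2; rewrite !frobeniusBl !frobeniusBr.
  move: (32 * L + 1) => X; generalize_pairings=> *; lra.
have t1' := frobenius_young (st_y w - st_y z) (- (A *m (st_x v - st_x w))) rho_gt0.
have t2 := frobenius_young (st_y v - st_y w) (A *m (st_x w - st_x z)) rho_gt0.
have t3 := frobenius_young (st_y w - st_y z) (spread (st_p v - st_p w)) rho_gt0.
have t4 := frobenius_young (st_y v - st_y w) (- spread (st_p w - st_p z)) rho_gt0.
have q1 := sqnorm_incidence_le xv0 wx sxv sxw.
have q2 := sqnorm_incidence_le xw0 zx sxw sxz.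
have q3 := l1_spread_le dpv dpw (fun i => wp i 0).
have q4 := l1_spread_le dpw dpz (fun i => zp i 0).
have sqN (r c : nat) (M : 'M[R]_(r, c)) : sqnorm (- M) = sqnorm M.
  by rewrite /sqnorm frobeniusNl frobeniusNr opprK.
rewrite sqN frobeniusNr in t4; rewrite sqN [frobenius _ (- _)]frobeniusNr in t1'.
set Kp1 := KLm (st_p v) (st_p w) in Bdp q3; set Kp2 := KLm (st_p w) (st_p z) in Bdp q4.
set Kx1 := KLm (st_x v) (st_x w) in q1; set Kx2 := KLm (st_x w) (st_x z) in q2.
set Y1 := sqnorm (st_y w - st_y z) in t1' t3.
set Y2 := sqnorm (st_y v - st_y w) in t2 t4.
have [Kp10 Kp20] : 0 <= Kp1 /\ 0 <= Kp2 by split; exact: KLm_ge0.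
have [Kx10 Kx20] : 0 <= Kx1 /\ 0 <= Kx2 by split; exact: KLm_ge0.
have [Y10 Y20] : 0 <= Y1 /\ 0 <= Y2 by split; exact: sqnorm_ge0.
have ri : 0 < (2 * rho)^-1 by rewrite invr_gt0 mulr_gt0.
have main : pairing (op w) w - pairing (op w) v - (pairing (op z) w - pairing (op z) v) =
    lam * frobenius (prox_grad (st_p w) - prox_grad (st_p z)) (st_p w - st_p v)
    + kap * (- frobenius (st_y w - st_y z) (A *m (st_x v - st_x w))
      + frobenius (st_y v - st_y w) (A *m (st_x w - st_x z))
      + frobenius (st_y w - st_y z) (spread (st_p v - st_p w))
      - frobenius (st_y v - st_y w) (spread (st_p w - st_p z))).
  rewrite !pairing_opE !spreadB !mulmxBr !frobeniusBl !frobeniusBr.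
  by move: (kap) (m%:R^-1); generalize_pairings=> *; ring.
rewrite main /divergence -/Kp1 -/Kp2 -/Kx1 -/Kx2 -/Y1 -/Y2.
have T : - frobenius (st_y w - st_y z) (A *m (st_x v - st_x w))
      + frobenius (st_y v - st_y w) (A *m (st_x w - st_x z))
      + frobenius (st_y w - st_y z) (spread (st_p v - st_p w))
      - frobenius (st_y v - st_y w) (spread (st_p w - st_p z)) <=
    rho * (Y1 + Y2) + rho^-1 * (4 * (Kx1 + Kx2) + 2 * m%:R * (Kp1 + Kp2)).
  have r1 : (2 * rho)^-1 = 2^-1 * rho^-1 by rewrite invfM.
  rewrite r1 in t1' t2 t3 t4.
  have ri' : 0 <= 2^-1 * rho^-1 by rewrite mulr_ge0// invr_ge0 ltW.
  have h1 := ler_wpM2l ri' q1; have h2 := ler_wpM2l ri' q2.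
  have h3 := ler_wpM2l ri' q3; have h4 := ler_wpM2l ri' q4.
  move: t1' t2 t3 t4 h1 h2 h3 h4; move: (rho^-1) (m%:R : R); generalize_pairings.
  move=> *; lra.
have := ler_wpM2l kap_ge0 T.
have Kp0 := addr_ge0 Kp10 Kp20; have Kx0 := addr_ge0 Kx10 Kx20.
have Y0 := addr_ge0 Y10 Y20.
have := ler_wpM2r Kp0 sp_small; have := ler_wpM2r Kx0 sx_small.
have := ler_wpM2r Y0 sy_small; move: Bdp; rewrite -/Kp1 -/Kp2.
move: (kap) (rho^-1) (m%:R : R) (32 * L + 1) (sp^-1) (sx^-1) (sy^-1).
move: (_ + _ - frobenius _ _) (frobenius _ _).
move: {+}Y1 {+}Y2 {+}Kp1 {+}Kp2 {+}Kx1 {+}Kx2 => *; lra.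
Qed.

(** The three-point inequality for w is tested at z', the one for z' at u. They leave the
    divergences of z' from w and of w from z, exactly what [op_relatively_lipschitz] consumes. *)
Lemma mirror_step z u (w := prox_step z (op z)) (z' := prox_step z (op w)) :
  interior z -> feasible R n m u ->
  pairing (op w) w - pairing (op w) u <= divergence u z - divergence u z'.
Proof.
move=> iz fu; have iw : interior w by exact: prox_step_interior.
have iz' : interior z' by exact: prox_step_interior.
have fz' : feasible R n m z' by case: iz'.
have := prox_step_three_point (op z) iz fz'; rewrite -/w.
have := prox_step_three_point (op w) iz fu; rewrite -/z'.
have := op_relatively_lipschitz iz iw iz'.
move: (pairing _ _) (pairing _ _) (pairing _ _) (pairing _ _) (pairing _ _).
move: (divergence _ _) (divergence _ _) (divergence _ _) (divergence _ _) (divergence _ _).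
by move=> *; lra.
Qed.

(** The bilinear terms match exactly; linearizing lam Bd at w loses lam times the divergence of u
    from w, which is nonnegative. *)
Lemma saddle_le_pairing w u : interior w -> feasible R n m u ->
  saddle C q lam p1 (st_p w) (st_x w) (st_y u)
    - saddle C q lam p1 (st_p u) (st_x u) (st_y w) <=
  pairing (op w) w - pairing (op w) u.
Proof.
move=> [[dpw _ _] _ _] [dpu _ _]; rewrite !saddleE.
have := Bd_three_point dpu dpw; have := Bd_ge0 n_gt1 dpu dpw.
rewrite !pairing_opE !frobenius_marginals !frobeniusBl !frobeniusBr => b0 e.
have b1 := mulr_ge0 lam_ge0 b0; have := congr1 ( *%R lam) e; move: b1; clear b0 e.
by move: (kap) (m%:R^-1); generalize_pairings=> *; lra.
Qed.

(** The iterates are written with the explicit gradient [op] and closed-form steps, the form in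
    which a program computes them; [mirror_prox_seq] links them to the specification. *)
Definition zseq (k : nat) : st :=
  iter k (fun z => prox_step z (op (prox_step z (op z))))
    (State p1 (const_mx (n * n)%:R^-1) 0).

Definition wseq (k : nat) : st := prox_step (zseq k) (op (zseq k)).

Arguments zseq : simpl never.
Arguments wseq : simpl never.

Lemma zseqS k : zseq k.+1 = prox_step (zseq k) (op (wseq k)).
Proof. by []. Qed.

Hypothesis p1_gt0 : forall i, 0 < p1 i 0.

Lemma zseq_interior k : interior (zseq k).
Proof.
elim: k => [|k IH]; last by rewrite zseqS; exact: prox_step_interior.
have nn0 : 0 < (n * n)%:R^-1 :> R by rewrite invr_gt0 ltr0n muln_gt0 n_gt0.
have [p0 sp1] := dp1.
split=> /=; last first.
- by move=> i j; rewrite mxE.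
- by move=> i j; rewrite (ord1 j).
apply/feasibleP; split=> //=.
- by move=> i j; rewrite (ord1 j).
- by move=> i j; rewrite mxE ltW.
- move=> j; under eq_bigr do rewrite mxE.
  by rewrite sumr_const card_ord -[LHS]mulr_natl divff// gt_eqF// -invr_gt0.
- by move=> i j; rewrite mxE lerN10 ler01.
Qed.

Lemma wseq_interior k : interior (wseq k).
Proof. by apply: prox_step_interior; exact: zseq_interior. Qed.

Lemma mirror_prox_seq : mirror_prox (saddle C q lam p1) sp sx sy p1 zseq wseq.
Proof.
split; first by [].
move=> k; have iz := zseq_interior k; have iw := wseq_interior k.
rewrite (saddle_operator_op iz) (saddle_operator_op iw) zseqS.
by split; exact: is_prox_step.
Qed.

Lemma sum_pairing_le N u : feasible R n m u ->
  \sum_(0 <= k < N) (pairing (op (wseq k)) (wseq k) - pairing (op (wseq k)) u) <=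
  divergence u (zseq 0).
Proof.
move=> fu; apply: le_trans (_ : divergence u (zseq 0) - divergence u (zseq N) <= _); last first.
  by rewrite gerBl divergence_ge0//; exact: zseq_interior.
elim: N => [|N IH]; first by rewrite big_nil subrr.
rewrite big_nat_recr//; have := mirror_step (zseq_interior N) fu.
rewrite -/(wseq N) -zseqS => h.
apply: le_trans (lerD IH h) _.
by rewrite addrA subrK.
Qed.

Variable N : nat.
Hypothesis N_gt0 : (0 < N)%N.

Let pbar : 'cV[R]_n := mirror_prox_output wseq N.
Let xbar : 'M[R]_(n * n, m) := N%:R^-1 *: \sum_(k < N) st_x (wseq k).

Let NR : 0 < N%:R :> R. Proof. by rewrite ltr0n. Qed.

Lemma sum_avg (x : R) : N%:R^-1 * (\sum_(k < N) x) = x.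
Proof. by rewrite sumr_const card_ord -[x *+ N]mulr_natl mulKf// gt_eqF. Qed.

Lemma output_simplex : simplex R n pbar.
Proof.
have H k : simplex R n (st_p (wseq k)) by case: (wseq_interior k) => -[].
split.
  move=> i; rewrite !mxE summxE mulr_ge0 ?invr_ge0//.
  by apply: sumr_ge0 => k _; case: (H k).
under eq_bigr do rewrite !mxE summxE.
rewrite -mulr_sumr exchange_big /= -[RHS](sum_avg 1); congr (_ * _).
by apply: eq_bigr => k _; case: (H k).
Qed.

Lemma xbar_simplex : (forall i j, 0 <= xbar i j) /\ (forall j, \sum_i xbar i j = 1).
Proof.
have H k := proj1 (feasibleP (wseq k)) (let: And3 f _ _ := wseq_interior k in f).
split.
  move=> i j; rewrite !mxE summxE mulr_ge0 ?invr_ge0//.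
  by apply: sumr_ge0 => k _; case: (H k).
move=> j; under eq_bigr do rewrite !mxE summxE.
rewrite -mulr_sumr exchange_big /= -[RHS](sum_avg 1); congr (_ * _).
by apply: eq_bigr => k _; case: (H k).
Qed.

(** Each divergence is expanded around the average: the first-order terms sum to zero and the
    remainders are nonnegative. *)
Lemma Bd_jensen : Bd pbar p1 <= N%:R^-1 * \sum_(k < N) Bd (st_p (wseq k)) p1.
Proof.
have dp := output_simplex.
have H k : simplex R n (st_p (wseq k)) by case: (wseq_interior k) => -[].
have e k := Bd_three_point (H k) dp.
have h (k : 'I_N) : true -> Bd pbar p1 +
    frobenius (prox_grad pbar - prox_grad p1) (st_p (wseq k) - pbar) <=
    Bd (st_p (wseq k)) p1.
  by move=> _; rewrite (e k) lerD2r lerDl Bd_ge0.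
have Ni : 0 <= N%:R^-1 :> R by rewrite invr_ge0.
apply: le_trans (ler_wpM2l Ni (ler_sum _ h)).
rewrite big_split mulrDr sum_avg lerDl -frobenius_sumr -frobeniusZr.
have -> : N%:R^-1 *: (\sum_(k < N) (st_p (wseq k) - pbar)) = 0.
  rewrite sumrB scalerBr sumr_const card_ord -[pbar *+ N]scaler_nat scalerA.
  by rewrite mulVf ?gt_eqF// scale1r subrr.
by rewrite frobeniusE mulmx0 mxtrace0.
Qed.

Lemma sum_affine (f1 f2 f3 f4 : 'I_N -> R) (e a b c : R) :
  \sum_k (a * f1 k + b * (f2 k - (f3 k + e)) + c * f4 k) =
  a * \sum_k f1 k + b * (\sum_k f2 k - (\sum_k f3 k + \sum_(k < N) e)) + c * \sum_k f4 k.
Proof. by rewrite -big_split -sumrB !mulr_sumr -!big_split. Qed.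

(** When u meets the marginal constraints, the bilinear term vanishes against every dual iterate, so
    the saddle value at u is the same at all steps. The dual block of u remains free and can be
    chosen after the output is known. *)
Lemma saddle_output_le u : feasible R n m u -> A *m st_x u = marginals_mx (st_p u) q ->
  saddle C q lam p1 pbar xbar (st_y u) <=
  m%:R^-1 * frobenius Cm (st_x u) + lam * Bd (st_p u) p1
    + N%:R^-1 * divergence u (zseq 0).
Proof.
move=> fu mu; have Ni : 0 <= N%:R^-1 :> R by rewrite invr_ge0.
pose a := m%:R^-1 * frobenius Cm (st_x u) + lam * Bd (st_p u) p1.
have avg : saddle C q lam p1 pbar xbar (st_y u) <= N%:R^-1 * \sum_(k < N)
    saddle C q lam p1 (st_p (wseq k)) (st_x (wseq k)) (st_y u).
  pose M0 := frobenius (st_y u) (marginals_mx 0 q).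
  pose Yu := usubmx (st_y u) *m const_mx 1 : 'cV[R]_n.
  pose f1 (k : 'I_N) := frobenius Cm (st_x (wseq k)).
  pose f2 (k : 'I_N) := frobenius (st_y u) (A *m st_x (wseq k)).
  pose f3 (k : 'I_N) := frobenius Yu (st_p (wseq k)).
  have S p x : saddle C q lam p1 p x (st_y u) = m%:R^-1 * frobenius Cm x +
      kap * (frobenius (st_y u) (A *m x) - (frobenius Yu p + M0)) + lam * Bd p p1.
    by rewrite saddleE frobenius_marginals [frobenius _ (spread _)]frobeniusC frobenius_spread.
  rewrite S (eq_bigr (fun k : 'I_N => m%:R^-1 * f1 k + kap * (f2 k - (f3 k + M0))
    + lam * Bd (st_p (wseq k)) p1)); last by move=> k _; exact: S.
  rewrite sum_affine.
  have -> : frobenius Cm xbar = N%:R^-1 * \sum_k f1 k.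
    by rewrite frobeniusZr frobenius_sumr.
  have -> : frobenius (st_y u) (A *m xbar) = N%:R^-1 * \sum_k f2 k.
    by rewrite -scalemxAr frobeniusZr mulmx_sumr frobenius_sumr.
  have -> : frobenius Yu pbar = N%:R^-1 * \sum_k f3 k.
    by rewrite frobeniusZr frobenius_sumr.
  have hB := ler_wpM2l lam_ge0 Bd_jensen; have hM := sum_avg M0.
  move: hB hM; move: (\sum_k f1 k) (\sum_k f2 k) (\sum_k f3 k) (\sum_(k < N) M0).
  move: (\sum_(k < N) Bd _ _) (kap) (m%:R^-1) (N%:R^-1) (M0) (Bd _ _).
  move=> sB f1' f2' x1 x2 x3 y1 y2 y3 y4 hB hM; rewrite -hM; move: hB; lra.
apply: le_trans avg _.
have h (k : 'I_N) : true -> saddle C q lam p1 (st_p (wseq k)) (st_x (wseq k)) (st_y u) <=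
    a + (pairing (op (wseq k)) (wseq k) - pairing (op (wseq k)) u).
  move=> _; rewrite -lerBlDl; apply: le_trans (saddle_le_pairing (wseq_interior k) fu).
  by rewrite lerD2l lerN2 saddleE mu [frobenius (marginals_mx _ _) _]frobeniusC subrr mulr0 addr0.
apply: le_trans (ler_wpM2l Ni (ler_sum _ h)) _.
rewrite big_split /= mulrDr sum_avg lerD2l ler_wpM2l//.
by have := sum_pairing_le N fu; rewrite big_mkord.
Qed.

End Saddle.

(** * Convergence rate of the penalized objective *)

Section Rate.
Context {R : realType} {n m : nat}.
Hypothesis n_gt1 : (1 < n)%N.
Hypothesis m_gt0 : (0 < m)%N.
Variables (C : 'M[R]_n) (q : 'I_m -> 'cV[R]_n) (lam : R) (p1 : 'cV[R]_n).
Hypothesis dp1 : simplex R n p1.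
Hypothesis C_ge0 : forall i j, 0 <= C i j.
Hypothesis lam_gt0 : 0 < lam.
Hypothesis dq : forall k, simplex R n (q k).
Local Notation A := (incidence R n).
Local Notation L := (ln n%:R : R).
Local Notation st := (state R n m).
Local Notation K := (`|C| : R).
Hypothesis K_gt0 : 0 < K.
Local Notation Cm := (\matrix_(s < n * n, k < m) vectorize C s 0).

(* Exact penalty: the violation of the marginal constraints, weighted by 2 |C|,
   pays for repairing the plans. *)
Lemma transport_le_saddle p (X : 'M[R]_(n * n, m)) : simplex R n p ->
  (forall i j, 0 <= X i j) -> (forall j, \sum_i X i j = 1) ->
  exists2 Y : 'M[R]_(n + n, m), forall i j, -1 <= Y i j <= 1 &
    penalized C q lam p1 p <= saddle C q lam p1 p X Y.
Proof.
move=> dp X0 sX; pose D := A *m X - marginals_mx p q.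
pose Y : 'M[R]_(n + n, m) := \matrix_(i, j) (if 0 <= D i j then 1 else -1).
exists Y.
  have le_N11 : (-1 : R) <= 1 by apply: le_trans ler01; rewrite lerN10.
  by move=> i j; rewrite mxE; case: ifP => _; rewrite lexx le_N11.
rewrite saddleE lerD2r.
have YD : frobenius Y (A *m X) - frobenius (marginals_mx p q) Y = \sum_k l1 (D ^~ k).
  rewrite [frobenius _ Y]frobeniusC -frobeniusBr -/D frobenius_col.
  apply: eq_bigr => k _; apply: eq_bigr => i _; rewrite mxE.
  case: ifPn => [h|]; first by rewrite mul1r ger0_norm.
  by rewrite -ltNge => h; rewrite mulN1r ltr0_norm.
rewrite YD.
have Tk k : transport C p (q k) <= \sum_s vectorize C s 0 * X s k + K * l1 (D ^~ k).
  pose pi := vec_mx (col k X)^T.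
  have piE i j : pi i j = X (mxvec_index i j) k by rewrite !mxE.
  have pi0 i j : 0 <= pi i j by rewrite piE.
  have spi : \sum_i \sum_j pi i j = 1.
    rewrite -(sX k) sum_mxvec_index; apply: eq_bigr => i _; apply: eq_bigr => j _.
    exact: piE.
  apply: le_trans (transport_le_relaxed C_ge0 dp (dq k) pi0 spi) _.
  have -> : frobenius C pi = \sum_s vectorize C s 0 * X s k.
    rewrite sum_mxvec_index; apply: eq_bigr => i _; apply: eq_bigr => j _.
    by rewrite piE mxE mxvecE.
  have [hu hd] := incidence_entries X k.
  rewrite lerD2l ler_wpM2l// /l1 big_split_ord /=.
  have DE l : D l k = (A *m X) l k - col_mx p (q k) l 0.
    by rewrite /D [LHS]mxE; congr (_ + _); rewrite [LHS]mxE; congr (- _); rewrite [LHS]mxE.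
  have Du i : D (lshift n i) k = \sum_j pi i j - p i 0.
    rewrite DE hu col_mxEu; congr (_ - _).
    by apply: eq_bigr => j _; rewrite piE.
  have Dd j : D (rshift n j) k = \sum_i pi i j - q k j 0.
    rewrite DE hd col_mxEd; congr (_ - _).
    by apply: eq_bigr => i _; rewrite piE.
  by rewrite lerD//; apply: ler_sum => i _; rewrite ?Du ?Dd.
have mi : 0 <= m%:R^-1 :> R by rewrite invr_ge0.
apply: le_trans (ler_wpM2l mi (ler_sum _ (fun k _ => Tk k))) _.
rewrite big_split mulrDr /= -mulr_sumr.
have -> : frobenius Cm X = \sum_k \sum_s vectorize C s 0 * X s k.
  by rewrite frobenius_col; do 2 apply: eq_bigr => ? _; rewrite mxE.
rewrite lerD2l.
have l0 : 0 <= \sum_k l1 (D ^~ k) by apply: sumr_ge0 => k _; exact: l1_ge0.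
rewrite mulrA [m%:R^-1 * _]mulrC ler_wpM2r// -mulrA ler_peMl ?mulr_ge0//.
by lra.
Qed.

Lemma near_optimal_plans p tau : simplex R n p -> 0 < tau ->
  exists X : 'M[R]_(n * n, m), [/\ forall i j, 0 <= X i j, forall j, \sum_i X i j = 1,
    A *m X = marginals_mx p q &
    m%:R^-1 * frobenius Cm X <= m%:R^-1 * (\sum_k transport C p (q k)) + tau].
Proof.
move=> dp t0.
have [pl hpi] : {pl : 'I_m -> 'M[R]_n & forall k, plans p (q k) (pl k) /\
    frobenius C (pl k) <= transport C p (q k) + tau}.
  apply: (@boolp.choice _ _ (fun k pl => plans p (q k) pl /\
    frobenius C pl <= transport C p (q k) + tau)) => k.
  by have [pl h1 h2] := transport_near C_ge0 dp (dq k) t0; exists pl; split=> //; exact: ltW.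
pose X : 'M[R]_(n * n, m) := \matrix_(s, k) mxvec (pl k) 0 s.
have XE i j k : X (mxvec_index i j) k = pl k i j by rewrite mxE mxvecE.
have hpl k := proj1 (plansP p (q k) (pl k)) (proj1 (hpi k)).
exists X; split.
- by move=> s k; case/mxvec_indexP: s => i j; rewrite XE; case: (hpl k).
- move=> k; rewrite sum_mxvec_index; have [_ h _] := hpl k; have [_ <-] := dp.
  by apply: eq_bigr => i _; rewrite -h; apply: eq_bigr => j _; rewrite XE.
- apply/matrixP => l k; rewrite [RHS]mxE; have [hu hd] := incidence_entries X k.
  have [_ h1 h2] := hpl k.
  case: (split_ordP l) => i ->; rewrite ?hu ?hd ?col_mxEu ?col_mxEd -?h1 -?h2.
    by apply: eq_bigr => j _; rewrite XE.
  by apply: eq_bigr => j _; rewrite XE.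
- have mR : 0 < m%:R :> R by rewrite ltr0n.
  rewrite -ler_pdivlMl ?invr_gt0// invrK mulrDr mulVKf ?gt_eqF//.
  have -> : frobenius Cm X = \sum_k frobenius C (pl k).
    rewrite frobenius_col; apply: eq_bigr => k _; rewrite sum_mxvec_index.
    by apply: eq_bigr => i _; apply: eq_bigr => j _; rewrite XE !mxE mxvecE.
  rewrite mulr_natl -[X in _ *+ X]card_ord -sumr_const -big_split /=.
  by apply: ler_sum => k _; case: (hpi k).
Qed.

Variable dl : R.
Hypothesis dl_gt0 : 0 < dl.
Hypothesis p1_dl : forall i, dl <= p1 i 0.
Local Notation D := (ln dl^-1).
Local Notation lg := (L + D).
Local Notation sq := (Num.sqrt n%:R : R).
Variables sp sx sy : R.
Hypotheses (sp_gt0 : 0 < sp) (sx_gt0 : 0 < sx) (sy_gt0 : 0 < sy).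
(** The smallest inverse steps allowed for rho = 1 / sqrt(n). This rho balances the box, whose
    squared diameter is of order m n, against entropies that are only logarithmic. *)
Hypothesis spE : sp^-1 = 4 * K * sq + lam * (32 * L + 1).
Hypothesis sxE : sx^-1 = 8 * K * sq / m%:R.
Hypothesis syE : sy^-1 = 4 * K / (m%:R * sq).

Let nR : 0 < n%:R :> R. Proof. by rewrite ltr0n ltnW. Qed.
Let mR : 0 < m%:R :> R. Proof. by rewrite ltr0n. Qed.
Let sq0 : 0 < sq. Proof. by rewrite sqrtr_gt0; exact: nR. Qed.
Let L0 : 0 < L. Proof. exact: (ln_n_gt0 n_gt1). Qed.
Let p1_gt0 i : 0 < p1 i 0. Proof. exact: lt_le_trans (p1_dl i). Qed.

Lemma dl_le_ninv : dl <= n%:R^-1.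
Proof.
rewrite -[leRHS]mul1r ler_pdivlMr; last exact: nR.
have [_ s1] := dp1; rewrite -[leRHS]s1.
apply: le_trans (_ : \sum_(i < n) dl <= _); last by apply: ler_sum.
by rewrite sumr_const card_ord mulr_natr.
Qed.

Lemma L_le_D : L <= D.
Proof.
rewrite ler_ln ?posrE ?invr_gt0//.
by rewrite -[leLHS]invrK lef_pV2 ?posrE ?invr_gt0// dl_le_ninv.
Qed.

(** Relative to the uniform plan the entropy is at most ln n^2 = 2 L per sample; a dual vector in
    the box has squared norm at most 2 n, halved by the divergence. *)
Lemma divergence_init_le (u : st) : feasible R n m u ->
  divergence sp sx sy u (zseq C q lam p1 sp sx sy 0) <=
  sp^-1 * KL (st_p u ^~ 0) (p1 ^~ 0) + sx^-1 * (m%:R * (2 * L)) + sy^-1 * (m%:R * n%:R).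
Proof.
move=> /feasibleP[p0 sp1 x0 sx1 hy]; rewrite /divergence /zseq /= KLm_cV subr0.
have nn : 0 < (n * n)%:R^-1 :> R by rewrite natrM invr_gt0; apply: mulr_gt0; exact: nR.
apply: lerD; first apply: lerD => //.
  apply: ler_wpM2l; first by rewrite invr_ge0 ltW.
  apply: le_trans (_ : \sum_(k < m) (2 * L) <= _); last first.
    by rewrite sumr_const card_ord [leRHS]mulr_natl.
  apply: ler_sum => k _.
  have e : 2 * L = ln (n * n)%:R^-1^-1.
    by rewrite invrK natrM lnM ?posrE; [rewrite mulr2n mulrDl !mul1r|exact: nR|exact: nR].
  rewrite e; apply: KL_le_ln => //.
  - under eq_bigr do rewrite mxE.
    by rewrite sumr_const card_ord -[LHS]mulr_natl divff// gt_eqF// -invr_gt0.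
  - by move=> i; rewrite mxE.
apply: ler_wpM2l; first by rewrite invr_ge0 ltW.
rewrite mulrC ler_pdivrMr//.
rewrite /sqnorm frobenius_col.
apply: le_trans (_ : \sum_(k < m) \sum_(i < n + n) 1 <= _); last first.
  rewrite !sumr_const !card_ord -mulrnA -!natrM ler_nat addnn -muln2; apply: eq_leq; ring.
do 2 (apply: ler_sum => ? _); rewrite -expr2 -[leRHS](expr1n _ 2).
rewrite -[X in X <= _]real_normK ?num_real// ler_pXn2r ?nnegrE//.
by rewrite ler_norml.
Qed.

Lemma Bd_refl : Bd p1 p1 = 0.
Proof.
rewrite /Bd /bregman (derive_prox_simplex n_gt1)// subrr big1 ?subr0 ?subrr// => i _.
by rewrite [X in _ * X]mxE mulr0.
Qed.

(** With lam unbounded, the bound must come from optimality: a point no worse than p1 has lam Bd p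
    p1 <= K l because transport is Lipschitz, strong convexity turns this into lam l <= 24 K, and KL
    is at most l (1 + D). *)
Lemma lam_KL_le p : simplex R n p ->
  penalized C q lam p1 p <= penalized C q lam p1 p1 ->
  lam * KL (p ^~ 0) (p1 ^~ 0) <= 24 * K * (1 + D).
Proof.
move=> dp; rewrite /penalized Bd_refl mulr0 addr0 => h.
set l := l1 (fun i => p i 0 - p1 i 0).
have D0 : 0 <= D by apply: le_trans L_le_D; exact: ltW.
have hl : lam * Bd p p1 <= K * l.
  have mi : 0 <= m%:R^-1 :> R by rewrite invr_ge0.
  have T k : transport C p1 (q k) <= transport C p (q k) + K * l.
    have := transport_lipschitz C_ge0 dp1 (dq k) dp (dq k).
    have -> : l1 (fun i => q k i 0 - q k i 0) = 0 :> R.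
      by rewrite /l1 big1// => i _; rewrite subrr normr0.
    by rewrite addr0.
  have Ts : \sum_k transport C p1 (q k) <= \sum_k (transport C p (q k) + K * l).
    by apply: ler_sum => k _; exact: T.
  have := ler_wpM2l mi Ts.
  rewrite big_split mulrDr sumr_const card_ord -[(K * l) *+ m]mulr_natl mulKf ?gt_eqF//.
  by move: h; move: (m%:R^-1 * _) (m%:R^-1 * _) => a b; lra.
have sc := Bd_strongly_convex n_gt1 dp dp1; rewrite -/l in sc.
have l0 : 0 <= l by exact: l1_ge0.
have hlam : lam * l <= 24 * K.
  have [l00|lN0] := eqVneq l 0; first by rewrite l00 mulr0 mulr_ge0.
  have {lN0}lp : 0 < l by rewrite lt_neqAle eq_sym lN0.
  rewrite -(ler_pM2r lp); have := ler_wpM2l (ltW lam_gt0) sc.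
  by move: hl; rewrite expr2; move: (Bd _ _) => b; lra.
apply: le_trans (ler_wpM2l (ltW lam_gt0) (KL_le (dl := dl) _ _ _)) _.
- by move=> i; have [p0 s1] := dp; rewrite p0 (@distr_le1 R _ (p ^~ 0) i p0 s1).
- rewrite dl_gt0; apply: le_trans dl_le_ninv _.
  by rewrite -[leRHS]invr1 lef_pV2 ?posrE// ler1n; exact: ltnW.
- exact: p1_dl.
- by rewrite mulrA ler_wpM2r// addr_ge0.
Qed.

(** As lg >= 1, one has 1 + D <= 2 lg and 32 L + 1 <= 33 lg, whence the constant 4 + 24 * 2 * 33 +
    16 + 4 = 1608. *)
Lemma initial_bound (kl : R) : kl <= D -> lam * kl <= 24 * K * (1 + D) ->
  sp^-1 * kl + sx^-1 * (m%:R * (2 * L)) + sy^-1 * (m%:R * n%:R) <=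
  1608 * K * sq * lg ^+ 2.
Proof.
rewrite spE sxE syE => klD lkl.
have LD := L_le_D; have L2 : 1/2 <= L by have := ln_n_ge n_gt1 (R := R); lra.
have sq1 : 1 <= sq by rewrite -[leLHS]sqrtr1; apply: ler_wsqrtr; rewrite ler1n; exact: ltnW.
have -> : 8 * K * sq / m%:R * (m%:R * (2 * L)) = 16 * (K * sq) * L.
  by field; rewrite gt_eqF.
have -> : 4 * K / (m%:R * sq) * (m%:R * n%:R) = 4 * (K * sq).
  rewrite -[X in _ * (_ * X)](sqr_sqrtr (ltW nR)); field.
  by rewrite !gt_eqF.
have -> : (4 * K * sq + lam * (32 * L + 1)) * kl =
    4 * (K * sq) * kl + lam * kl * (32 * L + 1) by ring.
move: sq1 lkl klD LD L2 K_gt0.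
have -> : 1608 * K * sq * lg ^+ 2 = 1608 * (K * sq) * lg ^+ 2 by ring.
generalize sq K L D; move: (lam * kl) => lk s k l d s1 h1 h2 ld l2 k0.
have ks : k <= k * s by rewrite ler_peMr// ltW.
move: ks; move: (k * s) => t ks.
have a1 : t * kl <= t * d by rewrite ler_wpM2l//; lra.
have a2 : lk * (32 * l + 1) <= 24 * t * (1 + d) * (32 * l + 1).
  apply: ler_wpM2r; first lra.
  by apply: (le_trans h1); apply: ler_wpM2r; lra.
have t0 : 0 <= t by lra.
have a3 : 0 <= t * (d - l) by apply: mulr_ge0; lra.
have a4 : 0 <= t * (l - 1/2) by apply: mulr_ge0; lra.
have a5 : 0 <= t * ((l - 1/2) * (l - 1/2)) by apply: mulr_ge0; rewrite ?mulr_ge0; lra.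
have a6 : 0 <= t * ((l - 1/2) * (d - l)) by apply: mulr_ge0; rewrite ?mulr_ge0; lra.
have a7 : 0 <= t * ((d - l) * (d - l)) by apply: mulr_ge0; rewrite ?mulr_ge0; lra.
by lra.
Qed.

Variable N : nat.
Hypothesis N_gt0 : (0 < N)%N.

Lemma le_rearrange (a b c d e tau : R) : b <= a + tau -> c <= d ->
  b + e + c <= tau + (a + e + d).
Proof. lra. Qed.

(** [lam_KL_le] covers only the competitors at least as good as p1; any other one is beaten by p1
    itself. *)
Lemma mirror_prox_rate :
  penalized_gap C q lam p1 (mirror_prox_output (wseq C q lam p1 sp sx sy) N) <=
  1608 * K * sq * lg ^+ 2 / N%:R.
Proof.
have NR : 0 < N%:R :> R by rewrite ltr0n.
have Ni : 0 <= N%:R^-1 :> R by rewrite invr_ge0.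
set B := 1608 * K * sq * lg ^+ 2; set pbar := mirror_prox_output _ _.
have e1 : 2 * (2 * K / m%:R) * sq^-1 <= sy^-1.
  by rewrite syE le_eqVlt; apply/orP; left; apply/eqP; field; rewrite !gt_eqF.
have e2 : 4 * (2 * K / m%:R) / sq^-1 <= sx^-1.
  by rewrite sxE le_eqVlt; apply/orP; left; apply/eqP; field; rewrite !gt_eqF.
have e3 : 2 * (2 * K / m%:R) * m%:R / sq^-1 + lam * (32 * L + 1) <= sp^-1.
  rewrite spE lerD2r le_eqVlt; apply/orP; left; apply/eqP; field; by rewrite !gt_eqF.
have r0 : 0 < sq^-1 by rewrite invr_gt0; exact: sq0.
have key p : simplex R n p -> penalized C q lam p1 p <= penalized C q lam p1 p1 ->
    penalized C q lam p1 pbar <= penalized C q lam p1 p + B / N%:R.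
  move=> dp pen; apply/ler_addgt0Pl => tau t0.
  have dbar : simplex R n pbar.
    exact: (output_simplex n_gt1 C q lam dp1 sp sx sy p1_gt0 N_gt0).
  have [X0 sX] := xbar_simplex n_gt1 C q lam dp1 sp sx sy p1_gt0 N_gt0.
  have [Y hY hbar] := transport_le_saddle dbar X0 sX.
  have [X [X0' sX' mX cX]] := near_optimal_plans dp t0.
  pose u : st := State p X Y.
  have fu : feasible R n m u.
    apply/feasibleP; case: dp => p0 sp1; split=> //=.
    by move=> i j; rewrite (ord1 j).
  have := saddle_output_le n_gt1 dp1 (ltW lam_gt0) sp_gt0 sx_gt0 sy_gt0 r0 e1 e2 e3
    p1_gt0 N_gt0 fu mX.
  move/(le_trans hbar) => h; apply: (le_trans h) => /=.
  have : N%:R^-1 * divergence sp sx sy u (zseq C q lam p1 sp sx sy 0) <= B / N%:R.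
    rewrite mulrC ler_wpM2r//; apply: le_trans (divergence_init_le fu) _ => /=.
    apply: initial_bound => //; last exact: lam_KL_le.
    have [p0 sp1] := dp; have [p10 sp11] := dp1.
    by apply: KL_le_ln.
  rewrite /penalized; move: cX; move: (m%:R^-1 * _) (m%:R^-1 * _) (N%:R^-1 * _) (B / _) (lam * _).
  by move=> a b c d e; exact: le_rearrange.
rewrite /penalized_gap lerBlDl -lerBlDr; apply: lb_le_inf.
  by exists (penalized C q lam p1 p1), p1.
move=> _ [p dp <-]; rewrite lerBlDr.
case/orP: (le_total (penalized C q lam p1 p) (penalized C q lam p1 p1)) => h.
  exact: key.
by apply: le_trans (key p1 dp1 (lexx _)) _; rewrite lerD2r.
Qed.

End Rate.

(** * Straight-line programs *)

Section Straight_line.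
Context {R : realType}.

Lemma run_rcons prog i (e : nat -> R) : run (rcons prog i) e = exec (run prog e) i.
Proof. by rewrite /run foldl_rcons. Qed.

Lemma run_cat prog prog' (e : nat -> R) : run (prog ++ prog') e = run prog' (run prog e).
Proof. by rewrite /run foldl_cat. Qed.

Definition dst (i : instr) := match i with Const d _ | Un _ d _ | Bin _ d _ _ => d end.

Lemma exec_other i (e : nat -> R) r : r != dst i -> exec e i r = e r.
Proof. by case: i => [d k|f d s|f d s t] /= /negPf ->. Qed.

(** The instruction set has no move; the maximum of a register with itself takes its place. *)
Definition copy (d s : nat) := Bin Max d s s.

Lemma exec_copy d s (e : nat -> R) : exec e (copy d s) d = e s.
Proof. by rewrite /= eqxx maxxx. Qed.

Lemma run_copies (J : eqType) (s : seq J) (d f : J -> nat) (e : nat -> R) :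
  {in s &, injective d} -> uniq s -> {in s &, forall i j, f i != d j} ->
  {in s, forall j, run [seq copy (d j) (f j) | j <- s] e (d j) = e (f j)} /\
  (forall r, {in s, forall j, r != d j} -> run [seq copy (d j) (f j) | j <- s] e r = e r).
Proof.
elim/last_ind: s => [|s j IH] dI; first by split.
rewrite rcons_uniq => /andP[jN us] fd; rewrite map_rcons.
have sub k : k \in s -> k \in rcons s j by rewrite mem_rcons inE orbC => ->.
have js : j \in rcons s j by rewrite mem_rcons mem_head.
have [IH1 IH2] := IH (fun i k hi hk => dI i k (sub i hi) (sub k hk)) us
  (fun i k hi hk => fd i k (sub i hi) (sub k hk)).
split=> [k|r hr]; last first.
  rewrite run_rcons exec_other; last exact: (hr j js).
  by apply: IH2 => k /sub; exact: hr.
rewrite mem_rcons inE => /orP[/eqP ->|ks]; rewrite run_rcons.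
  rewrite exec_copy; apply: IH2 => i si; exact: fd js (sub _ si).
rewrite exec_other ?IH1//=; apply/eqP => e1.
by have e2 := dI _ _ (sub _ ks) js e1; rewrite -e2 ks in jN.
Qed.

(* [T] is a type of inputs: a program is judged by the functions of the input
   that its registers hold, so that it cannot depend on the input. *)
Context {T : Type} {input : T -> nat -> R}.

Definition holds_in prog (f : T -> R) r := forall t, run prog (input t) r = f t.

(** The tracked values live below register B, so an instruction writing to B destroys none of
    them. *)
Definition reach (c : nat) (S : set (T -> R)) := exists prog B,
  (size prog <= c)%N /\ forall f, S f -> exists2 r, (r < B)%N & holds_in prog f r.

(** Quantifies over every larger collection S0 already available, and keeps it. Intermediate results
    can thus be shared, and costs add under composition. *)
Definition derives (S : set (T -> R)) (c : nat) (F : set (T -> R)) :=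
  forall c0 S0, S `<=` S0 -> reach c0 S0 -> reach (c0 + c) (S0 `|` F).

Lemma derives_sub S S' c c' F F' : S' `<=` S -> F `<=` F' -> (c' <= c)%N ->
  derives S' c' F' -> derives S c F.
Proof.
move=> SS FF cc h c0 S0 S0S r.
have [prog [B [hs hk]]] := h c0 S0 (subset_trans SS S0S) r.
exists prog, B; split; first by apply: leq_trans hs _; rewrite leq_add2l.
by move=> f [|/FF] hf; apply: hk; [left|right].
Qed.

Lemma derives_cost S c c' F : derives S c F -> (c <= c')%N -> derives S c' F.
Proof. by move=> h cc; apply: derives_sub h. Qed.

Lemma derives_trans S a F b G : derives S a F -> derives (S `|` F) b G ->
  derives S (a + b) (F `|` G).
Proof.
move=> hF hG c0 S0 S0S r; rewrite addnA setUA.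
by apply: hG (hF _ _ S0S r); exact: setSU.
Qed.

Lemma derives_refl S : derives S 0 S.
Proof. by move=> c0 S0 SS r; rewrite addn0 (setUidl SS). Qed.

Lemma derives_cup S a F b G : derives S a F -> derives S b G ->
  derives S (a + b) (F `|` G).
Proof. by move=> hF hG; apply: derives_trans hF _; apply: derives_sub hG => // f; left. Qed.

Definition value S c (f : T -> R) := derives S c [set f].

Lemma value_in (S : set (T -> R)) f : S f -> value S 0 f.
Proof. by move=> Sf; apply: derives_sub (@derives_refl S) => // _ ->. Qed.

Lemma value_cost S c c' f : value S c f -> (c <= c')%N -> value S c' f.
Proof. exact: derives_cost. Qed.

Lemma value_trans S a F b f : derives S a F -> value (S `|` F) b f -> value S (a + b) f.
Proof. by move=> h hf; apply: derives_sub (derives_trans h hf) => // g; right. Qed.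

Lemma reach_instr (i : nat -> instr) (f : T -> R) prog B c S :
  (forall B, dst (i B) = B) -> (size prog <= c)%N ->
  (forall f, S f -> exists2 r, (r < B)%N & holds_in prog f r) ->
  (forall t, exec (run prog (input t)) (i B) B = f t) -> reach (c + 1) (S `|` [set f]).
Proof.
move=> hd hs hk hf; exists (rcons prog (i B)), B.+1; split.
  by rewrite size_rcons addn1.
move=> g [/hk[r rB hr]|->].
  exists r; first exact: ltnW.
  by move=> t; rewrite run_rcons exec_other ?hr// hd neq_ltn rB.
by exists B => // t; rewrite run_rcons.
Qed.

Lemma value_const S k : value S 1 (fun=> k%:R).
Proof.
move=> c0 S0 _ [prog [B [hs hk]]].
by apply: (reach_instr (i := fun B => Const B k) _ hs hk) => // t; rewrite /= eqxx.
Qed.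

Lemma value_un S a o f : value S a f -> value S (a + 1) (fun t => eval_unop o (f t)).
Proof.
move=> hf; apply: value_trans hf _ => c0 S0 S0S [prog [B [hs hk]]].
have [r _ hr] : exists2 r, (r < B)%N & holds_in prog f r by apply/hk/S0S; right.
apply: (reach_instr (i := fun B => Un o B r) _ hs hk) => // t.
by rewrite /= eqxx hr.
Qed.

Lemma value_bin S a b o f g : value S a f -> value S b g ->
  value S (a + b + 1) (fun t => eval_binop o (f t) (g t)).
Proof.
move=> hf hg; apply: value_trans (derives_cup hf hg) _ => c0 S0 S0S [prog [B [hs hk]]].
have [r _ hr] : exists2 r, (r < B)%N & holds_in prog f r by apply/hk/S0S; right; left.
have [r' _ hr'] : exists2 r, (r < B)%N & holds_in prog g r by apply/hk/S0S; right; right.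
apply: (reach_instr (i := fun B => Bin o B r r') _ hs hk) => // t.
by rewrite /= eqxx hr hr'.
Qed.

Lemma value_add S a b f g : value S a f -> value S b g ->
  value S (a + b + 1) (fun t => f t + g t).
Proof. exact: (@value_bin S a b Defs.Add). Qed.

Lemma value_diff S a b f g : value S a f -> value S b g ->
  value S (a + b + 1) (fun t => f t - g t).
Proof. exact: (@value_bin S a b Defs.Sub). Qed.

Lemma value_mul S a b f g : value S a f -> value S b g ->
  value S (a + b + 1) (fun t => f t * g t).
Proof. exact: (@value_bin S a b Mul). Qed.

Lemma value_div S a b f g : value S a f -> value S b g ->
  value S (a + b + 1) (fun t => f t / g t).
Proof. exact: (@value_bin S a b Div). Qed.

Lemma value_pow S a b f g : value S a f -> value S b g ->
  value S (a + b + 1) (fun t => f t `^ g t).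
Proof. exact: (@value_bin S a b Pow). Qed.

Lemma value_max S a b f g : value S a f -> value S b g ->
  value S (a + b + 1) (fun t => Num.max (f t) (g t)).
Proof. exact: (@value_bin S a b Max). Qed.

Lemma value_min S a b f g : value S a f -> value S b g ->
  value S (a + b + 1) (fun t => Num.min (f t) (g t)).
Proof. exact: (@value_bin S a b Min). Qed.

Lemma value_exp S a f : value S a f -> value S (a + 1) (fun t => expR (f t)).
Proof. exact: (@value_un S a Exp). Qed.

Lemma value_ln S a f : value S a f -> value S (a + 1) (fun t => ln (f t)).
Proof. exact: (@value_un S a Ln). Qed.

Lemma value_opp S a f : value S a f -> value S (1 + a + 1) (fun t => - f t).
Proof.
move=> hf; rewrite (_ : (fun t => - f t) = fun t => 0%:R - f t).
  exact: value_diff (value_const 0) hf.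
by apply/funext => t; rewrite mulr0n sub0r.
Qed.

Lemma derives_range (J : finType) S c (F : J -> T -> R) :
  (forall j, value S c (F j)) -> derives S (#|J| * c) (range F).
Proof.
move=> h; have H s : derives S (size s * c) [set f | exists2 j, j \in s & f = F j].
  elim: s => [|j s IH].
    by apply: derives_sub (@derives_refl S) => // f [j]; rewrite in_nil.
  rewrite mulSn; apply: derives_sub (derives_cup (h j) IH) => // f [i].
  by rewrite inE => /orP[/eqP ->|si] ->; [left|right; exists i].
rewrite cardT; apply: derives_sub (H (enum J)) => // f [j _ <-].
by exists j => //; rewrite mem_enum.
Qed.

Lemma value_big (J : finType) S c o k (F : J -> T -> R) :
  (forall j, value S c (F j)) ->
  value S (#|J| * c.+1 + 1) (fun t => \big[eval_binop o/k%:R]_j F j t).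
Proof.
move=> h; have H s : value S (size s * c.+1 + 1)
    (fun t => \big[eval_binop o/k%:R]_(j <- s) F j t).
  elim: s => [|j s IH].
    rewrite (_ : (fun t => _) = fun=> k%:R); first exact: value_const.
    by apply/funext => t; rewrite big_nil.
  rewrite (_ : (fun t => _) = fun t => eval_binop o (F j t)
      (\big[eval_binop o/k%:R]_(j <- s) F j t)); last first.
    by apply/funext => t; rewrite big_cons.
  by apply: value_cost (value_bin o (h j) IH) _; rewrite /=; lia.
rewrite cardT; rewrite (_ : (fun t => _) =
  fun t => \big[eval_binop o/k%:R]_(j <- enum J) F j t) //.
by apply/funext => t; rewrite enumT [index_enum _]unlock.
Qed.

Lemma value_sum (J : finType) S c (F : J -> T -> R) :
  (forall j, value S c (F j)) -> value S (#|J| * c.+1 + 1) (fun t => \sum_j F j t).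
Proof. exact: (@value_big J S c Add 0 F). Qed.

Lemma reach_input (S : set (T -> R)) B :
  (forall f, S f -> exists2 r, (r < B)%N & forall t, input t r = f t) -> reach 0 S.
Proof. by move=> h; exists [::], B. Qed.

(** The outputs must land in registers 0 to n - 1, which may still hold values to be read. They are
    first copied to fresh registers from B0 + n on; the two rounds of copies cost 2 n. *)
Lemma reach_outputs n c S (out : 'I_n -> T -> R) : reach c S ->
  (forall i, S (out i)) -> exists2 prog, (size prog <= c + 2 * n)%N &
  forall t (i : 'I_n), run prog (input t) i = out i t.
Proof.
move=> [prog [B0 [hs hk]]] hS; pose B := (B0 + n)%N.
have [r hr] : {r : 'I_n -> nat & forall i, (r i < B)%N /\ holds_in prog (out i) (r i)}.
  apply: (@boolp.choice _ _ (fun i r => (r < B)%N /\ holds_in prog (out i) r)) => i.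
  have [r rB h] := hk _ (hS i).
  by exists r; split=> //; apply: (leq_trans rB); exact: leq_addr.
exists (prog ++ [seq copy (B + i)%N (r i) | i : 'I_n <- enum 'I_n]
  ++ [seq copy i (B + i)%N | i : 'I_n <- enum 'I_n]).
  have se : size (enum 'I_n) = n by rewrite size_enum_ord.
  by rewrite size_cat [X in (_ + X)%N]size_cat !(size_map _ (enum 'I_n)) se; lia.
move=> t i; rewrite !run_cat.
have ui := enum_uniq 'I_n; have mi (j : 'I_n) : j \in enum 'I_n by rewrite mem_enum.
pose e0 := run prog (input t).
pose e1 := run [seq copy (B + i)%N (r i) | i : 'I_n <- enum 'I_n] e0.
have I1 : {in enum 'I_n &, injective (fun i : 'I_n => B + i)%N}.
  by move=> j k _ _ /addnI /val_inj.
have I2 : {in enum 'I_n &, injective (fun i : 'I_n => val i)} by move=> j k _ _ /val_inj.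
have D1 : {in enum 'I_n &, forall j k : 'I_n, r j != (B + k)%N}.
  move=> j k _ _; have [h _] := hr j.
  by rewrite neq_ltn (leq_trans h)// leq_addr.
have D2 : {in enum 'I_n &, forall j k : 'I_n, (B + j)%N != val k}.
  move=> j k _ _; rewrite neq_ltn; apply/orP; right.
  by apply: (leq_trans (ltn_ord k)); rewrite /B -addnA addnCA leq_addr.
have [h1 _] := run_copies e0 I1 ui D1; have [h2 _] := run_copies e1 I2 ui D2.
transitivity (e1 (B + i)%N); first exact: h2 i (mi i).
transitivity (e0 (r i)); first exact: h1 i (mi i).
by have [_ h] := hr i; exact: h.
Qed.

End Straight_line.

(** * Cost of matrix operations *)

Section Matrices.
Context {R : realType} {T : Type} {input : T -> nat -> R}.
Local Notation derives := (@derives R T input).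
Local Notation value := (@value R T input).

Lemma derives_then (S F G : set (T -> R)) a b : derives S a F -> derives (S `|` F) b G ->
  derives S (a + b) G.
Proof. by move=> hF hG; apply: derives_sub (derives_trans hF hG) => // f; right. Qed.

Lemma value_inv (S : set (T -> R)) a f : value S a f -> value S (1 + a + 1) (fun t => (f t)^-1).
Proof.
move=> hf; rewrite (_ : (fun t => (f t)^-1) = fun t => 1%:R / f t).
  exact: value_div (value_const 1) hf.
by apply/funext => t; rewrite div1r.
Qed.

Lemma value_norm (S : set (T -> R)) f : S f -> value S 3 (fun t => `|f t|).
Proof.
move=> Sf; have hf : value S 0 f by exact: value_in.
rewrite (_ : (fun t => `|f t|) = fun t => Num.max (f t) (- f t)).
  exact: value_max hf (value_opp hf).
by apply/funext => t; rewrite maxrN.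
Qed.

Definition entries r c (M : T -> 'M[R]_(r, c)) : set (T -> R) :=
  range (fun (ij : 'I_r * 'I_c) t => M t ij.1 ij.2).

Lemma entriesP r c (M : T -> 'M[R]_(r, c)) i j : entries M (fun t => M t i j).
Proof. by exists (i, j). Qed.

Lemma value_entry (S : set (T -> R)) r c (M : T -> 'M[R]_(r, c)) i j :
  entries M `<=` S -> value S 0 (fun t => M t i j).
Proof. by move=> h; apply/value_in/h/entriesP. Qed.

Lemma derives_entries (S : set (T -> R)) k r c (M : T -> 'M[R]_(r, c)) :
  (forall i j, value S k (fun t => M t i j)) -> derives S (r * c * k) (entries M).
Proof.
move=> h; have := @derives_range R T input ('I_r * 'I_c)%type S k
  (fun ij t => M t ij.1 ij.2) (fun ij => h ij.1 ij.2).
by rewrite card_prod !card_ord.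
Qed.

(** The normalizers are computed once per column and shared, which keeps the cost linear in the
    number of entries. *)
Lemma derives_softmax (S : set (T -> R)) r c (s : T -> R) (Z G : T -> 'M[R]_(r, c)) :
  (0 < r)%N -> S s -> entries Z `<=` S -> entries G `<=` S ->
  derives S (8 * (r * c)) (entries (fun t => softmax_mx (s t) (Z t) (G t))).
Proof.
move=> r0 Ss hZ hG.
pose num t : 'M[R]_(r, c) := \matrix_(i, j) (Z t i j * expR (- (s t * G t i j))).
pose den t : 'M[R]_(1, c) := \row_j \sum_i num t i j.
have hnum : derives S (r * c * 5) (entries num).
  apply: derives_entries => i j.
  rewrite (_ : (fun t => num t i j) = fun t => Z t i j * expR (- (s t * G t i j))).
    exact: (value_mul (value_entry i j hZ)
      (value_exp (value_opp (value_mul (value_in Ss) (value_entry i j hG))))).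
  by apply/funext => t; rewrite mxE.
have hden : derives (S `|` entries num) (1 * c * (r * 1 + 1)) (entries den).
  apply: derives_entries => i j.
  rewrite (_ : (fun t => den t i j) = fun t => \sum_i num t i j); last first.
    by apply/funext => t; rewrite mxE.
  have := @value_sum R T input 'I_r (S `|` entries num) 0 (fun i t => num t i j).
  by rewrite card_ord; apply => k; apply: value_entry => f ?; right.
have hdiv : derives (S `|` entries num `|` entries den) (r * c * 1)
    (entries (fun t => softmax_mx (s t) (Z t) (G t))).
  apply: derives_entries => i j.
  rewrite (_ : (fun t => _) = fun t => num t i j / den t 0 j).
    by apply: (value_div (value_entry i j _) (value_entry 0 j _)) => f ?;
      [left; right|right].
  apply/funext => t; rewrite mxE /softmax !mxE; congr (_ / _).
  by apply: eq_bigr => k _; rewrite mxE.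
have := derives_then hnum (derives_then hden hdiv).
move/derives_cost; apply; nia.
Qed.

Lemma derives_clip (S : set (T -> R)) r c (s : T -> R) (Z G : T -> 'M[R]_(r, c)) :
  S s -> entries Z `<=` S -> entries G `<=` S ->
  derives S (r * c * 8) (entries (fun t => clip_mx (s t) (Z t) (G t))).
Proof.
move=> Ss hZ hG; apply: derives_entries => i j.
rewrite (_ : (fun t => _) =
  fun t => Num.max (- 1%:R) (Num.min 1%:R (Z t i j - s t * G t i j))).
  exact: (value_max (value_opp (value_const 1)) (value_min (value_const 1)
    (value_diff (value_entry i j hZ) (value_mul (value_in Ss) (value_entry i j hG))))).
by apply/funext => t; rewrite mxE.
Qed.

End Matrices.

(** * A program for N iterations of Mirror Prox *)

Section Mirror_prox.
Context {R : realType} {n m : nat}.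
Hypothesis n_gt0 : (0 < n)%N.
Hypothesis m_gt0 : (0 < m)%N.
Local Notation st := (state R n m).

Record problem := Problem {
  pb_C : 'M[R]_n;
  pb_q : 'I_m -> 'cV[R]_n;
  pb_lam : R;
  pb_p1 : 'cV[R]_n;
  pb_sp : R;
  pb_sx : R;
  pb_sy : R }.

Definition problem_input (t : problem) : nat -> R :=
  nth 0 (problem_data (pb_C t) (pb_q t) (pb_lam t) (pb_p1 t) (pb_sp t) (pb_sx t) (pb_sy t)).

Local Notation derives := (@derives R problem problem_input).
Local Notation value := (@value R problem problem_input).
Let q_mx t : 'M[R]_(n, m) := \matrix_(i, k) pb_q t k i 0.

Definition data : set (problem -> R) :=
  [set pb_lam; pb_sp; pb_sx; pb_sy] `|` entries pb_C `|` entries pb_p1 `|` entries q_mx.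

Definition state_entries (z : problem -> st) : set (problem -> R) :=
  entries (fun t => st_p (z t)) `|` entries (fun t => st_x (z t))
    `|` entries (fun t => st_y (z t)).

Lemma derives_prox_step (S : set (problem -> R)) (z g : problem -> st) : data `<=` S ->
  state_entries z `<=` S -> state_entries g `<=` S ->
  derives S (32 * (n * n * m))
    (state_entries (fun t => prox_step (pb_sp t) (pb_sx t) (pb_sy t) (z t) (g t))).
Proof.
move=> hd hz hg.
have Ssp : S pb_sp by apply: hd; do 3 left; left; left; right.
have Ssx : S pb_sx by apply: hd; do 3 left; left; right.
have Ssy : S pb_sy by apply: hd; do 3 left; right.
have zp : entries (fun t => st_p (z t)) `<=` S by move=> f ?; apply: hz; left; left.
have zx : entries (fun t => st_x (z t)) `<=` S by move=> f ?; apply: hz; left; right.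
have zy : entries (fun t => st_y (z t)) `<=` S by move=> f ?; apply: hz; right.
have gp : entries (fun t => st_p (g t)) `<=` S by move=> f ?; apply: hg; left; left.
have gx : entries (fun t => st_x (g t)) `<=` S by move=> f ?; apply: hg; left; right.
have gy : entries (fun t => st_y (g t)) `<=` S by move=> f ?; apply: hg; right.
have nn0 : (0 < n * n)%N by rewrite muln_gt0 n_gt0.
apply: derives_cost (derives_cup (derives_cup (derives_softmax n_gt0 Ssp zp gp)
  (derives_softmax nn0 Ssx zx gx)) (derives_clip Ssy zy gy)) _.
nia.
Qed.

Let a_cost (S : set (problem -> R)) : value S 8 (fun=> prox_exponent R n).
Proof.
exact: (value_add (value_const 1)
  (value_inv (value_mul (value_const 2) (value_ln (value_const n))))).
Qed.

Lemma derives_prox_grad (S : set (problem -> R)) (x : problem -> 'cV[R]_n) :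
  entries x `<=` S -> derives S (38 * n) (entries (fun t => prox_grad (x t))).
Proof.
move=> hx; pose ps t : R := psum (x t ^~ 0).
have hps : value S (n * 10 + 1) ps.
  have := @value_sum R problem problem_input 'I_n S 9 (fun i t => x t i 0 `^ prox_exponent R n).
  rewrite card_ord; apply=> i.
  exact: (value_pow (value_entry i 0 hx) (@a_cost S)).
have hg : derives (S `|` [set ps]) (n * 1 * 26) (entries (fun t => prox_grad (x t))).
  apply: derives_entries => i j; rewrite (ord1 j).
  rewrite (_ : (fun t => _) = fun t => 2%:R * ln n%:R * ps t `^ (2%:R / prox_exponent R n - 1%:R)
      * x t i 0 `^ (2%:R * ln n%:R)^-1); last first.
    by apply/funext => t; rewrite mxE.
  have h2L : value (S `|` [set ps]) 4 (fun=> 2%:R * ln n%:R).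
    exact: (value_mul (value_const 2) (value_ln (value_const n))).
  have hb : value (S `|` [set ps]) 12 (fun=> 2%:R / prox_exponent R n - 1%:R).
    exact: (value_diff (value_div (value_const 2) (@a_cost _)) (value_const 1)).
  have hps' : value (S `|` [set ps]) 0 ps by apply: value_in; right.
  have hxi : value (S `|` [set ps]) 0 (fun t => x t i 0).
    by apply: value_entry => f ?; left; exact: hx.
  exact: (value_mul (value_mul h2L (value_pow hps' hb)) (value_pow hxi (value_inv h2L))).
have := derives_then hps hg.
move/derives_cost; apply; lia.
Qed.

Lemma delta_mxvec_index (i j a b : 'I_n) :
  delta_mx (mxvec_index i j) 0 (mxvec_index a b) (0 : 'I_1) = ((a == i) && (b == j))%:R :> R.
Proof.
have := mxvecE (delta_mx i j : 'M[R]_n) a b.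
by rewrite mxvec_delta !mxE eqxx andbT.
Qed.

Lemma incidence_entry (i j a : 'I_n) :
  incidence R n (lshift n a) (mxvec_index i j) = (a == i)%:R /\
  incidence R n (rshift n a) (mxvec_index i j) = (a == j)%:R.
Proof.
have [hu hd] := incidence_entries (delta_mx (mxvec_index i j) 0 : 'M[R]_(n * n, 1)) 0.
have := hu a; have := hd a; rewrite -!colE ![col _ _ _ _]mxE => -> ->; split.
  rewrite (bigD1 j)//= big1 => [|b /negPf bj]; rewrite delta_mxvec_index.
    by rewrite eqxx andbT addr0.
  by rewrite bj andbF.
rewrite (bigD1 i)//= big1 => [|b /negPf bi]; rewrite delta_mxvec_index.
  by rewrite eqxx addr0.
by rewrite bi.
Qed.

Lemma incidence_tr_entries (Y : 'M[R]_(n + n, m)) i j k :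
  ((incidence R n)^T *m Y) (mxvec_index i j) k = Y (lshift n i) k + Y (rshift n j) k.
Proof.
rewrite mxE big_split_ord /=; congr (_ + _).
  rewrite (bigD1 i)//= big1 => [|a ai].
    by rewrite mxE (incidence_entry _ _ _).1 eqxx mul1r addr0.
  by rewrite mxE (incidence_entry _ _ _).1 (negPf ai) mul0r.
rewrite (bigD1 j)//= big1 => [|b bj].
  by rewrite mxE (incidence_entry _ _ _).2 eqxx mul1r addr0.
by rewrite mxE (incidence_entry _ _ _).2 (negPf bj) mul0r.
Qed.

Let kap t : R := 2 * `|pb_C t| / m%:R.

Lemma value_kap (S : set (problem -> R)) : data `<=` S -> value S (n * n * 4 + 5) kap.
Proof.
move=> hd; have hC : entries pb_C `<=` S by move=> f ?; apply: hd; left; left; right.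
have hN : value S (n * n * 4 + 1) (fun t => `|pb_C t|).
  rewrite (_ : (fun t => _) = fun t =>
      \big[eval_binop Max/0%:R]_(ij : 'I_n * 'I_n) `|pb_C t ij.1 ij.2|); last first.
    by apply/funext => t; rewrite -[LHS]/(mx_norm (pb_C t)) mx_normrE.
  have := @value_big R problem problem_input ('I_n * 'I_n)%type S 3 Max 0
    (fun ij t => `|pb_C t ij.1 ij.2|).
  rewrite card_prod !card_ord; apply=> ij.
  apply: value_norm; apply: hC; exact: entriesP.
apply: value_cost (value_div (value_mul (value_const 2) hN) (value_const m)) _.
lia.
Qed.

(** The incidence matrix A is never multiplied out: its product with the plans has 2 n m entries
    that are sums of n terms, and that of its transpose with the duals has n^2 m entries that are
    sums of two. This is the source of the cost n^2 m. *)
Lemma derives_op (S : set (problem -> R)) (z : problem -> st) : data `<=` S ->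
  state_entries z `<=` S ->
  derives S (200 * (n * n * m)) (state_entries (fun t =>
    op (pb_C t) (pb_q t) (pb_lam t) (pb_p1 t) (z t))).
Proof.
move=> hd hz.
have hk := value_kap hd.
have zp : entries (fun t => st_p (z t)) `<=` S by move=> f ?; apply: hz; left; left.
have zx : entries (fun t => st_x (z t)) `<=` S by move=> f ?; apply: hz; left; right.
have zy : entries (fun t => st_y (z t)) `<=` S by move=> f ?; apply: hz; right.
have hp1 : entries pb_p1 `<=` S by move=> f ?; apply: hd; left; right.
have hC : entries pb_C `<=` S by move=> f ?; apply: hd; left; left; right.
have hq : entries q_mx `<=` S by move=> f ?; apply: hd; right.
have hlam : S pb_lam by apply: hd; do 3 left; left; left; left.
pose S1 := S `|` [set kap].
have hz1 : derives S1 (38 * n) (entries (fun t => prox_grad (st_p (z t)))).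
  by apply: derives_prox_grad => f /zp ?; left.
pose S2 := S1 `|` entries (fun t => prox_grad (st_p (z t))).
have h1 : derives S2 (38 * n) (entries (fun t => prox_grad (pb_p1 t))).
  by apply: derives_prox_grad => f /hp1 ?; left; left.
pose S3 := S2 `|` entries (fun t => prox_grad (pb_p1 t)).
have SS : S `<=` S3 by move=> f ?; do 3 left.
have Sk : value S3 0 kap by apply: value_in; left; left; right.
have hp : derives S3 (n * 1 * (m + 6)) (entries (fun t =>
    op_p (pb_C t) (pb_lam t) (pb_p1 t) (z t))).
  apply: derives_entries => i j; rewrite (ord1 j).
  rewrite (_ : (fun t => _) = fun t => pb_lam t *
      (prox_grad (st_p (z t)) i 0 - prox_grad (pb_p1 t) i 0) -
      kap t * \sum_k st_y (z t) (lshift n i) k); last first.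
    apply/funext => t; rewrite /op_p [LHS]mxE; congr (_ + _).
      by rewrite [LHS]mxE; congr (_ * _); rewrite [LHS]mxE; congr (_ + _); rewrite [LHS]mxE.
    rewrite [LHS]mxE; congr (- _); rewrite [LHS]mxE mulmx_const1; congr (_ * _).
    by apply: eq_bigr => k _; rewrite mxE.
  have hs : value S3 (m * 1 + 1) (fun t => \sum_k st_y (z t) (lshift n i) k).
    have := @value_sum R problem problem_input 'I_m S3 0 (fun k t => st_y (z t) (lshift n i) k).
    by rewrite card_ord; apply=> k; apply: value_entry => f /zy /SS.
  have vz : value S3 0 (fun t => prox_grad (st_p (z t)) i 0).
    by apply: value_entry => f ?; left; right.
  have v1 : value S3 0 (fun t => prox_grad (pb_p1 t) i 0).
    by apply: value_entry => f ?; right.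
  have vl : value S3 0 pb_lam by apply: value_in; exact: SS.
  apply: value_cost (value_diff (value_mul vl (value_diff vz v1)) (value_mul Sk hs)) _.
  lia.
have hx : derives S3 (n * n * m * 10) (entries (fun t => op_x (pb_C t) (z t))).
  apply: derives_entries => s k; case/mxvec_indexP: s => i j.
  rewrite (_ : (fun t => _) = fun t => (m%:R)^-1 * pb_C t i j +
      kap t * (st_y (z t) (lshift n i) k + st_y (z t) (rshift n j) k)); last first.
    apply/funext => t; rewrite /op_x [LHS]mxE; congr (_ + _).
      by rewrite [LHS]mxE; congr (_ * _); rewrite !mxE mxvecE.
    by rewrite [LHS]mxE; congr (_ * _); exact: incidence_tr_entries.
  have vC : value S3 0 (fun t => pb_C t i j) by apply: value_entry => f /hC /SS.
  have vy l : value S3 0 (fun t => st_y (z t) l k) by apply: value_entry => f /zy /SS.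
  apply: value_cost (value_add (value_mul (value_inv (value_const m)) vC)
    (value_mul Sk (value_add (vy _) (vy _)))) _.
  by [].
have hy : derives S3 ((n + n) * m * (n + 6)) (entries (fun t =>
    - op_y (pb_C t) (pb_q t) (z t))).
  apply: derives_entries => l k.
  rewrite (_ : (fun t => _) = fun t => - (kap t *
      ((incidence R n *m st_x (z t)) l k - col_mx (st_p (z t)) (pb_q t k) l 0))); last first.
    apply/funext => t; rewrite /op_y [LHS]mxE; congr (- _).
    rewrite [LHS]mxE; congr (_ * _); rewrite [LHS]mxE; congr (_ + _).
    by rewrite [LHS]mxE; congr (- _); rewrite [LHS]mxE.
  have vA : value S3 (n * 1 + 1) (fun t => (incidence R n *m st_x (z t)) l k).
    have vx s : value S3 0 (fun t => st_x (z t) s k) by apply: value_entry => f /zx /SS.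
    case: (split_ordP l) => a ->.
      rewrite (_ : (fun t => _) = fun t => \sum_j st_x (z t) (mxvec_index a j) k); last first.
        by apply/funext => t; have [-> _] := incidence_entries (st_x (z t)) k.
      have := @value_sum R problem problem_input 'I_n S3 0
        (fun j t => st_x (z t) (mxvec_index a j) k).
      by rewrite card_ord; apply.
    rewrite (_ : (fun t => _) = fun t => \sum_i st_x (z t) (mxvec_index i a) k); last first.
      by apply/funext => t; have [_ ->] := incidence_entries (st_x (z t)) k.
    have := @value_sum R problem problem_input 'I_n S3 0
      (fun i t => st_x (z t) (mxvec_index i a) k).
    by rewrite card_ord; apply.
  have vq : value S3 0 (fun t => col_mx (st_p (z t)) (pb_q t k) l 0).
    case: (split_ordP l) => a ->.
      rewrite (_ : (fun t => _) = fun t => st_p (z t) a 0).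
        by apply: value_entry => f /zp /SS.
      by apply/funext => t; rewrite col_mxEu.
    rewrite (_ : (fun t => _) = fun t => q_mx t a k).
      by apply: value_entry => f /hq /SS.
    by apply/funext => t; rewrite col_mxEd mxE.
  apply: value_cost (value_opp (value_mul Sk (value_diff vA vq))) _.
  lia.
apply: derives_cost (derives_then hk (derives_then hz1 (derives_then h1
  (derives_cup (derives_cup hp hx) hy)))) _.
have e1 : (n <= n * n * m)%N by nia.
have e2 : (n * n <= n * n * m)%N by nia.
have e3 : (n * m <= n * n * m)%N by nia.
have e4 : (1 <= n * n * m)%N by nia.
lia.
Qed.

Let zs k t := zseq (pb_C t) (pb_q t) (pb_lam t) (pb_p1 t) (pb_sp t) (pb_sx t) (pb_sy t) k.
Let ws k t := wseq (pb_C t) (pb_q t) (pb_lam t) (pb_p1 t) (pb_sp t) (pb_sx t) (pb_sy t) k.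

(** Of the past w-iterates only the p-blocks are recorded, for the final average. *)
Let W N : set (problem -> R) :=
  [set f | exists2 j, (j < N)%N & entries (fun t => st_p (ws j t)) f].

(** 464 counts two evaluations of the operator at 200 and two proximal steps at 32; 5 pays for the
    initial state. *)
Lemma derives_iterates N : derives data ((5 + 464 * N) * (n * n * m))
  (W N `|` state_entries (zs N)).
Proof.
elim: N => [|N IH].
  have hp : derives data (n * 1 * 0) (entries pb_p1).
    by apply: derives_entries => i j; apply: value_entry => f ?; left; right.
  have hx : derives data (n * n * m * 3)
      (entries (fun=> const_mx (n * n)%:R^-1 : 'M[R]_(n * n, m))).
    apply: derives_entries => i j.
    rewrite (_ : (fun t => _) = fun=> (n * n)%:R^-1).
      exact: (value_inv (value_const _)).
    by apply/funext => t; rewrite mxE.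
  have hy : derives data ((n + n) * m * 1) (entries (fun=> 0 : 'M[R]_(n + n, m))).
    apply: derives_entries => i j.
    rewrite (_ : (fun t => _) = fun=> 0%:R); first exact: value_const.
    by apply/funext => t; rewrite mxE.
  apply: derives_sub (derives_cup (derives_cup hp hx) hy) => //.
    by move=> f [[j //]|].
  nia.
set F := W N `|` _ in IH; pose S := data `|` F.
pose g t := op (pb_C t) (pb_q t) (pb_lam t) (pb_p1 t) (zs N t).
pose g' t := op (pb_C t) (pb_q t) (pb_lam t) (pb_p1 t) (ws N t).
have h1 : derives S (200 * (n * n * m)) (state_entries g).
  by apply: derives_op => f ?; [left|right; right].
have h2 : derives (S `|` state_entries g) (32 * (n * n * m)) (state_entries (ws N)).
  by apply: derives_prox_step => f ?; [left; left|left; right; right|right].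
have h3 : derives (S `|` state_entries g `|` state_entries (ws N)) (200 * (n * n * m))
    (state_entries g').
  by apply: derives_op => f ?; [left; left; left|right].
have h4 : derives (S `|` state_entries g `|` state_entries (ws N) `|` state_entries g')
    (32 * (n * n * m)) (state_entries (zs N.+1)).
  by apply: derives_prox_step => f ?; [do 4 left|do 3 left; right; right|right].
apply: derives_sub (derives_trans IH (derives_trans h1 (derives_trans h2
  (derives_trans h3 h4)))) => //; last by lia.
move=> f [[j]|hf]; last by do 4 right.
rewrite ltnS leq_eqVlt => /orP[/eqP ->|jN] hf.
  by right; right; left; left; left.
by left; left; exists j.
Qed.

Lemma nth_map_index (J : eqType) (s : seq J) j (F : J -> R) : j \in s ->
  nth 0 (map F s) (index j s) = F j.
Proof. by move=> js; rewrite (nth_map j) ?index_mem// nth_index. Qed.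

Lemma allpairs_map (I J : eqType) (s : seq I) (u : seq J) (F : I -> J -> R) :
  [seq F i j | i <- s, j <- u] = [seq F ij.1 ij.2 | ij <- [seq (i, j) | i <- s, j <- u]].
Proof. by rewrite map_allpairs. Qed.

Lemma reach_data : @reach R problem problem_input 0 data.
Proof.
pose sC := [seq (i, j) | i <- enum 'I_n, j <- enum 'I_n].
pose sq := [seq (k, i) | k <- enum 'I_m, i <- enum 'I_n].
have mC ij : ij \in sC by case: ij => i j; apply: allpairs_f; rewrite mem_enum.
have mq ki : ki \in sq by case: ki => k i; apply: allpairs_f; rewrite mem_enum.
have dataE t : problem_input t = nth 0 ([:: pb_lam t; pb_sp t; pb_sx t; pb_sy t]
    ++ [seq pb_C t ij.1 ij.2 | ij <- sC] ++ [seq pb_p1 t i 0 | i <- enum 'I_n]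
    ++ [seq pb_q t ki.1 ki.2 0 | ki <- sq]).
  by rewrite /problem_input /problem_data !allpairs_map.
apply: (@reach_input _ _ _ _ (4 + (size sC + (n + size sq)))) => f.
have sn : size (enum 'I_n) = n by rewrite size_enum_ord.
case=> [[[[[[->|->]|->]|->]|[[i j] _ <-]]|[[i j] _ <-]]|[[i k] _ <-]].
- by exists 0%N => // t; rewrite dataE.
- by exists 1%N => // t; rewrite dataE.
- by exists 2%N => // t; rewrite dataE.
- by exists 3%N => // t; rewrite dataE.
- exists (index (i, j) sC).+4.
    by change (index (i, j) sC < size sC + (n + size sq))%N; rewrite ltn_addr// index_mem.
  by move=> t; rewrite dataE /= nth_cat size_map index_mem mC nth_map_index.
- exists (size sC + index i (enum 'I_n)).+4.
    change (size sC + index i (enum 'I_n) < size sC + (n + size sq))%N.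
    rewrite ltn_add2l ltn_addr//.
    by rewrite -[ltnRHS]sn index_mem mem_enum.
  move=> t; rewrite dataE /= nth_cat size_map ltnNge leq_addr /= addKn.
  by rewrite nth_cat size_map index_mem mem_enum nth_map_index ?mem_enum// (ord1 j).
- exists (size sC + (n + index (k, i) sq)).+4.
    change (size sC + (n + index (k, i) sq) < size sC + (n + size sq))%N.
    by rewrite !ltn_add2l index_mem mq.
  move=> t; rewrite dataE /= nth_cat size_map ltnNge leq_addr /= addKn.
  rewrite nth_cat size_map sn ltnNge leq_addr /= addKn nth_map_index//.
  by rewrite mxE.
Qed.

Lemma mirror_prox_program N : (0 < N)%N ->
  exists2 prog, (size prog <= 500 * (n * n * m * N))%N &
  forall C (q : 'I_m -> 'cV[R]_n) lam p1 sp sx sy,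
    computes prog (problem_data C q lam p1 sp sx sy)
      (mirror_prox_output (wseq C q lam p1 sp sx sy) N).
Proof.
move=> N0; pose F := W N `|` state_entries (zs N).
have hout : derives (data `|` F) (n * 1 * (N + 5))
    (entries (fun t => mirror_prox_output (fun k => ws k t) N)).
  apply: derives_entries => i j; rewrite (ord1 j).
  rewrite (_ : (fun t => _) = fun t => N%:R^-1 * \sum_(k < N) st_p (ws k t) i 0); last first.
    by apply/funext => t; rewrite mxE summxE.
  have := @value_sum R problem problem_input 'I_N (data `|` F) 0 (fun k t => st_p (ws k t) i 0).
  rewrite card_ord => hs.
  apply: value_cost (value_mul (value_inv (value_const N)) (hs _)) _; last by lia.
  by move=> k; apply: value_entry => f hf; right; left; exists k.
have := derives_then (derives_iterates N) hout (@subset_refl _ data) reach_data.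
move=> /reach_outputs/(_ (fun i => or_intror (entriesP _ i 0)))[prog].
rewrite add0n => hs hprog; exists prog.
  apply: leq_trans hs _.
  have e1 : (n <= n * n * m)%N by nia.
  move: e1; move: (n * n * m)%N => x e1.
  have e2 : (x <= x * N)%N by rewrite leq_pmulr.
  have e3 : (n * N <= x * N)%N by rewrite leq_mul2r e1 orbT.
  lia.
by move=> C q lam p1 sp sx sy i; exact: (hprog (Problem C q lam p1 sp sx sy)).
Qed.

End Mirror_prox.

(** * Choice of the parameters *)

Section Sizes.
Context {R : realType}.

Lemma natr_ceil (x : R) : 0 <= x -> x <= (`|Num.ceil x|%N)%:R <= x + 1.
Proof.
move=> x0; have c0 : 0 <= Num.ceil x by rewrite ceil_ge0 (lt_le_trans _ x0)// ltrN10.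
rewrite natr_absz (ger0_norm c0) ceil_ge /=.
have := ceilB1_lt x; rewrite intrB => h; lra.
Qed.

(** For |C| = 0 the formulas for m and eps' both return 0 and carry no information; the guarantee
    then holds because all costs vanish. *)
Lemma transport_norm0 n (C : 'M[R]_n) p q : (forall i j, 0 <= C i j) -> `|C| = 0 ->
  transport C p q = 0.
Proof.
move=> C0 K0; apply/le_anti; rewrite transport_ge0// andbT.
have CE i j : C i j = 0.
  by apply/eqP; rewrite -normr_le0 -K0; exact: entry_le_norm.
rewrite /transport; have [->|/set0P[_ [pl hpl _]]] :=
    eqVneq [set frobenius C pl | pl in plans p q] set0.
  by rewrite inf0.
apply: le_trans (transport_le_cost C0 hpl) _.
by rewrite /frobenius big1// => i _; rewrite big1// => j _; rewrite CE mul0r.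
Qed.

(** Choice over all triples of sizes fixes the programs before any instance is seen; degenerate
    sizes receive the empty program. *)
Lemma program_family : {prog : nat -> nat -> nat -> seq instr &
  forall n m N, (0 < n)%N -> (0 < m)%N -> (0 < N)%N ->
  (size (prog n m N) <= 500 * (n * n * m * N))%N /\
  forall (C : 'M[R]_n) (q : 'I_m -> 'cV[R]_n) lam p1 sp sx sy,
    computes (prog n m N) (problem_data C q lam p1 sp sx sy)
      (mirror_prox_output (wseq C q lam p1 sp sx sy) N)}.
Proof.
have [prog h] : {prog : nat * nat * nat -> seq instr & forall k,
    (0 < k.1.1)%N -> (0 < k.1.2)%N -> (0 < k.2)%N ->
  (size (prog k) <= 500 * (k.1.1 * k.1.1 * k.1.2 * k.2))%N /\
  forall (C : 'M[R]_k.1.1) (q : 'I_k.1.2 -> 'cV[R]_k.1.1) lam p1 sp sx sy,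
    computes (prog k) (problem_data C q lam p1 sp sx sy)
      (mirror_prox_output (wseq C q lam p1 sp sx sy) k.2)}.
  apply: (@boolp.choice _ _ (fun k prog => (0 < k.1.1)%N -> (0 < k.1.2)%N -> (0 < k.2)%N ->
    (size prog <= 500 * (k.1.1 * k.1.1 * k.1.2 * k.2))%N /\
    forall (C : 'M[R]_k.1.1) (q : 'I_k.1.2 -> 'cV[R]_k.1.1) lam p1 sp sx sy,
      computes prog (problem_data C q lam p1 sp sx sy)
        (mirror_prox_output (wseq C q lam p1 sp sx sy) k.2))) => -[[n m] N] /=.
  have [n0|/negP nn0] := boolP (0 < n)%N; last by exists [::].
  have [m0|/negP nm0] := boolP (0 < m)%N; last by exists [::].
  have [N0|/negP nN0] := boolP (0 < N)%N; last by exists [::].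
  by have [prog h1 h2] := @mirror_prox_program R n m n0 m0 N N0; exists prog.
by exists (fun n m N => prog (n, m, N)) => n m N; exact: h (n, m, N).
Qed.

(** Rounding N up costs 1, absorbed thanks to eps <= K; hence 1609 = 1608 + 1. *)
Lemma iterations_le (L lg K eps s : R) : 1/2 <= L -> L <= lg -> 1 <= lg -> 1 <= s ->
  0 < eps -> eps <= K ->
  1608 * K * s * lg ^+ 2 / ((4 * 96 * 64)^-1 / L * (eps ^+ 3 / K ^+ 2)) + 1 <=
  1609 * (4 * 96 * 64) * lg ^+ 3 * s * (K / eps) ^+ 3.
Proof.
move=> L2 Llg lg1 s1 e0 eK; have K0 : 0 < K := lt_le_trans e0 eK.
have L0 : 0 < L by lra.
have -> : 1608 * K * s * lg ^+ 2 / ((4 * 96 * 64)^-1 / L * (eps ^+ 3 / K ^+ 2)) =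
    1608 * (4 * 96 * 64) * (L * lg ^+ 2 * s * (K / eps) ^+ 3).
  by field; rewrite !gt_eqF.
have r1 : 1 <= K / eps by rewrite ler_pdivlMr// mul1r.
have r3 : 1 <= (K / eps) ^+ 3 by rewrite exprn_ege1.
move: r3; move: ((K / eps) ^+ 3) => r r1'; clear r1.
have g3 : 1 <= lg ^+ 3 by rewrite exprn_ege1.
have sr1 : 1 <= s * r by rewrite -[leLHS]mulr1 ler_pM.
have h1 : L * lg ^+ 2 * s * r <= lg ^+ 3 * (s * r).
  rewrite -mulrA [lg ^+ 3]exprS; apply: ler_wpM2r; first by lra.
  by apply: ler_wpM2r => //; rewrite exprn_ge0//; lra.
have h2 : 1 <= lg ^+ 3 * (s * r) by rewrite -[leLHS]mulr1 ler_pM.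
have -> : 1609 * (4 * 96 * 64) * lg ^+ 3 * s * r =
  1609 * (4 * 96 * 64) * (lg ^+ 3 * (s * r)) by ring.
by move: h1 h2; move: (L * _ * _ * _) (lg ^+ 3 * _) => x y; lra.
Qed.

(** Rounding m up costs 1, at most twice L (K / eps)^2 / beta because L >= 1/2; hence the added
    2. *)
Lemma samples_le (L lg K eps beta : R) : 1/2 <= L -> L <= lg ->
  0 < eps -> eps <= K -> 0 < beta -> beta < 1 ->
  4 * 96 * 8 * L ^+ 1 * (K ^+ 2 / (beta * eps ^+ 2)) + 1 <=
  (4 * 96 * 8 + 2) / beta * lg * (K / eps) ^+ 2.
Proof.
move=> L2 Llg e0 eK b0 b1.
have -> : 4 * 96 * 8 * L ^+ 1 * (K ^+ 2 / (beta * eps ^+ 2)) =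
    4 * 96 * 8 * (beta^-1 * L * (K / eps) ^+ 2) by field; rewrite !gt_eqF.
have r1 : 1 <= K / eps by rewrite ler_pdivlMr// mul1r.
have : 1 <= (K / eps) ^+ 2 by rewrite exprn_ege1.
move: ((K / eps) ^+ 2) => r r1'; clear r1.
have bi : 1 <= beta^-1 by rewrite -[leLHS]invr1 lef_pV2 ?posrE// ltW.
have br : 1 <= beta^-1 * r by rewrite -[leLHS]mulr1 ler_pM.
have -> : (4 * 96 * 8 + 2) / beta * lg * r = (4 * 96 * 8 + 2) * (lg * (beta^-1 * r)) by ring.
rewrite [beta^-1 * L]mulrC -[L * beta^-1 * r]mulrA.
have h1 : L * (beta^-1 * r) <= lg * (beta^-1 * r) by apply: ler_wpM2r => //; lra.
have h2 : 1/2 * (beta^-1 * r) <= L * (beta^-1 * r) by apply: ler_wpM2r => //; lra.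
by move: h1 h2 br; move: (beta^-1 * r) (lg * _) (L * _) => x y z; lra.
Qed.

End Sizes.

(** The programs are quantified before [beta] and the instance, so that one program per triple of
    sizes serves all data and step sizes. [Kc] comes after [beta], treated as fixed in the
    complexity. [delta] makes the distance of p1 to the boundary explicit; it enters through its
    logarithm. *)
Theorem theorem2p4p4 (R : realType) :
  exists (Km Ke KR : R) (km ke : nat) (prog : nat -> nat -> nat -> seq instr),
  [/\ 0 < Km, 0 < Ke & 0 < KR] /\
  forall beta : R, 0 < beta -> beta < 1 ->
  exists (Kc : R) (kc : nat),
  forall (n : nat) (C : 'M[R]_n) (P : probability (borel_cV R n) R)
    (p1 pstar : 'cV[R]_n) (eps Rd2 lam eps' : R) (m : nat),
  (1 < n)%N ->
  C^T = C -> (forall i j, 0 <= C i j) ->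
  P (simplex R n) = 1%E ->
  simplex R n p1 ->
  is_argmin (simplex R n) (expected_transport C P) pstar ->
  pstar != p1 ->
  0 < eps ->
  Rd2 = Bd pstar p1 ->
  lam = eps / (2 * Rd2) ->
  m = `|Num.ceil (Km * ln n%:R ^+ km * (`|C| ^+ 2 / (beta * eps ^+ 2)))|%N ->
  eps' = Ke / ln n%:R ^+ ke * (eps ^+ 3 / `|C| ^+ 2) ->
  [/\ Rd2 <= KR * ln n%:R,
      forall (d : measure_display) (O : measurableType d) (Pr : probability O R)
        (q : 'I_m -> O -> borel_cV R n) (phat : O -> 'cV[R]_n),
        iid Pr P q ->
        (forall o, simplex R n (phat o)) ->
        (forall o, penalized_gap C (fun k => q k o) lam p1 (phat o) <= eps') ->
        with_probability_at_least Pr (1 - beta)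
          [set o | expected_transport C P (phat o)
                   - expected_transport C P pstar <= eps]
    & forall delta : R,
        eps <= `|C| ->
        0 < delta -> (forall i, delta <= p1 i 0) ->
        exists (N : nat) (sp sx sy : R),
        [/\ (0 < N)%N, 0 < sp, 0 < sx & 0 < sy] /\
        ((size (prog n m N))%:R <=
           Kc * (ln n%:R + ln delta^-1) ^+ kc
              * (n%:R ^+ 2 * Num.sqrt n%:R * `|C| ^+ 5 / eps ^+ 5)) /\
        forall q : 'I_m -> 'cV[R]_n, (forall k, simplex R n (q k)) ->
        exists z w : nat -> state R n m,
        [/\ mirror_prox (saddle C q lam p1) sp sx sy p1 z w,
            penalized_gap C q lam p1 (mirror_prox_output w N) <= eps'
          & computes (prog n m N) (problem_data C q lam p1 sp sx sy)
              (mirror_prox_output w N)]].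
Proof.
have [prog progP] := @program_family R.
(* Rd2 <= 2 L gives lam >= eps / (4 L), and the midpoint gain has modulus lam / 96. The last factors
   are 8, for a stability term at most beta eps / 8, and 64 = 8^2, for a displacement costing at
   most eps / 8. *)
exists (4 * 96 * 8), (4 * 96 * 64)^-1, 2, 1%N, 1%N, prog.
split; first by split; rewrite ?invr_gt0; lra.
move=> beta b0 b1.
(* One logarithm comes from m and three from N: two from the rate and one from 1 / eps'. *)
exists (500 * ((4 * 96 * 8 + 2) / beta) * (1609 * (4 * 96 * 64))), 4%N.
move=> n C P p1 pstar eps Rd2 lam eps' m n_gt1 _ C0 P1 dp1 [dps _] ne e0 RdE lamE mE eE.
have RdL : Rd2 <= 2 * ln n%:R by rewrite RdE; exact: Bd_le.
have Rd0 : 0 < Rd2 by rewrite RdE; exact: Bd_gt0.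
have L2 : 1 / 2 <= ln n%:R :> R by exact: ln_n_ge.
have L0 : 0 < ln n%:R :> R by exact: ln_n_gt0.
have lam0 : 0 < lam by rewrite lamE divr_gt0// mulr_gt0.
have lam_ge : eps / (4 * ln n%:R) <= lam.
  rewrite lamE; apply: ler_wpM2l; first exact: ltW.
  by rewrite lef_pV2 ?posrE ?mulr_gt0//; lra.
have x0 : 0 <= 4 * 96 * 8 * ln n%:R ^+ 1 * (`|C| ^+ 2 / (beta * eps ^+ 2)) :> R.
  apply: mulr_ge0; first by apply: mulr_ge0 => //; apply/exprn_ge0/ltW.
  apply: divr_ge0; first by rewrite exprn_ge0.
  by apply: mulr_ge0; [exact: ltW|exact/exprn_ge0/ltW].
have /andP[m_ge m_le] := natr_ceil x0; rewrite -mE in m_ge m_le.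
have posK : 0 < `|C| -> 0 < eps' /\ (0 < m)%N.
  move=> K0; split.
    by rewrite eE expr1 !mulr_gt0 ?invr_gt0 ?exprn_gt0.
  rewrite -(ltr0n R); apply: lt_le_trans m_ge.
  by rewrite expr1 !mulr_gt0 ?invr_gt0 ?mulr_gt0 ?exprn_gt0.
split=> //.
- have [K0|KN0] := eqVneq `|C| 0.
    move=> d O Pr q phat _ _ _; exists setT; first split=> //.
      by rewrite probability_setT lee_fin; lra.
    move=> o _ /=; rewrite /expected_transport.
    have E0 p : \int[P]_q transport C p q = 0.
      under eq_Rintegral do rewrite transport_norm0//.
      by rewrite Rintegral_cst// mul0r.
    by rewrite !E0 subrr ltW.
  have K0 : 0 < `|C| by rewrite lt_neqAle eq_sym KN0 normr_ge0.
  have [e'0 m0] := posK K0; have mR : 0 < m%:R :> R by rewrite ltr0n.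
  apply: (statistical_bound n_gt1 (lam := lam) (eps' := eps')) => //.
  + rewrite -RdE lamE le_eqVlt; apply/orP; left; apply/eqP; field.
    by rewrite gt_eqF.
  + rewrite ler_pdivrMr ?mulr_gt0 ?divr_gt0//.
    apply: le_trans (_ : beta * eps / 8 * (eps / (4 * ln n%:R) / 96 *
      (4 * 96 * 8 * ln n%:R ^+ 1 * (`|C| ^+ 2 / (beta * eps ^+ 2)))) <= _).
      rewrite le_eqVlt; apply/orP; left; apply/eqP; field.
      by rewrite !gt_eqF.
    apply: ler_wpM2l; first by rewrite !mulr_ge0 ?ltW.
    apply: ler_pM => //; first by rewrite !mulr_ge0 ?invr_ge0 ?mulr_ge0 ?ltW.
    by rewrite ler_pM2r ?invr_gt0.
  + apply: le_trans (_ : eps / (4 * ln n%:R) / 96 * (eps / 8) ^+ 2 <= _).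
      rewrite eE le_eqVlt; apply/orP; left; apply/eqP; field.
      by rewrite !gt_eqF.
    apply: ler_wpM2r; first by rewrite exprn_ge0// divr_ge0 ?ltW.
    by rewrite ler_pM2r ?invr_gt0.
move=> delta eK d0 p1d; have K0 : 0 < `|C| := lt_le_trans e0 eK.
have [e'0 m0] := posK K0; have n0 : (0 < n)%N := ltnW n_gt1.
have mR : 0 < m%:R :> R by rewrite ltr0n.
have nR : 0 < n%:R :> R by rewrite ltr0n.
have sq0 : 0 < Num.sqrt n%:R :> R by rewrite sqrtr_gt0.
have sq1 : 1 <= Num.sqrt n%:R :> R.
  by rewrite -[leLHS]sqrtr1; apply: ler_wsqrtr; rewrite ler1n.
have LD := L_le_D n_gt1 dp1 d0 p1d.
set lg : R := ln n%:R + ln delta^-1.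
have lg1 : 1 <= lg by rewrite /lg; move: LD L2; move: (ln _) (ln _) => x y; lra.
have Llg : ln n%:R <= lg by rewrite /lg; move: LD L2; move: (ln _) (ln _) => x y; lra.
pose B : R := 1608 * `|C| * Num.sqrt n%:R * lg ^+ 2.
have lg0 : 0 < lg := lt_le_trans ltr01 lg1.
have B0 : 0 < B.
  apply: mulr_gt0; last exact: exprn_gt0.
  by do 2 (apply: mulr_gt0; last by []); rewrite ltr0n.
have /andP[N_ge N_le] := natr_ceil (ltW (divr_gt0 B0 e'0)).
set N := `|_|%N in N_ge N_le.
have NR : 0 < N%:R :> R by apply: lt_le_trans N_ge; exact: divr_gt0.
have N0 : (0 < N)%N by rewrite -(ltr0n R).
pose sp : R := (4 * `|C| * Num.sqrt n%:R + lam * (32 * ln n%:R + 1))^-1.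
pose sx : R := (8 * `|C| * Num.sqrt n%:R / m%:R)^-1.
pose sy : R := (4 * `|C| / (m%:R * Num.sqrt n%:R))^-1.
have sp0 : 0 < sp.
  rewrite /sp invr_gt0; apply: addr_gt0; first by rewrite !mulr_gt0.
  by apply: mulr_gt0 => //; move: L0; move: (ln _) => x; lra.
have sx0 : 0 < sx by rewrite /sx invr_gt0 divr_gt0// !mulr_gt0.
have sy0 : 0 < sy by rewrite /sy invr_gt0 divr_gt0// !mulr_gt0.
have [size_prog prog_computes] := progP n m N n0 m0 N0.
exists N, sp, sx, sy; split=> //; split.
  apply: le_trans (_ : 500 * (n%:R ^+ 2 * m%:R * N%:R) <= _).
    apply: le_trans (_ : (500 * (n * n * m * N))%:R <= _); first by rewrite ler_nat.
    by rewrite !natrM expr2.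
  have mle := le_trans m_le (samples_le L2 Llg e0 eK b0 b1).
  have Nle : N%:R <= 1609 * (4 * 96 * 64) * lg ^+ 3 * Num.sqrt n%:R * (`|C| / eps) ^+ 3.
    apply: le_trans N_le _; rewrite eE.
    exact: iterations_le.
  apply: le_trans (_ : 500 * (n%:R ^+ 2 * ((4 * 96 * 8 + 2) / beta * lg * (`|C| / eps) ^+ 2)
    * (1609 * (4 * 96 * 64) * lg ^+ 3 * Num.sqrt n%:R * (`|C| / eps) ^+ 3)) <= _).
    apply: ler_wpM2l; first by rewrite ler0n.
    apply: ler_pM Nle; [|exact: ler0n|].
      by apply: mulr_ge0; [exact/exprn_ge0/ltW|exact: ltW].
    by apply: ler_wpM2l mle; exact/exprn_ge0/ltW.
  rewrite le_eqVlt; apply/orP; left; apply/eqP.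
  move: (4 * 96 * 8 + 2) (1609 * (4 * 96 * 64)) (500) => c1 c2 c3.
  field; by rewrite !gt_eqF.
move=> q dq; have p1_gt0 i : 0 < p1 i 0 := lt_le_trans d0 (p1d i).
exists (zseq C q lam p1 sp sx sy), (wseq C q lam p1 sp sx sy); split.
- exact: mirror_prox_seq.
- apply: le_trans (_ : B / N%:R <= _); last first.
    by rewrite ler_pdivrMr// mulrC -ler_pdivrMr.
  by apply: mirror_prox_rate; rewrite /sp /sx /sy ?invrK.
- exact: prog_computes.
Qed.
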